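(* Let $\mathbf Y=\mathbf H(z,\mathbf Y)$ be an irreducible system of dimension $m$, with generating function solution $\mathbf Y$ of radius of convergence $\rho$. If $(\rho,\mathbf Y(\rho))$ lies inside the domain of convergence of $\mathbf H$, then there exists a neighborhood of $\boldsymbol\zeta:=(\mathbf Y(\rho),\rho)$ such that Newton's iteration for the characteristic system \[\mathbf Y-\mathbf H(z,\mathbf Y)=\mathbf 0,\qquad \det\Big(\mathrm{Id}-\tfrac{\partial\mathbf H}{\partial\mathbf Y}(z,\mathbf Y)\Big)=0\] in the unknowns $(\mathbf Y,z)$ converges quadratically to $\boldsymbol\zeta$ when started in that neighborhood.
   Context: Let $\mathbf H=(H_1,\dots,H_m)$, written $\mathbf H(z,\mathbf Y)$, be analytic in a neighborhood of $\mathbf 0\in\mathbb C^{m+1}$; its domain of convergence is that of its Taylor series at $\mathbf 0$. The system is well founded when (i) each $H_i$ has nonnegative real Taylor coefficients at $\mathbf 0$; (ii) with $\mathbf U^{[0]}=\mathbf 0$, for $k=0,\dots,m$, $(0,\mathbf U^{[k]})$ lies in the domain of convergence, so that $\mathbf U^{[k+1]}=\mathbf H(0,\mathbf U^{[k]})$ is defined; (iii) $\partial\mathbf H/\partial\mathbf Y$ at $(0,\mathbf U^{[m]})$ is nilpotent. The generating function solution is the unique solution analytic near $0$ with value $\mathbf U^{[m]}$ at $0$; $\mathbf Y(\rho)$ is its limit as $z\to\rho^-$. The system is irreducible if it is well founded, zero-free (no coordinate of the solution identically zero), recursive ($\partial\mathbf H/\partial\mathbf Y$ not nilpotent as a matrix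 of functions), and its dependency graph (edge $i\to j$ when $H_i$ depends on $Y_j$) is strongly connected. *)

(* Defs.v *)
From HB Require Import structures.
From mathcomp Require Import all_boot all_order all_algebra.
From mathcomp Require Import all_classical all_reals all_analysis.
From mathcomp Require Import complex.

Set Implicit Arguments.
Unset Strict Implicit.
Unset Printing Implicit Defensive.
Import Order.TTheory GRing.Theory Num.Theory.
Import numFieldTopology.Exports numFieldNormedType.Exports.

Local Open Scope classical_set_scope.
Local Open Scope ring_scope.
Local Open Scope complex_scope.

(* The complex numbers, named so that [numFieldNormedType] gives them their
   usual topology; [R[i]] itself carries none. In this type [0 <= x] means
   "x is a nonnegative real", and norms [`|x|] are complex-valued. *)
Definition Cplx (R : realType) : numClosedFieldType := R[i].

Definition ofR (R : realType) (x : R) : Cplx R := x%:C.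

Definition modulus (R : realType) (z : Cplx R) : R := complex.Re `|z|.

Section PowerSeries.
Context {R : realType} {n : nat}.
Local Notation C := (Cplx R).
Implicit Types (c : {ffun 'I_n -> nat} -> C) (x : 'rV[C]_n).

Definition monomial (a : {ffun 'I_n -> nat}) x : C := \prod_i x 0 i ^+ a i.

Definition abs_convergent c x : Prop :=
  summable [set: {ffun 'I_n -> nat}]
    (fun a => (modulus (c a * monomial a x))%:E).

(* The sum of the series, taken along the boxes [0, N[^n; the order of
   summation is irrelevant wherever the series converges absolutely. *)
Definition psum c x : C :=
  limn (fun N => \sum_(b : {ffun 'I_n -> 'I_N})
    c [ffun i => b i : nat] * monomial [ffun i => b i : nat] x).

End PowerSeries.

(* [h i a] is the Taylor coefficient at 0 of [H_i] on the monomial of exponent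
   [a]; variable 0 is [z] and variable [1 + j] is [Y_j]. *)
Definition psystem (R : realType) (m : nat) :=
  'I_m -> {ffun 'I_(1 + m) -> nat} -> Cplx R.

Section Systems.
Context {R : realType} {m : nat}.
Local Notation C := (Cplx R).
Implicit Types (h : psystem R m) (z : C) (Y : 'rV[C]_m) (p : 'rV[C]_(1 + m)).

Definition zY z Y : 'rV[C]_(1 + m) := row_mx z%:M Y.

Definition Hfun h p : 'rV[C]_m := \row_i psum (h i) p.

(* The domain of convergence is open: the interior of the set of points of
   absolute convergence. *)
Definition cvg_domain h : set 'rV[C]_(1 + m) :=
  interior [set p | forall i, abs_convergent (h i) p].

(* [jacobian] acts on row vectors, hence is the transpose of the usual one:
   [dHdY h p i j] is the partial derivative of [H_i] with respect to [Y_j]. *)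
Definition dHdY h p : 'M[C]_m := (dsubmx (jacobian (Hfun h) p))^T.

Definition Uiter h (k : nat) : 'rV[C]_m := iter k (fun u => Hfun h (zY 0 u)) 0.

(* [Uiter h 0 = 0], so the second clause contains the analyticity of [H] at 0. *)
Definition well_founded_system h : Prop :=
  [/\ forall i a, 0 <= h i a,
      forall k, (k <= m)%N -> cvg_domain h (zY 0 (Uiter h k)) &
      exists k, dHdY h (zY 0 (Uiter h m)) ^+ k = 0].

(* A vector [y] of univariate power series is given by its coefficients. *)
Definition gf (y : nat -> 'rV[C]_m) z : 'rV[C]_m :=
  limn (series (fun k => z ^+ k *: y k)).

Definition cvg_radius (y : nat -> 'rV[C]_m) : \bar R :=
  ereal_sup [set (modulus z)%:E |
    z in [set z | cvgn (series (fun k => z ^+ k *: y k))]].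

Definition gf_solution h (y : nat -> 'rV[C]_m) : Prop :=
  [/\ (0 < cvg_radius y)%E, gf y 0 = Uiter h m &
      \forall z \near (0 : C),
        cvg_domain h (zY z (gf y z)) /\ gf y z = Hfun h (zY z (gf y z))].

Definition zero_free_system h : Prop :=
  forall y, gf_solution h y -> forall i, exists k, y k 0 i != 0.

Definition recursive_system h : Prop :=
  ~ exists k, forall p, cvg_domain h p -> dHdY h p ^+ k = 0.

Definition depends_on h (i j : 'I_m) : Prop :=
  exists2 p, cvg_domain h p & dHdY h p i j != 0.

Definition strongly_connected_system h : Prop :=
  forall i j, connect [rel i' j' | `[< depends_on h i' j' >]] i j.

Definition irreducible_system h : Prop :=
  [/\ well_founded_system h, zero_free_system h, recursive_system h &
      strongly_connected_system h].

(* The unknowns of the characteristic system come in the order (Y, z). *)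
Definition zY_of_Yz (x : 'rV[C]_(m + 1)) : 'rV[C]_(1 + m) :=
  zY (rsubmx x 0 0) (lsubmx x).

Definition char_system h (x : 'rV[C]_(m + 1)) : 'rV[C]_(m + 1) :=
  row_mx (lsubmx x - Hfun h (zY_of_Yz x))
         (\det (1%:M - dHdY h (zY_of_Yz x)))%:M.

End Systems.

Section Newton.
Context {R : realType} {n : nat}.
Local Notation C := (Cplx R).
Implicit Types (F : 'rV[C]_n -> 'rV[C]_n) (x l : 'rV[C]_n) (D V : set 'rV[C]_n).

(* The row-vector form of x - F'(x)^-1 F(x). *)
Definition newton F x : 'rV[C]_n := x - F x *m invmx (jacobian F x).

(* [F] is only meaningful on [D], and [invmx] only on invertible matrices, so
   that the iteration is defined as long as both side conditions hold. *)
Definition newton_cvg_quadratically D F V l : Prop :=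
  exists c : R, forall x0, V x0 ->
    let x k := iter k (newton F) x0 in
    [/\ forall k, D (x k) /\ jacobian F (x k) \in unitmx,
        x @ \oo --> l &
        forall k, `|x k.+1 - l| <= ofR c * `|x k - l| ^+ 2].

End Newton.

(* Main.v *)
Require Import Defs.
From HB Require Import structures.
From mathcomp Require Import all_boot all_order all_algebra.
From mathcomp Require Import perm.
From mathcomp Require Import all_classical all_reals all_analysis.
From mathcomp Require Import complex ring lra.

Import Order.TTheory GRing.Theory Num.Theory.
Import numFieldTopology.Exports numFieldNormedType.Exports.

Local Open Scope classical_set_scope.
Local Open Scope ring_scope.

Set Implicit Arguments.
Unset Strict Implicit.
Unset Printing Implicit Defensive.

(** Newton's iteration converges quadratically near a zero where the Jacobian is
    invertible, so the point is that the Jacobian of the characteristic system is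
    invertible at [zeta = (tau, rho)].

    Call [(x, Z)], [x > 0], a supersolution when [H(x, Z) <= Z]. Comparing
    coefficients degree by degree shows that the coefficients of [Y] are
    nonnegative and that every partial sum of [Y] at [x] is bounded by [Z]; hence
    there is no supersolution with [x > rho]. On the other hand, a fixed point
    [(x0, Z0)] at which [(1 - A) w = 1], [A = dH/dY], has a solution [w >= 0] is
    perturbed, in the direction [w], into a supersolution with [x > x0].

    Convexity of [H] gives [A(x, Y x) (tau - Y x) <= tau - Y x] for [x < rho], and
    by compactness there is [w > 0] with [A w <= w] at [zeta]. If [1 - A] were
    invertible there would be a supersolution beyond [rho], so [1 - A] is singular;
    irreducibility then makes its kernels one-dimensional, spanned by positive
    vectors [w] and [u], and its adjugate is a nonzero multiple of [w u].
    A kernel vector of the Jacobian vanishes as soon as [u H_z] and [u d2H(w, w)] are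
    nonzero. If [H_z = 0] then [(rho + 1, tau)] is a supersolution; if [H] is affine
    in [Y] then [u H(rho, 0) = u (tau - A tau) = 0] makes [(rho, 0)] a supersolution;
    both are impossible. *)

(** * Limits of complex sequences *)

Section OrderedLimits.
Context {K : numFieldType}.

Lemma cvg_ge0 (T : Type) (F : set_system T) {FF : ProperFilter F}
    (f : T -> K) (a : K) :
  f @ F --> a -> (\forall t \near F, 0 <= f t) -> 0 <= a.
Proof.
move=> fa f0; suff <- : `|a| = a by [].
apply: (@norm_cvg_unique K K (f @ F)) => //.
apply: cvg_trans (cvg_norm fa); apply: near_eq_cvg => /=.
by apply: filterS f0 => t /= /ger0_norm ->.
Qed.

Lemma cvg_le (T : Type) (F : set_system T) {FF : ProperFilter F}
    (f g : T -> K) (a b : K) :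
  f @ F --> a -> g @ F --> b -> (\forall t \near F, f t <= g t) -> a <= b.
Proof.
move=> fa gb fg; rewrite -subr_ge0; apply: (cvg_ge0 (cvgB gb fa)).
by apply: filterS fg => t /=; rewrite !fctE subr_ge0.
Qed.

Lemma cvg_seq_le (u v : nat -> K) (a b : K) :
  u @ \oo --> a -> v @ \oo --> b -> (forall n, u n <= v n) -> a <= b.
Proof. by move=> ua vb uv; apply: (cvg_le ua vb); exact: nearW. Qed.

Lemma cvg_seq_le_cst (u : nat -> K) (a b : K) :
  u @ \oo --> a -> (forall n, u n <= b) -> a <= b.
Proof. by move=> ua; apply: (cvg_seq_le ua); exact: cvg_cst. Qed.

Lemma nondecreasing_cvg_ge (u : nat -> K) (a : K) :
  nondecreasing_seq u -> u @ \oo --> a -> forall n, u n <= a.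
Proof.
move=> u_nd ua n; apply: (cvg_le (@cvg_cst _ (u n) nat \oo _) ua).
by exists n => // k /= nk; exact: u_nd.
Qed.

Lemma cvg_exprn (T : Type) (F : set_system T) {FF : Filter F} (f : T -> K) (a : K) n :
  f @ F --> a -> f t ^+ n @[t --> F] --> a ^+ n.
Proof.
move=> fa; elim: n => [|n IH]; first by under eq_cvg do rewrite expr0; exact: cvg_cst.
by rewrite exprS; under eq_cvg do rewrite exprS; exact: cvgM.
Qed.

Lemma near0_right_mul_le (M e : K) :
  0 <= M -> 0 < e -> \forall x \near 0^'+, x * M <= e.
Proof.
move=> M0 e0; have d0 : 0 < e / (M + 1) by rewrite divr_gt0 // ltr_wpDl.
apply: filterS2 (nbhs_right_ge (0 : K)) (nbhs_right_le d0) => x x0.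
rewrite ler_pdivlMr ?ltr_wpDl //; apply: le_trans.
by rewrite ler_wpM2l // lerDl.
Qed.

End OrderedLimits.

Section DominatedIncrements.
Context {K : numDomainType}.
Implicit Types u v : nat -> K.

Definition dominated_increments u v := forall n, `|u n.+1 - u n| <= v n.+1 - v n.

Lemma dominated_increments_nondecreasing u v :
  dominated_increments u v -> nondecreasing_seq v.
Proof.
by move=> uv; apply/nondecreasing_seqP => n; rewrite -subr_ge0 (le_trans _ (uv n)).
Qed.

Lemma dominated_increments_le u v : dominated_increments u v ->
  forall m n, (m <= n)%N -> `|u n - u m| <= v n - v m.
Proof.
move=> uv m n /subnK <-; elim: (n - m)%N => [|p IH]; first by rewrite add0n !subrr normr0.
rewrite addSn -[u _.+1](subrK (u (p + m)%N)) -addrA.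
rewrite -[v _.+1](subrK (v (p + m)%N)) -[leRHS]addrA.
by apply: le_trans (ler_normD _ _) _; apply: lerD.
Qed.

End DominatedIncrements.

Section ComplexNumbers.
Context {R : realType}.
Local Notation C := (Cplx R).
Implicit Types (x y : R) (z : C).

Fact ofR_is_zmod_morphism : zmod_morphism (@ofR R).
Proof. by move=> x y; rewrite /ofR rmorphB. Qed.
HB.instance Definition _ :=
  GRing.isZmodMorphism.Build R (Cplx R) (@ofR R) ofR_is_zmod_morphism.

Fact ofR_is_monoid_morphism : monoid_morphism (@ofR R).
Proof. by split=> [|x y]; rewrite /ofR ?rmorph1 ?rmorphM. Qed.
HB.instance Definition _ :=
  GRing.isMonoidMorphism.Build R (Cplx R) (@ofR R) ofR_is_monoid_morphism.

Lemma ler_ofR x y : (ofR x <= ofR y) = (x <= y).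
Proof. exact: lecR. Qed.

Lemma ltr_ofR x y : (ofR x < ofR y) = (x < y).
Proof. exact: ltcR. Qed.

Lemma ofR_ge0 x : (0 <= ofR x) = (0 <= x).
Proof. by rewrite -[0]/(ofR 0) ler_ofR. Qed.

Lemma ofR_gt0 x : (0 < ofR x) = (0 < x).
Proof. by rewrite -[0]/(ofR 0) ltr_ofR. Qed.

Lemma ge0_ofR_Re z : 0 <= z -> z = ofR (complex.Re z).
Proof. by case: z => a b; rewrite lecE /= => /andP[/eqP-> _]. Qed.

Lemma Re_ge0 z : 0 <= z -> 0 <= complex.Re z.
Proof. by move=> z0; rewrite -ofR_ge0 -ge0_ofR_Re. Qed.

Lemma ofR_modulus z : ofR (modulus z) = `|z|.
Proof. by rewrite -ge0_ofR_Re. Qed.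

Lemma modulus_ge0 z : 0 <= modulus z.
Proof. exact: Re_ge0. Qed.

Lemma normr_ofR x : `|ofR x| = ofR `|x|.
Proof.
have [x0|x0] := leP 0 x; first by rewrite !ger0_norm ?ofR_ge0.
by rewrite (ltr0_norm x0) -normrN -rmorphN ger0_norm // ofR_ge0 oppr_ge0 ltW.
Qed.

Lemma continuous_ofR : continuous (@ofR R : R -> C).
Proof.
move=> x; apply/cvgrPdist_lt => e e0.
have eE := ge0_ofR_Re (ltW e0); rewrite eE ofR_gt0 in e0.
have /cvgrPdist_lt /(_ _ e0) : y @[y --> x] --> x by exact: cvg_id.
by apply: filterS => y; rewrite -rmorphB normr_ofR eE ltr_ofR.
Qed.

Lemma cvg_ofR (T : Type) (F : set_system T) {FF : Filter F} (f : T -> R) (l : R) :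
  f @ F --> l -> ofR (f t) @[t --> F] --> ofR l.
Proof. by move=> fl; apply: (continuous_cvg _ (continuous_ofR (x := l)) fl). Qed.

Lemma nondecreasing_bounded_cvgn (u : nat -> C) (M : C) :
  nondecreasing_seq u -> (forall n, u n <= M) -> cvgn u.
Proof.
move=> u_nd uM; pose v n := complex.Re (u n - u 0%N).
have uE n : u n = u 0%N + ofR (v n).
  by rewrite /v -ge0_ofR_Re ?subrKC // subr_ge0 u_nd.
have v_cvg : v @ \oo --> limn v.
  apply: nondecreasing_is_cvgn => [i j ij|].
    by rewrite -ler_ofR -(lerD2l (u 0%N)) -!uE u_nd.
  exists (complex.Re (M - u 0%N)) => _ [n _ <-].
  rewrite -ler_ofR -ge0_ofR_Re; last by rewrite subr_ge0.
  by rewrite lerBrDl -uE.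
apply/cvg_ex; exists (u 0%N + ofR (limn v)).
rewrite [u in u @ _](_ : _ = fun n => u 0%N + ofR (v n)); last exact/funext.
by apply: cvgD; [exact: cvg_cst|exact: cvg_ofR].
Qed.

Lemma dominated_increments_cvgn_real (u v : R^nat) (M : R) :
    dominated_increments u v -> (forall n, v n <= M) -> cvgn u.
Proof.
move=> uv vM; have v_nd := dominated_increments_nondecreasing uv.
have cv : cvgn (u + v).
  apply: nondecreasing_is_cvgn.
    apply/nondecreasing_seqP => n; rewrite !fctE.
    by have := uv n; rewrite ler_norml; lra.
  exists (u 0%N - v 0%N + M + M) => _ [n _ <-]; rewrite fctE.
  have := dominated_increments_le uv (leq0n n); rewrite ler_norml.
  by have := vM n; lra.
have -> : u = (u + v) - v by rewrite addrK.
apply: is_cvgB => //; apply: nondecreasing_is_cvgn => //.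
by exists M => _ [n _ <-].
Qed.

Lemma dominated_increments_cvgn (u v : nat -> C) (M : C) :
    dominated_increments u v -> (forall n, v n <= M) -> cvgn u.
Proof.
move=> uv vM; pose w n := complex.Re (v n - v 0%N).
have v_nd := dominated_increments_nondecreasing uv.
have wE n : ofR (w n) = v n - v 0%N by rewrite -ge0_ofR_Re // subr_ge0 v_nd.
have part_cvg (p : C -> R) : {morph p : x y / x - y} ->
    (forall z, ofR `|p z| <= `|z|) -> cvgn (p \o u).
  move=> pB p_le; apply: (@dominated_increments_cvgn_real _ w (complex.Re (M - v 0%N))) => n.
    rewrite -ler_ofR [leRHS]rmorphB /= !wE opprB addrA subrK -pB.
    exact: le_trans (p_le _) (uv n).
  by rewrite -ler_ofR wE -ge0_ofR_Re ?subr_ge0 // lerD2r.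
have Re_cvg : cvgn (@complex.Re R \o u).
  by apply: part_cvg => [z z'|z]; [exact: raddfB|exact: normc_ge_Re].
have Im_cvg : cvgn (@complex.Im R \o u).
  apply: part_cvg => [z z'|z]; first exact: raddfB.
  have -> : complex.Im z = - complex.Re ('i%C * z) by case: z => a b; simpc.
  by rewrite normrN (le_trans (normc_ge_Re _)) // normrM normCi mul1r.
rewrite [u](_ : _ = fun n => ofR (complex.Re (u n)) + 'i%C * ofR (complex.Im (u n))).
  apply/cvg_ex; eexists; apply: cvgD; first exact: cvg_ofR Re_cvg.
  by apply: cvgMl_tmp; exact: cvg_ofR Im_cvg.
by apply/funext => n; exact: complexE.
Qed.

Lemma dominated_increments_lim (u v : nat -> C) (M : C) :
    dominated_increments u v -> (forall n, v n <= M) ->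
  forall n, `|limn u - u n| <= M - v n.
Proof.
move=> uv vM n; have u_cvg := dominated_increments_cvgn uv vM.
apply: (cvg_le (cvg_norm (cvgB u_cvg (cvg_cst (u n)))) (cvg_cst _)).
exists n => // k /= nk; rewrite !fctE; apply: le_trans (dominated_increments_le uv nk) _.
by rewrite lerD2r.
Qed.

End ComplexNumbers.
(** * Sums over boxes of exponents *)

Section Boxes.
Context {n : nat}.
Local Notation expo := {ffun 'I_n -> nat}.

Definition box (N : nat) : seq expo :=
  [seq [ffun i => b i : nat] | b : {ffun 'I_n -> 'I_N}].

Lemma box_uniq N : uniq (box N).
Proof.
rewrite map_inj_uniq ?enum_uniq // => b b' /ffunP e; apply/ffunP => i.
by have := e i; rewrite !ffunE => /val_inj.
Qed.

Lemma mem_box N (a : expo) : (a \in box N) = [forall i, (a i < N)%N].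
Proof.
apply/mapP/forallP => [[b _ ->] i|aN]; first by rewrite ffunE.
exists [ffun i => Ordinal (aN i)]; first by rewrite mem_enum.
by apply/ffunP => i; rewrite !ffunE.
Qed.

Lemma sub_box (s : seq expo) : exists N, {subset s <= box N}.
Proof.
exists (\max_(a <- s) \max_i a i).+1 => a sa; rewrite mem_box; apply/forallP => i.
by rewrite ltnS (leq_trans (leq_bigmax i)) // (big_rem a sa) leq_maxl.
Qed.

Definition box_sum (V : nmodType) N (F : expo -> V) : V := \sum_(a <- box N) F a.

Lemma box_sumS (V : nmodType) N (F : expo -> V) :
  box_sum N.+1 F = box_sum N F + \sum_(a <- box N.+1 | a \notin box N) F a.
Proof.
rewrite [LHS](bigID (mem (box N))) /= -big_filter; congr (_ + _).
apply: perm_big; apply: uniq_perm; rewrite ?filter_uniq ?box_uniq // => a.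
rewrite mem_filter !mem_box andb_idr // => /forallP aN.
by apply/forallP => i; rewrite ltnS ltnW ?aN.
Qed.

Lemma box_sumZ (V : pzSemiRingType) N (k : V) (F : expo -> V) :
  box_sum N (fun a => k * F a) = k * box_sum N F.
Proof. by rewrite /box_sum mulr_sumr. Qed.

Section Normed.
Context {K : numDomainType}.
Implicit Types F G : expo -> K.

Definition box_bounded F := exists M, forall N, box_sum N (fun a => `|F a|) <= M.

Lemma ler_box_sum N F G : (forall a, F a <= G a) -> box_sum N F <= box_sum N G.
Proof. by move=> FG; apply: ler_sum. Qed.

Lemma box_sum_ge0 N F : (forall a, 0 <= F a) -> 0 <= box_sum N F.
Proof. by move=> F0; apply: sumr_ge0. Qed.

Lemma box_sum_nondecreasing F :
  (forall a, 0 <= F a) -> nondecreasing_seq (fun N => box_sum N F).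
Proof.
by move=> F0; apply/nondecreasing_seqP => N; rewrite box_sumS lerDl sumr_ge0.
Qed.

Lemma box_sum_ge_term F (a : expo) :
  (forall a, 0 <= F a) -> exists N, F a <= box_sum N F.
Proof.
move=> F0; have [N sN] := sub_box [:: a]; exists N.
by rewrite /box_sum (big_rem a) ?sN ?mem_head //= lerDl sumr_ge0.
Qed.

Lemma box_bounded_le F G (k : K) : 0 <= k -> (forall a, `|F a| <= k * `|G a|) ->
  box_bounded G -> box_bounded F.
Proof.
move=> k0 FG [M GM]; exists (k * M) => N.
by rewrite (le_trans (ler_box_sum _ FG)) // box_sumZ ler_wpM2l.
Qed.

End Normed.

Section Limit.
Context {R : realType}.
Local Notation C := (Cplx R).
Implicit Types F : expo -> C.

Definition box_limit F : C := limn (fun N => box_sum N F).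

Lemma cvg_box_sum F : box_bounded F -> (fun N => box_sum N F) @ \oo --> box_limit F.
Proof.
case=> M FM; apply: dominated_increments_cvgn FM => N.
by rewrite !box_sumS ![_ + _ - _]addrAC !subrr !add0r ler_norm_sum.
Qed.

Lemma box_sum_le_limit F :
  (forall a, 0 <= F a) -> box_bounded F -> forall N, box_sum N F <= box_limit F.
Proof.
move=> F0 bF; apply: nondecreasing_cvg_ge (cvg_box_sum bF).
exact: box_sum_nondecreasing.
Qed.

Lemma box_limit_ge0 F : (forall a, 0 <= F a) -> box_bounded F -> 0 <= box_limit F.
Proof. by move=> F0 /(box_sum_le_limit F0)/(_ 0%N); apply/le_trans/box_sum_ge0. Qed.

Lemma term_le_box_limit F a :
  (forall a, 0 <= F a) -> box_bounded F -> F a <= box_limit F.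
Proof.
move=> F0 /(box_sum_le_limit F0) sF; have [N /le_trans] := box_sum_ge_term a F0.
exact.
Qed.

Lemma box_limit_le F M :
  box_bounded F -> (forall N, box_sum N F <= M) -> box_limit F <= M.
Proof. by move=> bF; apply: cvg_seq_le_cst (cvg_box_sum bF). Qed.

Lemma box_limit0 F : (forall a, F a = 0) -> box_limit F = 0.
Proof.
move=> F0; rewrite /box_limit (_ : (fun N => _) = fun=> 0) ?lim_cst //.
by apply/funext => N; rewrite /box_sum big1.
Qed.

End Limit.
End Boxes.

(** * Second order approximation *)

Lemma leibniz_cons (K : comNzRingType) (I : eqType) (i : I) (r : seq I) (d g : I -> K) :
  i \notin r ->
  \sum_(k <- i :: r) d k * \prod_(j <- i :: r | j != k) g j =
  d i * \prod_(j <- r) g j + g i * \sum_(k <- r) d k * \prod_(j <- r | j != k) g j.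
Proof.
move=> ir; rewrite big_cons; congr (_ + _).
  rewrite big_cons eqxx /=; congr (_ * _); rewrite [RHS]big_seq_cond [LHS]big_seq_cond.
  by apply: eq_bigl => j; case: eqVneq => [->|]; rewrite ?(negPf ir) ?andbT.
rewrite mulr_sumr; apply: eq_big_seq => k kr.
rewrite big_cons; case: eqVneq => [e|_]; first by rewrite -e in kr; rewrite kr in ir.
by rewrite mulrCA.
Qed.

Section SecondOrderApproximation.
Context {K : numDomainType}.
Implicit Types l b c : K.

(* [g'] and [g] are the values of a function at two nearby points and [dg] is
   its differential at the second point, applied to the displacement. *)
Definition taylor2 l b (g' g dg : K) : Prop :=
  [/\ `|g'| <= b, `|g| <= b, `|g' - g| <= l * b, `|dg| <= l * b
    & `|g' - g - dg| <= l ^+ 2 * b].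

Lemma taylor2_ge0 l b g' g dg : taylor2 l b g' g dg -> 0 <= b.
Proof. by case=> g'b _ _ _ _; apply: le_trans g'b. Qed.

Lemma taylor2W l b l' b' g' g dg : 0 <= l -> l <= l' -> b <= b' ->
  taylor2 l b g' g dg -> taylor2 l' b' g' g dg.
Proof.
move=> l0 ll bb t; have b0 := taylor2_ge0 t.
have lb : l * b <= l' * b' by apply: ler_pM.
case: t => bg' bg bdiff bdg brem; split; do ?[exact: le_trans lb|exact: le_trans bb].
apply: le_trans brem _; apply: ler_pM; rewrite ?exprn_ge0 //.
by rewrite lerXn2r // nnegrE ?(le_trans l0).
Qed.

Lemma taylor2D l b c g' g dg h' h dh :
  taylor2 l b g' g dg -> taylor2 l c h' h dh ->
  taylor2 l (b + c) (g' + h') (g + h) (dg + dh).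
Proof.
have normD (u v p q : K) : `|u| <= p -> `|v| <= q -> `|u + v| <= p + q.
  by move=> up vq; apply: le_trans (ler_normD _ _) _; apply: lerD.
case=> bg' bg bgB bdg bgr [bh' bh bhB bdh bhr].
split; rewrite ?mulrDr; [exact: normD|exact: normD| |exact: normD|].
  by rewrite opprD addrACA; apply: normD.
have -> : g' + h' - (g + h) - (dg + dh) = (g' - g - dg) + (h' - h - dh) by ring.
exact: normD.
Qed.

Lemma taylor2_cst l c : 0 <= l -> taylor2 l `|c| c c 0.
Proof. by move=> l0; split; rewrite ?subrr ?subr0 ?normr0 ?mulr_ge0 ?exprn_ge0. Qed.

Lemma taylor2M l b g' g dg k c h' h dh : 0 <= l -> 0 <= k ->
  taylor2 l b g' g dg -> taylor2 k c h' h dh ->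
  taylor2 (l + k) (b * c) (g' * h') (g * h) (dg * h + g * dh).
Proof.
have normM (u v p q : K) : `|u| <= p -> `|v| <= q -> `|u * v| <= p * q.
  by move=> up vq; rewrite normrM ler_pM.
have normMD (u v u' v' p q : K) : `|u| <= l * b -> `|v| <= c -> `|u'| <= b ->
    `|v'| <= k * c -> `|u * v + u' * v'| <= (l + k) * (b * c).
  move=> ul vc ub vk; apply: le_trans (ler_normD _ _) _; rewrite mulrDl lerD //.
    by rewrite mulrA; apply: normM.
  by rewrite mulrCA; apply: normM.
move=> l0 k0 tg th; have b0 := taylor2_ge0 tg; have c0 := taylor2_ge0 th.
case: tg th => bg' bg bgB bdg bgr [bh' bh bhB bdh bhr].
split; [exact: normM|exact: normM| |exact: normMD|].
  have -> : g' * h' - g * h = (g' - g) * h' + g * (h' - h) by ring.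
  exact: normMD.
have -> : g' * h' - g * h - (dg * h + g * dh) =
  (g' - g - dg) * h' + dg * (h' - h) + g * (h' - h - dh) by ring.
apply: le_trans (_ : l ^+ 2 * b * c + (l * b) * (k * c) + b * (k ^+ 2 * c) <= _).
  apply: le_trans (ler_normD _ _) _; apply: lerD; last exact: normM.
  by apply: le_trans (ler_normD _ _) _; apply: lerD; apply: normM.
rewrite -subr_ge0; have -> : (l + k) ^+ 2 * (b * c) -
  (l ^+ 2 * b * c + l * b * (k * c) + b * (k ^+ 2 * c)) = l * k * (b * c) by ring.
by rewrite !mulr_ge0.
Qed.

Lemma taylor2_sum (I : Type) (r : seq I) l (b g' g dg : I -> K) : 0 <= l ->
  (forall i, taylor2 l (b i) (g' i) (g i) (dg i)) ->
  taylor2 l (\sum_(i <- r) b i) (\sum_(i <- r) g' i) (\sum_(i <- r) g i)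
            (\sum_(i <- r) dg i).
Proof.
move=> l0 tg; elim: r => [|i r IH]; last by rewrite !big_cons; apply: taylor2D.
by rewrite !big_nil -[X in taylor2 l X](normr0 K); exact: taylor2_cst.
Qed.

Lemma taylor2_prod (I : eqType) (r : seq I) (l b g' g dg : I -> K) :
  uniq r -> (forall i, 0 <= l i) ->
  (forall i, taylor2 (l i) (b i) (g' i) (g i) (dg i)) ->
  taylor2 (\sum_(i <- r) l i) (\prod_(i <- r) b i) (\prod_(i <- r) g' i)
    (\prod_(i <- r) g i)
    (\sum_(i <- r) dg i * \prod_(j <- r | j != i) g j).
Proof.
move=> + l0 tg; elim: r => [_|i r IH /= /andP[ir ur]].
  by rewrite !big_nil -[X in taylor2 _ X](normr1 K); exact: taylor2_cst.
rewrite leibniz_cons // ![in X in taylor2 X]big_cons ![in X in taylor2 _ X]big_cons.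
rewrite (big_cons _ _ _ _ _ g') (big_cons _ _ _ _ _ g).
apply: taylor2M => //; last exact: IH.
exact: sumr_ge0.
Qed.

End SecondOrderApproximation.
Lemma ler_term_sum (K : numDomainType) (I : finType) (F : I -> K) i :
  (forall i, 0 <= F i) -> F i <= \sum_i F i.
Proof. by move=> F0; rewrite (bigD1 i) //= lerDl sumr_ge0. Qed.

Section RowNorm.
Context {K : numDomainType} {n : nat}.
Implicit Types x y : 'rV[K]_n.

Lemma ler_coord_norm x i : `|x 0 i| <= `|x|.
Proof.
rewrite -[`|x|]/(mx_norm x) mx_normE -[leLHS]nngE num_le.
exact: (le_bigmax _ (fun ij : 'I_1 * 'I_n => `|x ij.1 ij.2|%:nng) (0, i)).
Qed.

Lemma rowBE x y i : (x - y) 0 i = x 0 i - y 0 i.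
Proof. by rewrite !mxE. Qed.

Lemma rowZE k x i : (k *: x) 0 i = k * x 0 i.
Proof. by rewrite mxE. Qed.

Lemma norm_row_le x (b : K) : 0 <= b -> (forall i, `|x 0 i| <= b) -> `|x| <= b.
Proof.
move=> b0 xb; have [x0|/mx_norm_neq0[[i j]]] := eqVneq (mx_norm x) 0.
  by rewrite -[`|x|]/(mx_norm x) x0.
by rewrite -[`|x|]/(mx_norm x) => -> /=; rewrite (ord1 i).
Qed.

End RowNorm.

Section Taylor2On.
Context {K : numDomainType} {n : nat}.
Implicit Types (D : set 'rV[K]_n) (f : 'rV[K]_n -> K) (g : 'I_n -> 'rV[K]_n -> K).

(* [g k] is the partial derivative of [f] in the direction [k]; the second order
   remainder is uniformly quadratic on [D]. *)
Definition taylor2_on D f g : Prop := exists L B, 0 <= L /\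
  forall x x', D x -> D x' ->
    taylor2 (L * `|x' - x|) B (f x') (f x) (\sum_k (x' - x) 0 k * g k x).

Lemma taylor2_on_ext D f f' g g' :
  (forall x, D x -> f x = f' x) -> (forall k x, D x -> g k x = g' k x) ->
  taylor2_on D f g -> taylor2_on D f' g'.
Proof.
move=> ff gg [L [B [L0 fg]]]; exists L, B; split=> // x x' Dx Dx'.
rewrite -!ff //; under eq_bigr do rewrite -gg //; exact: fg.
Qed.

Lemma taylor2_on_cst D (c : K) : taylor2_on D (fun=> c) (fun _ _ => 0).
Proof.
exists 0, `|c|; split=> // x x' _ _; rewrite mul0r big1; first exact: taylor2_cst.
by move=> k _; rewrite mulr0.
Qed.

Lemma taylor2_on_coord D (M : K) i : (forall x, D x -> `|x 0 i| <= M) ->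
  taylor2_on D (fun x => x 0 i) (fun k _ => (k == i)%:R).
Proof.
move=> DM; exists 1, (M + 1); split=> // x x' Dx Dx'.
have M0 : 0 <= M by apply: le_trans (DM _ Dx).
have -> : \sum_k (x' - x) 0 k * (k == i)%:R = x' 0 i - x 0 i.
  rewrite (bigD1 i) //= eqxx mulr1 big1 ?addr0 ?mxE //.
  by move=> k /negPf ->; rewrite mulr0.
have diff_le : `|x' 0 i - x 0 i| <= 1 * `|x' - x| * (M + 1).
  rewrite mul1r; have := ler_coord_norm (x' - x) i; rewrite !mxE => /le_trans; apply.
  by rewrite ler_peMr // lerDr.
split; rewrite ?subrr ?normr0 ?mulr_ge0 ?exprn_ge0 ?addr_ge0 //.
  by rewrite ler_wpDr ?DM.
by rewrite ler_wpDr ?DM.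
Qed.

Lemma taylor2_onM D f f' g g' : taylor2_on D f g -> taylor2_on D f' g' ->
  taylor2_on D (fun x => f x * f' x) (fun k x => g k x * f' x + f x * g' k x).
Proof.
move=> [L [B [L0 fg]]] [L' [B' [L0' fg']]]; exists (L + L'), (B * B').
split=> [|x x' Dx Dx']; first exact: addr_ge0.
have := taylor2M _ _ (fg _ _ Dx Dx') (fg' _ _ Dx Dx').
rewrite -mulrDl !mulr_ge0 // => /(_ isT isT).
rewrite mulr_suml mulr_sumr -big_split /=.
by under eq_bigr => k _ do rewrite -mulrA [f x * _]mulrCA -mulrDr.
Qed.

Section Family.
Variables (I : finType) (D : set 'rV[K]_n).
Variables (f : I -> 'rV[K]_n -> K) (g : I -> 'I_n -> 'rV[K]_n -> K).
Hypothesis fg : forall i, taylor2_on D (f i) (g i).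

Lemma taylor2_on_choice : exists L B : I -> K, forall i, 0 <= L i /\
  forall x x', D x -> D x' ->
    taylor2 (L i * `|x' - x|) (B i) (f i x') (f i x) (\sum_k (x' - x) 0 k * g i k x).
Proof.
have /choice[LB LBP] : forall i, exists LB : K * K, 0 <= LB.1 /\
  forall x x', D x -> D x' ->
    taylor2 (LB.1 * `|x' - x|) LB.2 (f i x') (f i x) (\sum_k (x' - x) 0 k * g i k x).
  by move=> i; have [L [B LB]] := fg i; exists (L, B).
by exists (fun i => (LB i).1), (fun i => (LB i).2).
Qed.

Lemma taylor2_on_sum :
  taylor2_on D (fun x => \sum_i f i x) (fun k x => \sum_i g i k x).
Proof.
have [L [B LB]] := taylor2_on_choice.
have L0 i : 0 <= L i by case: (LB i).
exists (\sum_i L i), (\sum_i B i); split=> [|x x' Dx Dx']; first exact: sumr_ge0.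
under [X in taylor2 _ _ _ _ X]eq_bigr do rewrite mulr_sumr.
rewrite exchange_big /=; apply: taylor2_sum => [|i]; first by rewrite mulr_ge0 ?sumr_ge0.
have [_ /(_ _ _ Dx Dx')] := LB i; apply: taylor2W => //; first by rewrite mulr_ge0.
by rewrite ler_wpM2r // ler_term_sum.
Qed.

Lemma taylor2_on_prod :
  taylor2_on D (fun x => \prod_i f i x)
    (fun k x => \sum_i g i k x * \prod_(j | j != i) f j x).
Proof.
have [L [B LB]] := taylor2_on_choice.
exists (\sum_i L i), (\prod_i B i); split=> [|x x' Dx Dx'].
  by apply: sumr_ge0 => i _; case: (LB i).
under [X in taylor2 _ _ _ _ X]eq_bigr do rewrite mulr_sumr.
rewrite exchange_big /= mulr_suml.
under [X in taylor2 _ _ _ _ X]eq_bigr do under eq_bigr do rewrite mulrA.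
under [X in taylor2 _ _ _ _ X]eq_bigr do rewrite -mulr_suml.
apply: taylor2_prod; first exact: index_enum_uniq.
  by move=> i; rewrite mulr_ge0 //; case: (LB i).
by move=> i; have [_ /(_ _ _ Dx Dx')] := LB i.
Qed.

End Family.

Lemma taylor2_onB D f f' g g' : taylor2_on D f g -> taylor2_on D f' g' ->
  taylor2_on D (fun x => f x - f' x) (fun k x => g k x - g' k x).
Proof.
move=> fg fg'.
pose F (b : bool) := if b then f else fun x => -1 * f' x.
pose G (b : bool) := if b then g else fun k x => 0 * f' x + -1 * g' k x.
have FG : taylor2_on D (fun x => \sum_b F b x) (fun k x => \sum_b G b k x).
  apply: taylor2_on_sum => -[] //; exact: taylor2_onM (taylor2_on_cst _ _) fg'.
apply: taylor2_on_ext FG => [x _|k x _]; rewrite big_bool /= ?mul0r ?add0r.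
  by rewrite mulN1r.
by rewrite mulN1r.
Qed.

Lemma taylor2_on_det m D (M : 'rV[K]_n -> 'M[K]_m) (G : 'I_m -> 'I_m -> 'I_n -> 'rV[K]_n -> K) :
  (forall i j, taylor2_on D (fun x => M x i j) (G i j)) ->
  taylor2_on D (fun x => \det (M x))
    (fun k x => \sum_i \sum_j G i j k x * cofactor (M x) i j).
Proof.
move=> MG.
have leibniz : taylor2_on D (fun x => \sum_(s : {perm 'I_m}) (-1) ^+ s * \prod_i M x i (s i))
  (fun k x => \sum_(s : {perm 'I_m}) (0 * (\prod_i M x i (s i)) + (-1) ^+ s *
      \sum_i G i (s i) k x * \prod_(j | j != i) M x j (s j))).
  apply: taylor2_on_sum => s; apply: taylor2_onM; first exact: taylor2_on_cst.
  by apply: taylor2_on_prod => i; exact: MG.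
apply: taylor2_on_ext leibniz => // k x _.
under eq_bigr do rewrite mul0r add0r mulr_sumr.
rewrite exchange_big /=; apply: eq_bigr => i _.
pose N := \matrix_(i', j) (if i' == i then G i j k x else M x i' j).
transitivity (\det N).
  apply: eq_bigr => s _; congr (_ * _); rewrite [RHS](bigD1 i) //= /N !mxE eqxx.
  by congr (_ * _); apply: eq_bigr => j ji; rewrite !mxE (negPf ji).
rewrite (expand_det_row _ i); apply: eq_bigr => j _; rewrite mxE eqxx.
congr (_ * (_ * \det _)); apply/matrixP => i' j'; rewrite !mxE.
by rewrite eq_sym (negPf (neq_lift _ _)).
Qed.

Lemma taylor2_on_lipschitz D f g : taylor2_on D f g -> exists2 M, 0 <= M &
  forall x x', D x -> D x' -> `|f x' - f x| <= M * `|x' - x|.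
Proof.
move=> [L [B [L0 fg]]]; exists (L * `|B|) => [|x x' Dx Dx']; first exact: mulr_ge0.
have t := fg _ _ Dx Dx'; have B0 := taylor2_ge0 t.
by case: t => _ _ + _ _; rewrite mulrAC (ger0_norm B0).
Qed.

Lemma taylor2_on_quadratic D f g : taylor2_on D f g -> exists2 M, 0 <= M &
  forall x x', D x -> D x' ->
  `|f x' - f x - \sum_k (x' - x) 0 k * g k x| <= M * `|x' - x| ^+ 2.
Proof.
move=> [L [B [L0 fg]]]; exists (L ^+ 2 * `|B|) => [|x x' Dx Dx'].
  by rewrite mulr_ge0 // exprn_ge0.
have t := fg _ _ Dx Dx'; have B0 := taylor2_ge0 t.
by case: t => _ _ _ _; rewrite exprMn mulrAC (ger0_norm B0).
Qed.

End Taylor2On.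

Section Reindexing.
Context {K : numDomainType} {n n' : nat}.
Variables (s : 'I_n' -> 'I_n) (pi : 'rV[K]_n' -> 'rV[K]_n).
Hypotheses (s_bij : bijective s) (piE : forall x k, pi x 0 (s k) = x 0 k).

Lemma ler_norm_reindex x x' : `|pi x' - pi x| <= `|x' - x|.
Proof.
apply: norm_row_le => // v; have [t _ stK] := s_bij.
by rewrite -[v]stK rowBE !piE -rowBE; exact: ler_coord_norm.
Qed.

Lemma taylor2_on_reindex (D : set 'rV[K]_n) f g : taylor2_on D f g ->
  taylor2_on (pi @^-1` D) (fun x => f (pi x)) (fun k x => g (s k) (pi x)).
Proof.
move=> [L [B [L0 fg]]]; exists L, B; split=> // x x' Dx Dx'.
have -> : \sum_k (x' - x) 0 k * g (s k) (pi x) = \sum_v (pi x' - pi x) 0 v * g v (pi x).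
  rewrite [RHS](reindex s) /=; first by apply: eq_bigr => k _; rewrite !rowBE !piE.
  exact: onW_bij.
apply: taylor2W (fg _ _ Dx Dx') => //; first by rewrite mulr_ge0.
by rewrite ler_wpM2l // ler_norm_reindex.
Qed.

End Reindexing.

(** * Term by term differentiation of power series *)

Section FallingPowers.
Context {K : numFieldType}.
Implicit Types (s e x : K).

(* The [k]-th derivative of [x ^+ n]. *)
Definition falling (n k : nat) x : K := (n ^_ k)%:R * x ^+ (n - k).

Definition cauchy_bound (n k : nat) s e : K := k`!%:R / e ^+ k * (s + e) ^+ n.

Lemma falling0 n x : falling n 0 x = x ^+ n.
Proof. by rewrite /falling ffactn0 mul1r subn0. Qed.

Lemma falling_small n k x : (n < k)%N -> falling n k x = 0.
Proof. by move=> nk; rewrite /falling ffact_small // mul0r. Qed.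

Lemma falling_ge0 n k x : 0 <= x -> 0 <= falling n k x.
Proof. by move=> x0; rewrite mulr_ge0 // exprn_ge0. Qed.

Lemma falling_gt0 n k x : (k <= n)%N -> 0 < x -> 0 < falling n k x.
Proof. by move=> kn x0; rewrite mulr_gt0 ?exprn_gt0 // ltr0n ffact_gt0. Qed.

Lemma ler_norm_falling n k s x : `|x| <= s -> `|falling n k x| <= falling n k s.
Proof.
move=> xs; have s0 : 0 <= s by apply: le_trans xs.
by rewrite normrM normr_nat ler_wpM2l // normrX lerXn2r ?nnegrE.
Qed.

Lemma ler_falling n k x y : 0 <= x -> x <= y -> falling n k x <= falling n k y.
Proof. by move=> x0 xy; rewrite ler_wpM2l // lerXn2r ?nnegrE ?(le_trans x0). Qed.

Lemma cauchy_boundS n k s e :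
  cauchy_bound n k.+1 s e = k.+1%:R / e * cauchy_bound n k s e.
Proof. by rewrite /cauchy_bound factS natrM exprS invfM; ring. Qed.

Lemma cauchy_bound_ge0 n k s e : 0 <= s -> 0 < e -> 0 <= cauchy_bound n k s e.
Proof.
by move=> s0 /ltW e0; rewrite mulr_ge0 ?exprn_ge0 ?addr_ge0 ?divr_ge0 ?exprn_ge0.
Qed.

Lemma falling_le_cauchy_bound n k s e :
  0 <= s -> 0 < e -> falling n k s <= cauchy_bound n k s e.
Proof.
move=> s0 e0; have [nk|kn] := ltnP n k.
  by rewrite falling_small // cauchy_bound_ge0.
rewrite /falling /cauchy_bound mulrAC ler_pdivlMr ?exprn_gt0 //; move/ltW in e0.
rewrite exprDn (bigD1 (Ordinal (kn : (k < n.+1)%N))) //= -bin_ffact natrM.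
have -> : 'C(n, k)%:R * k`!%:R * s ^+ (n - k) * e ^+ k =
  k`!%:R * (s ^+ (n - k) * e ^+ k *+ 'C(n, k)) by rewrite -mulr_natl; ring.
rewrite ler_wpM2l // lerDl sumr_ge0 // => i _.
by rewrite mulrn_wge0 // mulr_ge0 // exprn_ge0.
Qed.

Lemma normB_exprn_le (p : nat) s x x' : `|x| <= s -> `|x'| <= s ->
  `|x' ^+ p - x ^+ p| <= `|x' - x| * (p%:R * s ^+ p.-1).
Proof.
move=> xs xs'; have s0 : 0 <= s by apply: le_trans xs.
elim: p => [|p IH]; first by rewrite subrr normr0 mul0r mulr0.
have -> : x' ^+ p.+1 - x ^+ p.+1 = x' * (x' ^+ p - x ^+ p) + (x' - x) * x ^+ p.
  by rewrite !exprS; ring.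
apply: le_trans (ler_normD _ _) _; rewrite !normrM /=.
rewrite -addn1 natrD mulrDl mul1r mulrDr; apply: lerD; last first.
  by rewrite ler_wpM2l // normrX lerXn2r ?nnegrE.
apply: le_trans (ler_pM _ _ xs' IH) _ => //.
case: p {IH} => [|p]; first by rewrite !mul0r !mulr0.
by rewrite /= exprS; have -> : s * (`|x' - x| * (p.+1%:R * s ^+ p)) =
  `|x' - x| * (p.+1%:R * (s * s ^+ p)) by ring.
Qed.

Lemma norm_taylor_exprn_le (p : nat) s x x' : `|x| <= s -> `|x'| <= s ->
  `|x' ^+ p - x ^+ p - (x' - x) * (p%:R * x ^+ p.-1)| <=
  `|x' - x| ^+ 2 * (p%:R * p.-1%:R * s ^+ p.-2).
Proof.
move=> xs xs'; have s0 : 0 <= s by apply: le_trans xs.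
elim: p => [|p IH]; first by rewrite subrr !mul0r mulr0 subrr normr0.
have -> : x' ^+ p.+1 - x ^+ p.+1 - (x' - x) * (p.+1%:R * x ^+ p.+1.-1) =
  x' * (x' ^+ p - x ^+ p - (x' - x) * (p%:R * x ^+ p.-1)) +
  (x' - x) ^+ 2 * (p%:R * x ^+ p.-1).
  case: p {IH} => [|p] /=; first by rewrite !expr0 !mul0r; ring.
  by rewrite -[p.+2%:R]natr1 !exprS; ring.
apply: le_trans (ler_normD _ _) _; rewrite !normrM normrX /=.
case: p IH => [|p] IH /=.
  by rewrite !expr0 subrr !mul0r !mulr0 !normr0 !(mulr0, mul0r) subrr normr0 mulr0 addr0.
apply: le_trans (lerD (ler_pM _ _ xs' IH) (_ : _ <= `|x' - x| ^+ 2 * (p.+1%:R * s ^+ p))) _ => //=.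
  by rewrite -expr2 ler_wpM2l ?exprn_ge0 // normr_nat ler_wpM2l // lerXn2r ?nnegrE.
case: p {IH} => [|p] /=.
  rewrite !expr0 !(mulr0, mul0r, mulr1, add0r) -[leLHS]mulr1 ler_wpM2l ?exprn_ge0 //.
  by rewrite ler1n.
have -> : s * (`|x' - x| ^+ 2 * (p.+2%:R * p.+1%:R * s ^+ p)) +
   `|x' - x| ^+ 2 * (p.+2%:R * s ^+ p.+1) =
   `|x' - x| ^+ 2 * (p.+2%:R * p.+2%:R * s ^+ p.+1).
  by rewrite (exprS s p) -[p.+2%:R]natr1; move: (p.+1%:R : K) => q; ring.
by rewrite ler_wpM2l ?exprn_ge0 // ler_wpM2r ?exprn_ge0 // ler_wpM2r // ler_nat.
Qed.

Lemma normB_falling_le n k s x x' : `|x| <= s -> `|x'| <= s ->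
  `|falling n k x' - falling n k x| <= `|x' - x| * falling n k.+1 s.
Proof.
move=> xs xs'; rewrite /falling -mulrBr normrM normr_nat.
apply: le_trans (ler_wpM2l _ (normB_exprn_le (n - k) xs xs')) _ => //.
by rewrite mulrCA ffactnSr natrM subnS !mulrA.
Qed.

Lemma norm_taylor_falling_le n k s x x' : `|x| <= s -> `|x'| <= s ->
  `|falling n k x' - falling n k x - (x' - x) * falling n k.+1 x| <=
  `|x' - x| ^+ 2 * falling n k.+2 s.
Proof.
move=> xs xs'.
have -> : falling n k x' - falling n k x - (x' - x) * falling n k.+1 x = (n ^_ k)%:R *
    (x' ^+ (n - k) - x ^+ (n - k) - (x' - x) * ((n - k)%:R * x ^+ (n - k).-1)).
  by rewrite /falling ffactnSr natrM subnS; ring.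
rewrite normrM normr_nat.
apply: le_trans (ler_wpM2l _ (norm_taylor_exprn_le (n - k) xs xs')) _ => //.
by rewrite mulrCA /falling !ffactnSr !natrM !subnS !mulrA.
Qed.

Lemma taylor2_falling (n k : nat) s e x x' : `|x| <= s -> `|x'| <= s -> 0 < e ->
  taylor2 (k.+2%:R / e * `|x' - x|) (cauchy_bound n k s e)
    (falling n k x') (falling n k x) ((x' - x) * falling n k.+1 x).
Proof.
move=> xs xs' e0; have s0 : 0 <= s by apply: le_trans xs.
have b0 := cauchy_bound_ge0 n k s0 e0.
have derive_le : falling n k.+1 s <= k.+2%:R / e * cauchy_bound n k s e.
  apply: le_trans (falling_le_cauchy_bound n k.+1 s0 e0) _; rewrite cauchy_boundS.
  by rewrite !ler_wpM2r ?invr_ge0 ?ler_nat // ltW.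
have derive2_le : falling n k.+2 s <= (k.+2%:R / e) ^+ 2 * cauchy_bound n k s e.
  apply: le_trans (falling_le_cauchy_bound n k.+2 s0 e0) _; rewrite !cauchy_boundS.
  rewrite expr2 -[leRHS]mulrA ler_wpM2l ?divr_ge0 ?(ltW e0) //.
  by rewrite !ler_wpM2r ?invr_ge0 ?ler_nat // ltW.
have falling_le z : `|z| <= s -> `|falling n k z| <= cauchy_bound n k s e.
  by move=> /ler_norm_falling/le_trans; apply; exact: falling_le_cauchy_bound.
split; [exact: falling_le|exact: falling_le| | |].
- apply: le_trans (normB_falling_le _ _ xs xs') _.
  by rewrite [leRHS]mulrAC [leRHS]mulrC ler_wpM2l.
- rewrite normrM [leRHS]mulrAC [leRHS]mulrC ler_wpM2l //; apply: le_trans derive_le.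
  exact: ler_norm_falling.
- apply: le_trans (norm_taylor_falling_le _ _ xs xs') _.
  by rewrite exprMn [leRHS]mulrAC [leRHS]mulrC ler_wpM2l ?exprn_ge0.
Qed.

Lemma falling_bernoulli n x y : 0 <= x -> x <= y ->
  falling n 0 x + (y - x) * falling n 1 x <= falling n 0 y.
Proof.
move=> x0 xy; have y0 := le_trans x0 xy.
rewrite !falling0 /falling ffactn1.
elim: n => [|n IH]; first by rewrite !expr0 mul0r mulr0 addr0.
rewrite subSS subn0 !exprS; apply: le_trans (ler_wpM2l y0 IH); rewrite -subr_ge0.
case: n {IH} => [|n].
  by rewrite le_eqVlt; apply/orP; left; apply/eqP; rewrite sub0n !expr0; ring.
rewrite subSS subn0 exprS -[n.+2%:R]natr1.
move: (n.+1%:R : K) (ler0n K n.+1) => q q0.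
have -> : y * (x * x ^+ n + (y - x) * (q * x ^+ n)) -
   (x * (x * x ^+ n) + (y - x) * ((q + 1) * (x * x ^+ n))) =
   (y - x) ^+ 2 * (q * x ^+ n) by ring.
by rewrite mulr_ge0 ?exprn_ge0 ?subr_ge0 // mulr_ge0 // exprn_ge0.
Qed.

End FallingPowers.
Section PartialDerivatives.
Context {K : numFieldType} {n : nat}.
Local Notation expo := {ffun 'I_n -> nat}.
Implicit Types (al : 'I_n -> nat) (a : expo) (x y : 'rV[K]_n).

Definition row_ge0 x := forall i, 0 <= x 0 i.

Definition row_le x y := forall i, x 0 i <= y 0 i.

Definition mindex0 : 'I_n -> nat := fun=> 0%N.

Definition mindexS (j : 'I_n) al : 'I_n -> nat := fun i => (al i + (i == j))%N.

(* The monomial of exponent [a], differentiated [al i] times in each variable [i]. *)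
Definition dmonomial al a x : K := \prod_i falling (a i) (al i) (x 0 i).

Lemma dmonomial0 a x : dmonomial mindex0 a x = \prod_i x 0 i ^+ a i.
Proof. by apply: eq_bigr => i _; exact: falling0. Qed.

Lemma dmonomial_mindexS j al a x :
  dmonomial (mindexS j al) a x = falling (a j) (al j).+1 (x 0 j) *
    \prod_(i | i != j) falling (a i) (al i) (x 0 i).
Proof.
rewrite /dmonomial (bigD1 j) //= /mindexS eqxx addn1; congr (_ * _).
by apply: eq_bigr => i /negPf ->; rewrite addn0.
Qed.

(* Euler's identity, for one variable of one monomial. *)
Lemma mul_dmonomial_mindexS j a x :
  x 0 j * dmonomial (mindexS j mindex0) a x = (a j)%:R * dmonomial mindex0 a x.
Proof.
rewrite dmonomial_mindexS dmonomial0 [in RHS](bigD1 j) //= !mulrA; congr (_ * _).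
  rewrite /falling /mindex0 ffactn1 mulrAC -exprS subn1 mulrC.
  by have [->|a0] := posnP (a j); rewrite ?mul0r ?prednK.
by apply: eq_bigr => i _; rewrite falling0.
Qed.

Lemma dmonomial_small al a x v : (a v < al v)%N -> dmonomial al a x = 0.
Proof. by move=> av; rewrite /dmonomial (bigD1 v) //= falling_small ?mul0r. Qed.

Lemma dmonomial_ge0 al a x : row_ge0 x -> 0 <= dmonomial al a x.
Proof. by move=> x0; apply: prodr_ge0 => i _; exact: falling_ge0. Qed.

Lemma dmonomial_gt0 al a x :
  (forall i, (al i <= a i)%N) -> (forall i, 0 < x 0 i) -> 0 < dmonomial al a x.
Proof. by move=> al_a x0; apply: prodr_gt0 => i _; exact: falling_gt0. Qed.

Lemma ler_dmonomial al a x y :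
  row_ge0 x -> row_le x y -> dmonomial al a x <= dmonomial al a y.
Proof. by move=> x0 xy; apply: ler_prod => i _; rewrite falling_ge0 ?ler_falling. Qed.

Lemma taylor2_dmonomial al a (s : 'rV[K]_n) e x x' :
  (forall i, `|x 0 i| <= s 0 i) -> (forall i, `|x' 0 i| <= s 0 i) -> 0 < e ->
  taylor2 ((\sum_i (al i).+2%:R / e) * `|x' - x|)
    (\prod_i ((al i)`!%:R / e ^+ al i) * dmonomial mindex0 a (s + const_mx e))
    (dmonomial al a x') (dmonomial al a x)
    (\sum_j (x' - x) 0 j * dmonomial (mindexS j al) a x).
Proof.
move=> xs xs' e0; rewrite mulr_suml dmonomial0 -big_split /=.
have le0 (i : 'I_n) (z : K) : 0 <= z -> 0 <= (al i).+2%:R / e * z.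
  by move=> z0; rewrite mulr_ge0 // divr_ge0 // ltW.
have := @taylor2_prod K _ (index_enum 'I_n) _ _ _ _ _ (index_enum_uniq _)
  (fun i => le0 i _ (normr_ge0 (x' 0 i - x 0 i)))
  (fun i => taylor2_falling (a i) (al i) (xs i) (xs' i) e0).
under [X in taylor2 _ _ _ _ X -> _]eq_bigr => j _ do
  rewrite -mulrA -dmonomial_mindexS -rowBE.
apply: taylor2W; first by apply: sumr_ge0 => i _; exact: le0.
  apply: ler_sum => i _; rewrite ler_wpM2l ?divr_ge0 ?(ltW e0) //.
  by have := ler_coord_norm (x' - x) i; rewrite !mxE.
rewrite [leRHS](eq_bigr (fun i => cauchy_bound (a i) (al i) (s 0 i) e)) // => i _.
by rewrite !mxE.
Qed.

Lemma prod_bernoulli (I : eqType) (r : seq I) (f f' d : I -> K) : uniq r ->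
  (forall i, 0 <= f i) -> (forall i, 0 <= d i) -> (forall i, f i + d i <= f' i) ->
  \prod_(i <- r) f i + \sum_(i <- r) d i * \prod_(j <- r | j != i) f j <=
  \prod_(i <- r) f' i.
Proof.
move=> + f0 d0 ff; elim: r => [_|i r IH /= /andP[ir ur]].
  by rewrite !big_nil addr0.
rewrite leibniz_cons // ![\prod_(j <- _ :: _) _]big_cons.
set P := \prod_(j <- r) f j; set S := \sum_(k <- r) _.
have P0 : 0 <= P by apply: prodr_ge0.
have S0 : 0 <= S by apply: sumr_ge0 => k _; rewrite mulr_ge0 // prodr_ge0.
apply: le_trans (_ : (f i + d i) * (P + S) <= _); last first.
  by apply: ler_pM => //; rewrite ?addr_ge0 //; exact: IH.
rewrite -subr_ge0; have -> : (f i + d i) * (P + S) - (f i * P + (d i * P + f i * S)) =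
  d i * S by ring.
exact: mulr_ge0.
Qed.

Lemma dmonomial_convex a x y : row_ge0 x -> row_le x y ->
  dmonomial mindex0 a x + \sum_j (y - x) 0 j * dmonomial (mindexS j mindex0) a x <=
  dmonomial mindex0 a y.
Proof.
move=> x0 xy; under eq_bigr => j _ do rewrite dmonomial_mindexS mulrA rowBE.
apply: prod_bernoulli => [|i|i|i]; [exact: index_enum_uniq|exact: falling_ge0| |].
  by rewrite mulr_ge0 ?subr_ge0 ?falling_ge0.
exact: falling_bernoulli.
Qed.

End PartialDerivatives.

Lemma taylor2_cvg (K : numFieldType) (l b : K) (g' g dg : nat -> K) (G' G dG : K) :
  (forall N, taylor2 l b (g' N) (g N) (dg N)) ->
  g' @ \oo --> G' -> g @ \oo --> G -> dg @ \oo --> dG -> taylor2 l b G' G dG.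
Proof.
move=> t c' cg dc; split.
- by apply: (cvg_seq_le_cst (cvg_norm c')) => N; case: (t N).
- by apply: (cvg_seq_le_cst (cvg_norm cg)) => N; case: (t N).
- by apply: (cvg_seq_le_cst (cvg_norm (cvgB c' cg))) => N; case: (t N).
- by apply: (cvg_seq_le_cst (cvg_norm dc)) => N; case: (t N).
- by apply: (cvg_seq_le_cst (cvg_norm (cvgB (cvgB c' cg) dc))) => N; case: (t N).
Qed.

Section PowerSeriesDerivatives.
Context {R : realType} {n : nat}.
Local Notation C := (Cplx R).
Local Notation expo := {ffun 'I_n -> nat}.
Implicit Types (al : 'I_n -> nat) (c : expo -> C) (x y : 'rV[C]_n).

Definition dseries al c x : C := box_limit (fun a => c a * dmonomial al a x).

Definition dseries_cvg al c x : Prop := box_bounded (fun a => c a * dmonomial al a x).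

Definition polydisc (s : 'rV[C]_n) : set 'rV[C]_n := [set x | forall i, `|x 0 i| <= s 0 i].

Lemma psumE c x : psum c x = dseries mindex0 c x.
Proof.
congr (limn _); apply/funext => N.
by rewrite /box_sum big_map big_enum; apply: eq_bigr => b _; rewrite dmonomial0.
Qed.

Lemma esum_box_boundedP (f : expo -> R) : (forall a, 0 <= f a) ->
  (\esum_(a in setT) (f a)%:E < +oo)%E <-> exists M, forall N, box_sum N f <= M.
Proof.
move=> f0.
have sumE N : (\sum_(a \in [set` box N]) (f a)%:E)%E = (box_sum N f)%:E.
  by rewrite -fsbig_seq ?box_uniq // sumEFin.
split=> [fin|[M fM]].
  exists (fine (\esum_(a in setT) (f a)%:E)%E) => N.
  have esum0 : (0 <= \esum_(a in setT) (f a)%:E)%E.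
    by apply: esum_ge0 => a _; rewrite lee_fin.
  rewrite -lee_fin fineK ?ge0_fin_numE //.
  by apply: esum_ge; exists [set` box N]; [split=> //; exact: finite_seq|rewrite sumE].
apply: le_lt_trans (ltry M); apply: ge_ereal_sup => _ [X [finX _] <-].
have /finite_seqP[t ->] := finX; have [N tN] := sub_box t.
apply: le_trans (_ : \sum_(a \in [set` box N]) (f a)%:E <= _)%E.
  apply: lee_fsum_nneg_subset; do ?exact: finite_seq; last first.
    by move=> a _; rewrite lee_fin.
  by move=> a; rewrite !inE => /tN.
by rewrite sumE lee_fin.
Qed.

Lemma abs_convergentP c x : abs_convergent c x <-> dseries_cvg mindex0 c x.
Proof.
pose f a := modulus (c a * monomial a x).
have f0 a : 0 <= f a by exact: modulus_ge0.
have boxE N : box_sum N (fun a => `|c a * dmonomial mindex0 a x|) = ofR (box_sum N f).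
  by rewrite /box_sum rmorph_sum; apply: eq_bigr => a _; rewrite dmonomial0 -ofR_modulus.
have -> : abs_convergent c x = (\esum_(a in setT) (f a)%:E < +oo)%E.
  by congr (_ < _)%E; apply: eq_esum => a _; rewrite gee0_abs // lee_fin modulus_ge0.
rewrite (esum_box_boundedP f0); split=> [[M fM]|[M fM]].
  by exists (ofR M) => N; rewrite boxE ler_ofR.
have M0 : 0 <= M by apply: le_trans (fM 0%N); rewrite box_sum_ge0.
by exists (complex.Re M) => N; rewrite -ler_ofR -boxE -ge0_ofR_Re.
Qed.

Lemma cvg_dseries al c x : dseries_cvg al c x ->
  (fun N => box_sum N (fun a => c a * dmonomial al a x)) @ \oo --> dseries al c x.
Proof. exact: cvg_box_sum. Qed.

Section Polydisc.
Variables (c : expo -> C) (s : 'rV[C]_n) (e : C).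
Hypotheses (s_ge0 : row_ge0 s) (e_gt0 : 0 < e).
Hypothesis c_cvg : abs_convergent c (s + const_mx e).

Let cauchy_ge0 al : 0 <= \prod_i ((al i)`!%:R / e ^+ al i) :> C.
Proof. by rewrite prodr_ge0 // => i _; rewrite divr_ge0 // exprn_ge0 // ltW. Qed.

Let outer_ge0 (a : expo) : 0 <= dmonomial mindex0 a (s + const_mx e).
Proof. by apply: dmonomial_ge0 => i; rewrite !mxE addr_ge0 // ltW. Qed.

Lemma dseries_cvg_polydisc al x : polydisc s x -> dseries_cvg al c x.
Proof.
move=> xs; have /abs_convergentP := c_cvg; apply: box_bounded_le (cauchy_ge0 al) _ => a.
rewrite !normrM mulrCA ler_wpM2l // (ger0_norm (outer_ge0 a)).
by have [] := taylor2_dmonomial al a xs xs e_gt0.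
Qed.

Lemma taylor2_box_sum al N x x' : polydisc s x -> polydisc s x' ->
  taylor2 ((\sum_i (al i).+2%:R / e) * `|x' - x|)
    (\prod_i ((al i)`!%:R / e ^+ al i) *
       box_sum N (fun a => `|c a * dmonomial mindex0 a (s + const_mx e)|))
    (box_sum N (fun a => c a * dmonomial al a x'))
    (box_sum N (fun a => c a * dmonomial al a x))
    (\sum_j (x' - x) 0 j * box_sum N (fun a => c a * dmonomial (mindexS j al) a x)).
Proof.
move=> xs xs'; set l := _ * `|_|.
have l0 : 0 <= l.
  by rewrite mulr_ge0 // sumr_ge0 // => i _; rewrite divr_ge0 // ltW.
under [X in taylor2 _ _ _ _ X]eq_bigr do rewrite -box_sumZ.
rewrite -box_sumZ exchange_big /=; apply: taylor2_sum => // a.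
have := taylor2M (lexx 0) l0 (taylor2_cst (c a) (lexx 0))
  (taylor2_dmonomial al a xs xs' e_gt0).
rewrite add0r mul0r add0r normrM (ger0_norm (outer_ge0 a)) mulrCA mulr_sumr.
by under [X in taylor2 _ _ _ _ X -> _]eq_bigr do rewrite mulrCA.
Qed.

Lemma taylor2_on_dseries al :
  taylor2_on (polydisc s) (dseries al c) (fun j => dseries (mindexS j al) c).
Proof.
have /abs_convergentP[M cM] := c_cvg.
exists (\sum_i (al i).+2%:R / e), (\prod_i ((al i)`!%:R / e ^+ al i) * M).
split=> [|x x' xs xs']; first by rewrite sumr_ge0 // => i _; rewrite divr_ge0 // ltW.
apply: (taylor2_cvg (fun N => taylor2W _ (lexx _) (ler_wpM2l (cauchy_ge0 al) (cM N))
  (taylor2_box_sum al N xs xs'))).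
- by rewrite mulr_ge0 // sumr_ge0 // => i _; rewrite divr_ge0 // ltW.
- by apply/cvg_dseries/dseries_cvg_polydisc.
- by apply/cvg_dseries/dseries_cvg_polydisc.
- apply: (cvg_big (@add_continuous _)) => j _; apply: cvgMl_tmp.
  by apply/cvg_dseries/dseries_cvg_polydisc.
Qed.

End Polydisc.

Section NonnegativeCoefficients.
Variable c : expo -> C.
Hypothesis c_ge0 : forall a, 0 <= c a.

Let term_ge0 al a x : row_ge0 x -> 0 <= c a * dmonomial al a x.
Proof. by move=> x0; rewrite mulr_ge0 ?dmonomial_ge0. Qed.

Lemma dseries_cvg_le al x y :
  row_ge0 x -> row_le x y -> dseries_cvg al c y -> dseries_cvg al c x.
Proof.
move=> x0 xy; have y0 i : 0 <= y 0 i := le_trans (x0 i) (xy i).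
apply: (@box_bounded_le _ _ _ _ 1) => // a.
by rewrite mul1r !ger0_norm ?term_ge0 // ler_wpM2l // ler_dmonomial.
Qed.

Lemma dseries_ge0 al x : row_ge0 x -> dseries_cvg al c x -> 0 <= dseries al c x.
Proof. by move=> x0; apply: box_limit_ge0 => a; exact: term_ge0. Qed.

Lemma dseries_le al x y : row_ge0 x -> row_le x y ->
  dseries_cvg al c y -> dseries al c x <= dseries al c y.
Proof.
move=> x0 xy y_cvg; have x_cvg := dseries_cvg_le x0 xy y_cvg.
apply: (cvg_seq_le (cvg_dseries x_cvg) (cvg_dseries y_cvg)) => N.
by apply: ler_box_sum => a; rewrite ler_wpM2l // ler_dmonomial.
Qed.

Lemma dseries_convex x y : row_ge0 x -> row_le x y -> dseries_cvg mindex0 c y ->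
  (forall j, dseries_cvg (mindexS j mindex0) c x) ->
  dseries mindex0 c x + \sum_j (y - x) 0 j * dseries (mindexS j mindex0) c x <=
  dseries mindex0 c y.
Proof.
move=> x0 xy y_cvg dx_cvg; have x_cvg := dseries_cvg_le x0 xy y_cvg.
have tangent_cvg : (fun N => box_sum N (fun a => c a * dmonomial mindex0 a x) +
    \sum_j (y - x) 0 j * box_sum N (fun a => c a * dmonomial (mindexS j mindex0) a x))
    @ \oo --> dseries mindex0 c x + \sum_j (y - x) 0 j * dseries (mindexS j mindex0) c x.
  apply: cvgD; first exact: cvg_dseries.
  by apply: (cvg_big (@add_continuous _)) => j _; apply: cvgMl_tmp; exact: cvg_dseries.
apply: (cvg_seq_le tangent_cvg (cvg_dseries y_cvg)) => N.
under eq_bigr do rewrite -box_sumZ.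
rewrite /box_sum exchange_big -big_split /=; apply: ler_sum => a _.
apply: le_trans (ler_wpM2l (c_ge0 a) (dmonomial_convex a x0 xy)).
by rewrite mulrDr mulr_sumr lerD2l; apply: ler_sum => j _; rewrite mulrCA.
Qed.

Lemma dseries_eq0_coef al x (a : expo) : (forall i, 0 < x 0 i) -> dseries_cvg al c x ->
  dseries al c x = 0 -> (forall i, (al i <= a i)%N) -> c a = 0.
Proof.
move=> x0 x_cvg dx0 al_a; have x0' i : 0 <= x 0 i by exact: ltW.
have := term_le_box_limit a (fun a => term_ge0 al a x0') x_cvg; rewrite -/(dseries _ _ _) dx0.
by rewrite pmulr_lle0 ?dmonomial_gt0 // => c0; apply/eqP; rewrite eq_le c0 c_ge0.
Qed.

Lemma dseries_gt0 al x y : (forall i, 0 < x 0 i) -> dseries_cvg al c x ->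
  dseries al c y != 0 -> 0 < dseries al c x.
Proof.
move=> x0 x_cvg dy; have x0' i : 0 <= x 0 i by exact: ltW.
rewrite lt_neqAle dseries_ge0 // andbT eq_sym; apply: contra_neq dy => dx0.
apply: box_limit0 => a.
have [/existsP[i /dmonomial_small ->]|/existsPn al_a] := boolP [exists i, (a i < al i)%N].
  by rewrite mulr0.
by rewrite (dseries_eq0_coef x0 x_cvg dx0) ?mul0r // => i; rewrite leqNgt.
Qed.

End NonnegativeCoefficients.
End PowerSeriesDerivatives.
(** * Local quadratic convergence of Newton's iteration *)

Section QuadraticRemainder.
Context {K : numFieldType} {V W : normedModType K}.
Implicit Types (f : V -> W) (x : V) (M : K).

Lemma lipschitz_cvg f x M : 0 <= M ->
  (\forall x' \near x, `|f x' - f x| <= M * `|x' - x|) -> f x' @[x' --> x] --> f x.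
Proof.
move=> M0 f_lip; apply/cvgrPdist_lt => e e0.
have d0 : 0 < e / (M + 1) by rewrite divr_gt0 // ltr_wpDl.
have /cvgrPdist_lt/(_ _ d0) : x' @[x' --> x] --> x by exact: cvg_id.
apply: filterS2 f_lip => x' fx' xx'.
rewrite distrC; apply: le_lt_trans fx' _.
rewrite distrC; move: xx'; rewrite ltr_pdivlMr ?ltr_wpDl // mulrC; apply: le_lt_trans.
by rewrite ler_wpM2r // lerDl.
Qed.

Lemma lipschitz_continuous f M :
  0 <= M -> (forall x x', `|f x' - f x| <= M * `|x' - x|) -> continuous f.
Proof. by move=> M0 f_lip x; apply: (lipschitz_cvg M0); exact: nearW. Qed.

Lemma quadratic_remainder_diff f (df : {linear V -> W}) x M : 0 <= M -> continuous df ->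
  (\forall x' \near x, `|f x' - f x - df (x' - x)| <= M * `|x' - x| ^+ 2) ->
  'd f x = df :> (V -> W).
Proof.
move=> M0 df_cont f_quad; apply: diff_unique => //; apply/eqaddoP => e e0.
have f_quad0 : \forall v \near (0 : V),
    `|f (v + x) - f x - df (v + x - x)| <= M * `|v + x - x| ^+ 2.
  have : v + x @[v --> (0 : V)] --> 0 + x by apply: cvgD; [exact: cvg_id|exact: cvg_cst].
  by rewrite add0r => /(_ _ f_quad).
have d0 : 0 < e / (M + 1) by rewrite divr_gt0 // ltr_wpDl.
have /cvgrPdist_lt/(_ _ d0) : v @[v --> (0 : V)] --> (0 : V) by exact: cvg_id.
apply: filterS2 f_quad0 => v + v_small /=; rewrite addrK !fctE /= opprD addrA.
move=> /le_trans; apply; rewrite expr2 mulrA ler_wpM2r //.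
move: v_small; rewrite sub0r normrN ltr_pdivlMr ?ltr_wpDl // mulrC => /ltW.
by apply: le_trans; rewrite ler_wpM2r // lerDl.
Qed.

End QuadraticRemainder.

Section EntryNorm.
Context {K : numFieldType}.

Definition entry_norm n m (A : 'M[K]_(n, m)) : K := \sum_k \sum_l `|A k l|.

Lemma entry_norm_ge0 n m (A : 'M[K]_(n, m)) : 0 <= entry_norm A.
Proof. by do 2!apply: sumr_ge0 => ? _. Qed.

Lemma norm_mulmx_le n m (v : 'rV[K]_n) (A : 'M[K]_(n, m)) :
  `|v *m A| <= entry_norm A * `|v|.
Proof.
apply: norm_row_le => [|l]; first by rewrite mulr_ge0 ?entry_norm_ge0.
rewrite mxE mulr_suml; apply: le_trans (ler_norm_sum _ _ _) _.
apply: ler_sum => k _; rewrite normrM mulrC ler_pM ?ler_coord_norm //.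
exact: (ler_term_sum (F := fun l => `|A k l|)).
Qed.

Section Perturbation.
Context {n : nat}.
Variables A B : 'M[K]_n.
Hypothesis A_unit : A \in unitmx.
Hypothesis AB_close : entry_norm (invmx A) * entry_norm (A - B) <= 2^-1.

Lemma norm_le_mulmx_perturbed (v : 'rV[K]_n) :
  `|v| <= 2 * entry_norm (invmx A) * `|v *m B|.
Proof.
set c := entry_norm (invmx A).
have vE : v = (v *m B) *m invmx A + (v *m (A - B)) *m invmx A.
  by rewrite -mulmxDl -mulmxDr subrKC mulmxK.
have v_le : `|v| <= c * `|v *m B| + 2^-1 * `|v|.
  rewrite {1}vE; apply: le_trans (ler_normD _ _) _; apply: lerD.
    exact: norm_mulmx_le.
  apply: le_trans (norm_mulmx_le _ _) _; rewrite -/c.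
  apply: le_trans (ler_wpM2l (entry_norm_ge0 _) (norm_mulmx_le _ _)) _.
  by rewrite mulrA ler_wpM2r.
move: v_le; rewrite -lerBlDr -{1}[`|v|]mul1r -mulrBl.
have -> : 1 - 2^-1 = 2^-1 :> K by field.
by rewrite ler_pdivrMl // mulrA.
Qed.

Lemma unitmx_perturbed : B \in unitmx.
Proof.
rewrite -row_free_unit -kermx_eq0; apply/eqP/row_matrixP => i.
rewrite row0; apply/eqP; rewrite -normr_le0; apply: le_trans (norm_le_mulmx_perturbed _) _.
by rewrite -row_mul mulmx_ker row0 normr0 mulr0.
Qed.

End Perturbation.
End EntryNorm.

Section Jacobian.
Context {K : numFieldType} {n m : nat}.
Implicit Types (D : set 'rV[K]_n) (F : 'rV[K]_n -> 'rV[K]_m) (J : 'rV[K]_n -> 'M[K]_(n, m)).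

Definition taylor2_on_rV D F J : Prop :=
  forall l, taylor2_on D (fun x => F x 0 l) (fun k x => J x k l).

Lemma taylor2_on_rV_quadratic D F J : taylor2_on_rV D F J -> exists2 M, 0 <= M &
  forall x x', D x -> D x' -> `|F x' - F x - (x' - x) *m J x| <= M * `|x' - x| ^+ 2.
Proof.
move=> FJ; have /choice[M MP] : forall l, exists M, 0 <= M /\ forall x x', D x -> D x' ->
    `|F x' 0 l - F x 0 l - \sum_k (x' - x) 0 k * J x k l| <= M * `|x' - x| ^+ 2.
  by move=> l; have [M M0 FM] := taylor2_on_quadratic (FJ l); exists M.
have M0 l : 0 <= M l by case: (MP l).
exists (\sum_l M l) => [|x x' Dx Dx']; first exact: sumr_ge0.
apply: norm_row_le => [|l]; first by rewrite mulr_ge0 ?exprn_ge0 ?sumr_ge0.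
have [_ /(_ _ _ Dx Dx')] := MP l; rewrite !mxE => /le_trans; apply.
by rewrite ler_wpM2r ?exprn_ge0 // ler_term_sum.
Qed.

Lemma taylor2_on_jacobian D F J x : taylor2_on_rV D F J -> nbhs x D -> jacobian F x = J x.
Proof.
move=> /taylor2_on_rV_quadratic[M M0 F_quad] xD; have Dx := nbhs_singleton xD.
suff dF : 'd F x = mulmxr (J x) :> ('rV[K]_n -> 'rV[K]_m).
  apply/row_matrixP => i; rewrite /jacobian rowE mul_rV_lin1 dF.
  by rewrite /= -rowE.
apply: (quadratic_remainder_diff M0).
  apply: (lipschitz_continuous (entry_norm_ge0 (J x))) => v' v'' /=.
  by rewrite -mulmxBl; exact: norm_mulmx_le.
by apply: filterS xD => x' Dx'; exact: F_quad.
Qed.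

Lemma taylor2_on_entry_norm D J :
  (forall k l, exists g, taylor2_on D (fun x => J x k l) g) -> exists2 P, 0 <= P &
  forall x x', D x -> D x' -> entry_norm (J x' - J x) <= P * `|x' - x|.
Proof.
move=> J_taylor; have /choice[N NP] : forall kl : 'I_n * 'I_m, exists N, 0 <= N /\
    forall x x', D x -> D x' -> `|J x' kl.1 kl.2 - J x kl.1 kl.2| <= N * `|x' - x|.
  move=> [k l]; have [g /taylor2_on_lipschitz[N N0 NP]] := J_taylor k l.
  by exists N.
exists (\sum_k \sum_l N (k, l)) => [|x x' Dx Dx'].
  by do 2!apply: sumr_ge0 => ? _; exact: (NP (_, _)).1.
rewrite mulr_suml; apply: ler_sum => k _; rewrite mulr_suml; apply: ler_sum => l _.
by rewrite !mxE; have [_ NPkl] := NP (k, l); exact: NPkl.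
Qed.

End Jacobian.

Lemma taylor2_on_continuous (K : numFieldType) n (D : set 'rV[K]_n) f g (x : 'rV[K]_n) :
  taylor2_on D f g -> nbhs x D -> f x' @[x' --> x] --> f x.
Proof.
move=> /taylor2_on_lipschitz[M M0 f_lip] xD; apply: (lipschitz_cvg M0).
have Dx := nbhs_singleton xD.
by apply: filterS xD => x' Dx'; exact: f_lip.
Qed.

Section NewtonConvergence.
Context {R : realType}.
Local Notation C := (Cplx R).

Lemma near_norm_lt (V : normedModType C) (z : V) (e : C) :
  0 < e -> \forall x \near z, `|x - z| < e.
Proof.
move=> e0; have /cvgrPdist_lt/(_ _ e0) : x @[x --> z] --> z by exact: cvg_id.
by apply: filterS => x; rewrite distrC.
Qed.

Lemma cvg_expr_half : (fun k => 2^-1 ^+ k : C) @ \oo --> (0 : C).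
Proof.
have : (fun k => ofR (2^-1 ^+ k) : C) @ \oo --> ofR (0 : R).
  by apply: cvg_ofR; apply: cvg_expr; rewrite ger0_norm ?invf_lt1 ?ltr1n.
rewrite rmorph0; apply: cvg_trans; apply: near_eq_cvg; apply: nearW => k.
by rewrite rmorphXn fmorphV rmorph_nat.
Qed.

Section QuadraticContraction.
Context {V : normedModType C}.
Variables (f : V -> V) (z : V) (c d : C).
Hypotheses (c_ge0 : 0 <= c) (d_gt0 : 0 < d) (cd_le : c * d <= 2^-1).
Hypothesis f_quadratic : forall x, `|x - z| < d -> `|f x - z| <= c * `|x - z| ^+ 2.

Lemma quadratic_contraction_iter x k :
  `|x - z| < d -> `|iter k f x - z| < d /\ `|iter k f x - z| <= 2^-1 ^+ k * d.
Proof.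
move=> xz; elim: k => [|k [kd kd2]]; first by rewrite expr0 mul1r ltW.
have half : `|iter k.+1 f x - z| <= 2^-1 * `|iter k f x - z|.
  apply: le_trans (f_quadratic kd) _; rewrite expr2 mulrA ler_wpM2r //.
  by apply: le_trans cd_le; rewrite ler_wpM2l // ltW.
split; last by apply: le_trans half _; rewrite exprS -mulrA ler_wpM2l ?invr_ge0.
by apply: le_lt_trans half (le_lt_trans _ kd); rewrite ler_piMl // invf_le1 ?ler1n.
Qed.

Lemma quadratic_contraction_cvg x : `|x - z| < d -> (fun k => iter k f x) @ \oo --> z.
Proof.
move=> xz; apply/cvgrPdist_lt => e e0.
have := cvg_expr_half => /cvgrPdist_lt /(_ (e / d)); rewrite divr_gt0 // => /(_ isT).
apply: filterS => k; rewrite sub0r normrN normrX ger0_norm ?invr_ge0 //.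
rewrite ltr_pdivlMr // => /(le_lt_trans _); apply; rewrite distrC.
by have [] := quadratic_contraction_iter k xz.
Qed.

End QuadraticContraction.

Section NondegenerateZero.
Context {n : nat}.
Variables (D : set 'rV[C]_n) (F : 'rV[C]_n -> 'rV[C]_n) (J : 'rV[C]_n -> 'M[C]_n).
Variable zeta : 'rV[C]_n.
Hypothesis F_taylor : taylor2_on_rV D F J.
Hypothesis J_taylor : forall k l, exists g, taylor2_on D (fun x => J x k l) g.
Hypotheses (zeta_D : nbhs zeta D) (F_zeta : F zeta = 0) (J_zeta : J zeta \in unitmx).

Lemma near_jacobian_close : \forall x \near zeta, [/\ nbhs x D, jacobian F x = J x &
  entry_norm (invmx (J zeta)) * entry_norm (J zeta - J x) <= 2^-1].
Proof.
have [P P0 JP] := taylor2_on_entry_norm J_taylor.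
set a := entry_norm (invmx (J zeta)); have a0 : 0 <= a by exact: entry_norm_ge0.
have e0 : 0 < (2 * (a * P + 1))^-1 :> C.
  by rewrite invr_gt0 mulr_gt0 // ltr_wpDl // mulr_ge0.
have Dz := nbhs_singleton zeta_D.
have /nbhs_interior : nbhs zeta D by [].
apply: filterS2 (near_norm_lt zeta e0) => x /ltW xz xD.
split=> //; first exact: taylor2_on_jacobian.
apply: le_trans (ler_wpM2l a0 (JP _ _ (nbhs_singleton xD) Dz)) _.
rewrite mulrA distrC; apply: le_trans (ler_wpM2l _ xz) _; first exact: mulr_ge0.
rewrite invfM mulrCA ger_pMr ?invr_gt0 // ler_pdivrMr ?ltr_wpDl ?mulr_ge0 //.
by rewrite mul1r lerDl.
Qed.

Lemma newton_step_quadratic : exists2 c, 0 <= c & \forall x \near zeta,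
  [/\ D x, jacobian F x \in unitmx & `|newton F x - zeta| <= c * `|x - zeta| ^+ 2].
Proof.
have [M M0 F_quad] := taylor2_on_rV_quadratic F_taylor.
set a := entry_norm (invmx (J zeta)); have a0 : 0 <= a by exact: entry_norm_ge0.
exists (2 * a * M); first by rewrite !mulr_ge0.
apply: filterS near_jacobian_close => x [/nbhs_singleton Dx jacE close].
have unit_x := unitmx_perturbed J_zeta close; split=> //; first by rewrite jacE.
apply: le_trans (norm_le_mulmx_perturbed J_zeta close _) _; rewrite -/a.
rewrite -!mulrA ler_wpM2l // ler_wpM2l // /newton jacE addrAC mulmxBl mulmxKV //.
have := F_quad _ _ Dx (nbhs_singleton zeta_D).
rewrite F_zeta sub0r -(opprB x zeta) mulNmx opprK normrN.
by rewrite [- F x + _]addrC.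
Qed.

Theorem newton_cvg_quadratically_near :
  exists2 V, nbhs zeta V & newton_cvg_quadratically D F V zeta.
Proof.
have [c c0 /nbhs_ballP[r /= r0 near_zeta]] := newton_step_quadratic.
near (0 : C)^'+ => d.
have d0 : 0 < d by near: d; exact: nbhs_right_gt.
have dr : d <= r by near: d; exact: nbhs_right_le.
have cd : c * d <= 2^-1.
  by rewrite mulrC; near: d; apply: near0_right_mul_le; rewrite ?invr_gt0.
have in_ball x : `|x - zeta| < d -> ball zeta r x.
  by move=> xd; rewrite -ball_normE /= distrC; exact: lt_le_trans xd dr.
have step x : `|x - zeta| < d -> `|newton F x - zeta| <= c * `|x - zeta| ^+ 2.
  by move=> /in_ball/near_zeta[].
exists [set x | `|x - zeta| < d]; first exact: (near_norm_lt zeta d0).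
exists (complex.Re c) => x0 x0d; rewrite -ge0_ofR_Re //.
have iter_d k := (quadratic_contraction_iter c0 cd step k x0d).1.
split=> [k||k]; last exact: step (iter_d k).
  by have [] := near_zeta _ (in_ball _ (iter_d k)).
exact: (quadratic_contraction_cvg c0 d0 cd step x0d).
Unshelve. all: by end_near.
Qed.

End NondegenerateZero.

Lemma newton_cvg_quadraticallyW n (D E V : set 'rV[C]_n) F zeta : D `<=` E ->
  newton_cvg_quadratically D F V zeta -> newton_cvg_quadratically E F V zeta.
Proof.
move=> DE [c newton_V]; exists c => x Vx; have [iter_D iter_cvg iter_le] := newton_V x Vx.
by split=> // k; have [/DE Dk unit_k] := iter_D k.
Qed.

End NewtonConvergence.
(** * Nonnegative irreducible matrices *)

Section EntrywiseOrder.
Context {F : numDomainType}.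

Definition mx_ge0 m n (A : 'M[F]_(m, n)) := forall i j, 0 <= A i j.

Definition mx_gt0 m n (A : 'M[F]_(m, n)) := forall i j, 0 < A i j.

Definition mx_le m n (A B : 'M[F]_(m, n)) := forall i j, A i j <= B i j.

Definition irreducible_mx n (A : 'M[F]_n) :=
  forall i j, connect [rel i j | 0 < A i j] i j.

Lemma norm_mx_ge0 m n (A : 'M[F]_(m, n)) : mx_ge0 (map_mx Num.norm A).
Proof. by move=> i j; rewrite mxE. Qed.

Lemma norm_mx_eq0 m n (A : 'M[F]_(m, n)) : map_mx Num.norm A = 0 -> A = 0.
Proof.
move=> /matrixP A0; apply/matrixP => i j; apply/eqP; rewrite [X in _ == X]mxE -normr_eq0.
by have := A0 i j; rewrite !mxE => ->.
Qed.

Lemma mulmx_ge0 m n p (A : 'M[F]_(m, n)) (B : 'M[F]_(n, p)) :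
  mx_ge0 A -> mx_ge0 B -> mx_ge0 (A *m B).
Proof. by move=> A0 B0 i j; rewrite mxE sumr_ge0 // => k _; rewrite mulr_ge0. Qed.

Lemma mulmx_gt0 n (u : 'rV[F]_n) (v : 'cV[F]_n) :
  mx_gt0 u -> mx_ge0 v -> v != 0 -> 0 < (u *m v) 0 0.
Proof.
move=> u0 v0 /cV0Pn[k vk]; rewrite mxE (bigD1 k) //= ltr_pwDl //.
  by rewrite mulr_gt0 // lt_neqAle eq_sym vk v0.
by apply: sumr_ge0 => l _; rewrite mulr_ge0 // ltW.
Qed.

Lemma nilpotent_solve n (A : 'M[F]_n) e : mx_ge0 A -> A ^+ e = 0 ->
  exists2 v : 'cV[F]_n, mx_ge0 v & v - A *m v = const_mx 1.
Proof.
move=> A0 Ae; have pow_ge0 l : mx_ge0 (A ^+ l).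
  elim: l => [|l IH]; last by rewrite exprS; exact: mulmx_ge0.
  by move=> i j; rewrite expr0 mxE ler0n.
pose S := \sum_(l < e) A ^+ l.
have AS : (1%:M - A) *m S = 1%:M.
  apply: oppr_inj; rewrite -mulNmx opprB mulmxE.
  by have := subrX1 A e; rewrite Ae sub0r => <-.
exists (S *m const_mx 1); last by rewrite -{1}[S *m _]mul1mx -mulmxBl mulmxA AS mul1mx.
apply: mulmx_ge0 => i j; last by rewrite mxE.
by rewrite summxE sumr_ge0 // => l _; exact: pow_ge0.
Qed.

Lemma irreducible_mx_tr n (A : 'M[F]_n) : irreducible_mx A -> irreducible_mx A^T.
Proof.
move=> A_irr i j; rewrite connect_rev /=.
by rewrite (eq_connect (e' := [rel i j | 0 < A i j])) // => k l; rewrite /= mxE.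
Qed.

Lemma connect_ind_bwd (T : finType) (e : rel T) (P : T -> Prop) i j :
  (forall k l, e k l -> P l -> P k) -> connect e i j -> P j -> P i.
Proof.
move=> eP /connectP[p + ->]; elim: p i => [|k p IH] i //= /andP[ik kp] Pj.
by apply: eP ik _; apply: IH.
Qed.

Lemma connect_ind_fwd (T : finType) (e : rel T) (P : T -> Prop) i j :
  (forall k l, e k l -> P k -> P l) -> connect e i j -> P i -> P j.
Proof.
move=> eP /connectP[p + ->]; elim: p i => [|k p IH] i //= /andP[ik kp] Pi.
by apply: IH => //; apply: eP ik Pi.
Qed.

Lemma subinvariant_gt0 n (A : 'M[F]_n) (w : 'cV[F]_n) : mx_ge0 A -> irreducible_mx A ->
  mx_ge0 w -> w != 0 -> mx_le (A *m w) w -> mx_gt0 w.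
Proof.
move=> A0 A_irr w0 /cV0Pn[k wk] Aw i j; rewrite (ord1 j).
apply: (@connect_ind_bwd _ _ (fun i => 0 < w i 0) _ _ _ (A_irr i k)) => [a b /= ab wb|].
  apply: lt_le_trans (Aw a 0); rewrite mxE (bigD1 b) //= ltr_pwDl ?mulr_gt0 //.
  by apply: sumr_ge0 => l _; rewrite mulr_ge0.
by rewrite lt_neqAle eq_sym wk w0.
Qed.

End EntrywiseOrder.

Section Subinvariant.
Context {F : realFieldType} {n : nat}.
Variables (A : 'M[F]_n) (w : 'cV[F]_n).
Hypotheses (A_ge0 : mx_ge0 A) (A_irr : irreducible_mx A).
Hypotheses (w_gt0 : mx_gt0 w) (Aw : mx_le (A *m w) w).
Implicit Types q x : 'cV[F]_n.

(* The set where [q / w] is maximal is closed under the dependencies of [A]. *)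
Lemma superinvariant_proportional q :
  mx_ge0 q -> mx_le q (A *m q) -> exists2 t, 0 <= t & q = t *: w.
Proof.
move=> q0 qA; have [i0 _|no_index] := pickP (fun _ : 'I_n => true); last first.
  by exists 0 => //; apply/colP => i; have := no_index i.
have [k _ kmax] := @arg_maxP _ _ _ i0 xpredT (fun i => q i 0 / w i 0) isT.
set t := q k 0 / w k 0.
have t0 : 0 <= t by rewrite divr_ge0 // ltW.
have qt i : q i 0 <= t * w i 0 by rewrite -ler_pdivrMr //; exact: kmax.
exists t => //; apply/colP => i; rewrite mxE.
apply: (@connect_ind_fwd _ _ (fun i => q i 0 = t * w i 0) _ _ _ (A_irr k i)); last first.
  by rewrite divfK // gt_eqF.
move=> a b /= ab qa.
have gap_ge0 j : 0 <= A a j * (t * w j 0 - q j 0) by rewrite mulr_ge0 // subr_ge0.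
have gap_sum : \sum_j A a j * (t * w j 0 - q j 0) <= 0.
  under eq_bigr do rewrite mulrBr mulrCA.
  rewrite sumrB -mulr_sumr subr_le0; have := qA a 0; rewrite mxE qa; apply: le_trans.
  by rewrite ler_wpM2l //; have := Aw a 0; rewrite mxE.
have : A a b * (t * w b 0 - q b 0) = 0.
  apply/eqP; rewrite eq_le gap_ge0 andbT; apply: le_trans gap_sum.
  exact: (ler_term_sum (F := fun j => A a j * (t * w j 0 - q j 0))).
by move/eqP; rewrite mulf_eq0 gt_eqF //= subr_eq0 eq_sym => /eqP.
Qed.

Lemma superinvariant_eq0 q i :
  mx_ge0 q -> mx_le q (A *m q) -> q i 0 = 0 -> q = 0.
Proof.
move=> q0 qA qi; have [t _ qt] := superinvariant_proportional q0 qA.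
move/eqP: qi; rewrite qt mxE mulf_eq0 [w _ _ == _]gt_eqF // orbF => /eqP ->.
by rewrite scale0r.
Qed.

Lemma norm_invariant_le x : A *m x = x -> mx_le (map_mx Num.norm x) (A *m map_mx Num.norm x).
Proof.
move=> Ax i j; rewrite mxE -{1}Ax !mxE; apply: le_trans (ler_norm_sum _ _ _) _.
by apply: ler_sum => k _; rewrite mxE normrM ger0_norm.
Qed.

Lemma subinvariant_solve : \det (1%:M - A) != 0 ->
  exists2 v : 'cV[F]_n, mx_ge0 v & v - A *m v = const_mx 1.
Proof.
move=> dA; have A_unit : 1%:M - A \in unitmx by rewrite unitmxE unitfE.
pose v := invmx (1%:M - A) *m const_mx 1 : 'cV_n.
have vE : v - A *m v = const_mx 1 by rewrite -{1}[v]mul1mx -mulmxBl mulKVmx.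
exists v => // i j; rewrite (ord1 j).
have [k _ kmin] := @arg_minP _ _ _ i xpredT (fun i => v i 0 / w i 0) isT.
set t := v k 0 / w k 0 in kmin.
have vt l : t * w l 0 <= v l 0 by rewrite -ler_pdivlMr //; exact: kmin.
suff t0 : 0 <= t by rewrite (le_trans _ (vt i)) // mulr_ge0 // ltW.
rewrite leNgt; apply/negP => t_lt0.
have Av_ge : t * (A *m w) k 0 <= (A *m v) k 0.
  by rewrite !mxE mulr_sumr; apply: ler_sum => l _; rewrite mulrCA ler_wpM2l.
have tw_le : t * w k 0 <= t * (A *m w) k 0 by rewrite ler_nM2l.
have vk : v k 0 = t * w k 0 by rewrite /t divfK // gt_eqF.
have := congr1 (fun x : 'cV_n => x k 0) vE; rewrite [LHS]mxE [X in _ + X]mxE [RHS]mxE.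
lra.
Qed.

Hypothesis det0 : \det (1%:M - A) = 0.

Lemma singular_invariant : exists2 x : 'cV[F]_n, x != 0 & A *m x = x.
Proof.
have /eqP/det0P[v v0 vA] : \det (1%:M - A)^T = 0 by rewrite det_tr.
exists v^T; first by rewrite -trmx_eq0 trmxK.
move/(congr1 trmx)/eqP: vA; rewrite trmx_mul trmxK trmx0 mulmxBl mul1mx subr_eq0.
by move/eqP.
Qed.

Lemma subinvariant_invariant : A *m w = w.
Proof.
have [x x0 Ax] := singular_invariant; have xA := norm_invariant_le Ax.
have [t t0 xt] := superinvariant_proportional (norm_mx_ge0 x) xA.
have t_gt0 : 0 < t.
  rewrite lt_neqAle t0 andbT; apply: contra_neq x0 => t_0.
  by apply: norm_mx_eq0; rewrite xt -t_0 scale0r.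
apply/matrixP => i j; apply/eqP; rewrite eq_le Aw /= -(ler_pM2l t_gt0).
by move: (xA i j); rewrite xt -scalemxAr [X in X <= _]mxE [X in _ <= X]mxE.
Qed.

Lemma invariant_proportional x : A *m x = x -> exists t, x = t *: w.
Proof.
move=> Ax; have [i _|no_index] := pickP (fun _ : 'I_n => true); last first.
  by exists 0; apply/colP => i; have := no_index i.
set t := x i 0 / w i 0; exists t.
have Ad : A *m (x - t *: w) = x - t *: w.
  by rewrite mulmxBr Ax -scalemxAr subinvariant_invariant.
have di : map_mx Num.norm (x - t *: w) i 0 = 0.
  by rewrite !mxE divfK ?gt_eqF // subrr normr0.
have /norm_mx_eq0/eqP := superinvariant_eq0 (norm_mx_ge0 _) (norm_invariant_le Ad) di.
by rewrite subr_eq0 => /eqP.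
Qed.

(* Pairing with [w] turns [q <= q A] into an equality. *)
Lemma left_superinvariant_invariant (q : 'rV[F]_n) : mx_le q (q *m A) -> q *m A = q.
Proof.
move=> qA; have gap_ge0 j : 0 <= (q *m A - q) 0 j * w j 0.
  by rewrite mulr_ge0 // ?(ltW (w_gt0 _ _)) // !mxE subr_ge0; have := qA 0 j; rewrite mxE.
have gap_sum : \sum_j (q *m A - q) 0 j * w j 0 = 0.
  have : ((q *m A - q) *m w) 0 0 = 0.
    by rewrite mulmxBl -mulmxA subinvariant_invariant subrr mxE.
  by rewrite mxE.
apply/eqP; rewrite -subr_eq0; apply/eqP/rowP => j; rewrite [RHS]mxE.
have /(_ j isT)/eqP := psumr_eq0P (fun k _ => gap_ge0 k) gap_sum.
by rewrite mulf_eq0 [w _ _ == _]gt_eqF // orbF => /eqP.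
Qed.

Lemma left_invariant_gt0 : exists2 u : 'rV[F]_n, mx_gt0 u & u *m A = u.
Proof.
have /eqP/det0P[v v0 vA] := det0.
have {}vA : v *m A = v by apply/eqP; rewrite eq_sym -subr_eq0 -{1}[v]mulmx1 -mulmxBr vA.
pose u := map_mx Num.norm v.
have uA : u *m A = u.
  apply: left_superinvariant_invariant => i j; rewrite mxE -{1}vA !mxE.
  apply: le_trans (ler_norm_sum _ _ _) _; apply: ler_sum => k _.
  by rewrite mxE normrM (ger0_norm (A_ge0 _ _)).
exists u => // i j; rewrite -[u]trmxK mxE.
apply: (subinvariant_gt0 (A := A^T)).
- by move=> a b; rewrite mxE.
- exact: irreducible_mx_tr.
- by move=> a b; rewrite !mxE.
- apply: contra_neq v0 => /(congr1 trmx); rewrite trmxK trmx0.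
  exact: norm_mx_eq0.
- by move=> a b; rewrite -trmx_mul uA.
Qed.

(* A kernel vector of the minor extends by [0] to a superinvariant vector. *)
Lemma principal_cofactor_neq0 i : cofactor (1%:M - A) i i != 0.
Proof.
rewrite /cofactor mulf_neq0 ?signr_eq0 // -det_tr; apply/det0P => -[v v0 vN].
pose q : 'cV[F]_n := \col_k if unlift i k is Some l then `|v 0 l| else 0.
have q_lift l : q (lift i l) 0 = `|v 0 l| by rewrite mxE liftK.
have qi : q i 0 = 0 by rewrite mxE unlift_none.
have q0 : mx_ge0 q by move=> k j; rewrite mxE; case: unlift.
have vE l : v 0 l = \sum_k A (lift i l) (lift i k) * v 0 k.
  have /rowP/(_ l) := vN; rewrite !mxE => e; apply/eqP; rewrite -subr_eq0 -[X in _ == X]e.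
  apply/eqP; rewrite (bigD1 l) //= [X in _ = X](bigD1 l) //= !mxE eqxx.
  rewrite mulrBr mulr1 opprD addrA [v 0 l * _]mulrC; congr (_ + _).
  rewrite -sumrN; apply: eq_bigr => k kl; rewrite !mxE (inj_eq (@lift_inj _ i)).
  by rewrite eq_sym (negPf kl) sub0r mulrN mulrC.
have qA : mx_le q (A *m q).
  move=> k j; rewrite (ord1 j); case: (unliftP i k) => [l ->|->]; last first.
    by rewrite qi mulmx_ge0.
  rewrite q_lift mxE (bigD1_ord i) //= qi mulr0 add0r vE.
  apply: le_trans (ler_norm_sum _ _ _) _; apply: ler_sum => k' _.
  by rewrite normrM (ger0_norm (A_ge0 _ _)) q_lift.
case/eqP: v0; apply/rowP => l; rewrite mxE; apply/eqP.
by rewrite -normr_eq0 -q_lift (superinvariant_eq0 q0 qA qi) mxE.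
Qed.

End Subinvariant.

Section SingularIrreducible.
Context {F : realFieldType} {n : nat}.
Variables (A : 'M[F]_n) (w : 'cV[F]_n) (u : 'rV[F]_n).
Hypotheses (A_ge0 : mx_ge0 A) (A_irr : irreducible_mx A).
Hypotheses (w_gt0 : mx_gt0 w) (Aw : A *m w = w).
Hypotheses (u_gt0 : mx_gt0 u) (uA : u *m A = u).
Hypothesis det0 : \det (1%:M - A) = 0.

Let Aw_le : mx_le (A *m w) w.
Proof. by rewrite Aw => i j. Qed.

Lemma left_invariant_proportional (x : 'rV[F]_n) : x *m A = x -> exists t, x = t *: u.
Proof.
move=> xA; have [t xt] : exists t, x^T = t *: u^T.
  apply: (invariant_proportional (A := A^T)).
  - by move=> i j; rewrite mxE.
  - exact: irreducible_mx_tr.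
  - by move=> i j; rewrite mxE.
  - by rewrite -trmx_mul uA => i j.
  - by rewrite -(trmx1 F n) -linearB det_tr.
  - by rewrite -trmx_mul xA.
by exists t; rewrite -[x]trmxK xt linearZ /= trmxK.
Qed.

Lemma adj_rank1 : exists2 k, k != 0 & \adj (1%:M - A) = k *: (w *m u).
Proof.
have [i _|no_index] := pickP (fun _ : 'I_n => true); last first.
  by exists 1; [exact: oner_neq0|apply/matrixP => i; have := no_index i].
set N := \adj (1%:M - A).
have AN : A *m N = N.
  apply/eqP; rewrite eq_sym -subr_eq0 -{1}[N]mul1mx -mulmxBl mul_mx_adj det0.
  by rewrite raddf0.
have NA : N *m A = N.
  apply/eqP; rewrite eq_sym -subr_eq0 -{1}[N]mulmx1 -mulmxBr mul_adj_mx det0.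
  by rewrite raddf0.
have /choice[r rP] j : exists t, col j N = t *: w.
  apply: (invariant_proportional A_ge0 A_irr w_gt0 Aw_le det0).
  by rewrite colE mulmxA AN.
have NE : N = w *m \row_j r j.
  apply/matrixP => k j; have /colP/(_ k) := rP j.
  by rewrite !mxE big_ord1 mxE mulrC.
have [t rt] : exists t, \row_j r j = t *: u.
  apply: left_invariant_proportional; apply/rowP => j; apply: (mulfI (lt0r_neq0 (w_gt0 i 0))).
  move: NA; rewrite NE -mulmxA => /matrixP/(_ i j).
  by rewrite [LHS]mxE [RHS]mxE !big_ord1.
exists t; last by rewrite NE rt -scalemxAr.
apply: contra_neq (principal_cofactor_neq0 A_ge0 A_irr w_gt0 Aw_le i) => t0.
have /matrixP/(_ i i) : N = 0 by rewrite NE rt t0 scale0r mulmx0.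
by rewrite !mxE.
Qed.

(* A kernel vector [(x, t)] has [t = 0] because [u] annihilates the range of
   [1 - A] while [u b > 0]; then [x] is proportional to [w]. *)
Lemma bordered_unitmx (b : 'rV[F]_n) (c : 'cV[F]_n) (d : 'M[F]_1) :
  mx_ge0 b -> b != 0 -> (w^T *m c) 0 0 != 0 ->
  block_mx (1%:M - A)^T c (- b) d \in unitmx.
Proof.
move=> b0 b_neq0 wc; rewrite -row_free_unit -kermx_eq0; apply/eqP/row_matrixP => i.
rewrite row0; set v := row i _; have : v *m block_mx (1%:M - A)^T c (- b) d = 0.
  by rewrite -row_mul mulmx_ker row0.
rewrite -[v]hsubmxK; set x := lsubmx v; set t := rsubmx v.
rewrite mul_row_block -row_mx0 => /eq_row_mx[/eqP]; rewrite mulmxN subr_eq0 => /eqP xtb xc.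
have t0 : t = 0.
  have : t *m (b *m u^T) = 0.
    by rewrite mulmxA -xtb -mulmxA -trmx_mul mulmxBr mulmx1 uA subrr trmx0 mulmx0.
  rewrite [t]mx11_scalar [b *m u^T]mx11_scalar -scalar_mxM => /matrixP/(_ 0 0).
  have bu : 0 < (b *m u^T) 0 0.
    rewrite -[b]trmxK -trmx_mul mxE mulmx_gt0 // => [k j|]; first by rewrite mxE.
    by rewrite trmx_eq0.
  rewrite [LHS]mxE [RHS]mxE mulr1n => /eqP; rewrite mulf_eq0 [X in _ || X]gt_eqF // orbF.
  by move=> /eqP ->; rewrite raddf0.
have Ax : A *m x^T = x^T.
  apply/eqP; rewrite eq_sym -subr_eq0 -{1}[x^T]mul1mx -mulmxBl -[1%:M - A]trmxK -trmx_mul.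
  by rewrite xtb t0 mul0mx trmx0.
have [s xs] := invariant_proportional A_ge0 A_irr w_gt0 Aw_le det0 Ax.
have xE : x = s *: w^T by rewrite -[x]trmxK xs linearZ.
have s0 : s = 0.
  move: xc; rewrite t0 mul0mx addr0 xE -scalemxAl => /matrixP/(_ 0 0).
  by rewrite [LHS]mxE [RHS]mxE => /eqP; rewrite mulf_eq0 (negPf wc) orbF => /eqP.
by rewrite t0 xE s0 scale0r row_mx0.
Qed.

Lemma adj_contraction_neq0 (B : 'I_n -> 'I_n -> 'cV[F]_n) :
  (forall i j, mx_ge0 (B i j)) -> (exists i j, B i j != 0) ->
  (w^T *m \sum_i \sum_j cofactor (1%:M - A) i j *: B i j) 0 0 != 0.
Proof.
move=> B0 [i [j Bij]]; have [k k0 adjE] := adj_rank1.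
have cofE a b : cofactor (1%:M - A) a b = k * (w b 0 * u 0 a).
  by have /matrixP/(_ b a) := adjE; rewrite !mxE big_ord1.
have -> : (w^T *m \sum_i \sum_j cofactor (1%:M - A) i j *: B i j) 0 0 =
    k * \sum_a \sum_b w b 0 * u 0 a * (w^T *m B a b) 0 0.
  rewrite mulmx_sumr summxE mulr_sumr; apply: eq_bigr => a _.
  rewrite mulmx_sumr summxE mulr_sumr; apply: eq_bigr => b _.
  by rewrite -scalemxAr mxE cofE [RHS]mulrA.
have wT : mx_gt0 w^T by move=> a b; rewrite mxE.
have term_ge0 a b : 0 <= w b 0 * u 0 a * (w^T *m B a b) 0 0.
  rewrite !mulr_ge0 ?(ltW (w_gt0 _ _)) ?(ltW (u_gt0 _ _)) //.
  by apply: mulmx_ge0 => // x y; exact: ltW (wT x y).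
rewrite mulf_neq0 // gt_eqF // (lt_le_trans (_ : 0 < w j 0 * u 0 i * (w^T *m B i j) 0 0)) //.
  by rewrite !mulr_gt0 ?mulmx_gt0.
apply: le_trans (ler_term_sum (F := fun a => \sum_b _) i _) => [|a]; last exact: sumr_ge0.
exact: (ler_term_sum (F := fun b => w b 0 * u 0 i * (w^T *m B i b) 0 0)).
Qed.

End SingularIrreducible.

Section SubinvariantLimit.
Context {R : realType} {n : nat}.
Variable A : 'M[R]_n.
Implicit Type v : 'rV[R]_n.

Definition subinvariance_excess v : R := \sum_i Num.max 0 ((A *m v^T) i 0 - v 0 i).

Lemma subinvariance_excess_continuous : continuous subinvariance_excess.
Proof.
move=> v; have ? := nbhs_filter v; apply: (cvg_big (@add_continuous _)) => i _.
have gap_cont : {for v, continuous (fun v => (A *m v^T) i 0 - v 0 i)}.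
  apply: cvgB; last exact: coord_continuous.
  rewrite mxE; under eq_cvg do rewrite mxE.
  apply: (cvg_big (@add_continuous _)) => j _; apply: cvgMl_tmp.
  by rewrite mxE; under eq_cvg do rewrite mxE; exact: coord_continuous.
by have := continuous_max (@cst_continuous _ _ (0 : R) v) gap_cont.
Qed.

Lemma subinvariance_excess_le0 v : subinvariance_excess v <= 0 -> mx_le (A *m v^T) v^T.
Proof.
move=> excess0 i j; have term_ge0 k : 0 <= Num.max 0 ((A *m v^T) k 0 - v 0 k).
  by rewrite le_max lexx.
have := le_trans (ler_term_sum i term_ge0) excess0.
by rewrite ge_max subr_le0 (ord1 j) [v^T i 0]mxE => /andP[].
Qed.

Let simplex := [set v : 'rV[R]_n | forall i, `[0, 1]%classic (v 0 i)] `&`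
  [set v | \sum_i v 0 i = 1].

Let simplex_compact : compact simplex.
Proof.
apply: compact_closedI.
  exact: (@rV_compact R n (fun=> `[0, 1]%classic) (fun=> @segment_compact R 0 1)).
have sum_cont : continuous (fun v : 'rV[R]_n => \sum_i v 0 i).
  move=> v; have ? := nbhs_filter v.
  by apply: (cvg_big (@add_continuous _)) => i _; exact: coord_continuous.
by have /continuous_closedP := sum_cont => /(_ _ (@closed_eq R 1)).
Qed.

Hypothesis near_subinvariant : forall e, 0 < e -> exists v : 'rV[R]_n,
  [/\ mx_ge0 v, \sum_i v 0 i = 1 & forall i, (A *m v^T) i 0 <= v 0 i + e].

Let excess_small e : 0 < e -> exists2 v, v \in simplex & subinvariance_excess v <= n%:R * e.
Proof.
move=> e0; have [v [v0 v1 Av]] := near_subinvariant e0; exists v.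
  rewrite inE; split=> // i /=; rewrite in_itv /= v0 -v1.
  exact: (ler_term_sum (F := fun i => v 0 i)).
rewrite mulr_natl -[X in _ *+ X](card_ord n) -sumr_const; apply: ler_sum => i _.
by rewrite ge_max (ltW e0) lerBlDl Av.
Qed.

(* The excess attains its infimum [0] on the compact simplex. *)
Lemma subinvariant_limit : exists w : 'cV[R]_n, [/\ mx_ge0 w, w != 0 & mx_le (A *m w) w].
Proof.
have [v0 /set_mem v0S _] := excess_small ltr01.
have [v /set_mem[v01 v1] v_min] := EVT_min_rV (ex_intro _ v0 v0S) simplex_compact
  (continuous_subspaceT subinvariance_excess_continuous).
have excess0 : subinvariance_excess v <= 0.
  apply/ler_addgt0Pr => e e0; rewrite add0r.
  have [v' v'S excess_v'] := excess_small (divr_gt0 e0 (ltr0Sn R n)).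
  apply: le_trans (v_min _ v'S) (le_trans excess_v' _).
  by rewrite mulrCA ger_pMr // ler_pdivrMr ?ltr0Sn // mul1r ler_nat.
exists v^T; split; last exact: subinvariance_excess_le0.
  by move=> i j; rewrite mxE (ord1 j); have := v01 i; rewrite /= in_itv /= => /andP[].
apply: contra_eqN v1 => /eqP/(congr1 trmx); rewrite trmxK trmx0 => ->.
by under eq_bigr do rewrite mxE; rewrite sumr_const mul0rn eq_sym oner_eq0.
Qed.

End SubinvariantLimit.

Lemma near_subinvariant_normalize (F : realFieldType) (n : nat) (A B : 'M[F]_n)
    (d : 'rV[F]_n) (e : F) :
  (forall i j, A i j <= B i j + e) -> mx_ge0 d -> d != 0 -> mx_le (B *m d^T) d^T ->
  exists v : 'rV[F]_n, [/\ mx_ge0 v, \sum_i v 0 i = 1 &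
    forall i, (A *m v^T) i 0 <= v 0 i + e].
Proof.
move=> AB d0 /rV0Pn[k dk] Bd; set S := \sum_i d 0 i.
have S0 : 0 < S.
  rewrite /S (bigD1 k) //= ltr_pwDl //; last by apply: sumr_ge0 => i _; exact: d0.
  by rewrite lt_neqAle eq_sym dk d0.
exists (S^-1 *: d); split=> [i j||i].
- by rewrite mxE mulr_ge0 // invr_ge0 ltW.
- by under eq_bigr do rewrite mxE; rewrite -mulr_sumr mulVf ?gt_eqF.
rewrite linearZ -scalemxAr [leLHS]mxE [X in _ <= X + _]mxE ler_pdivrMl // mulrDr.
rewrite mulVKf ?gt_eqF //.
have -> : S * e = \sum_j e * d 0 j by rewrite -mulr_sumr mulrC.
apply: le_trans (_ : \sum_j (B i j + e) * d 0 j <= _).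
  by rewrite mxE; apply: ler_sum => j _; rewrite mxE ler_wpM2r.
under eq_bigr do rewrite mulrDl.
rewrite big_split lerD2r; have := Bd i 0; rewrite !mxE; apply: le_trans.
by apply: ler_sum => j _; rewrite mxE.
Qed.
(** * Expansions at the origin *)

Section SmallArguments.
Context {K : numFieldType}.

Definition bigOXn (V : normedZmodType K) (N : nat) (f : K -> V) : Prop :=
  exists2 M, 0 <= M & \forall x \near 0^'+, `|f x| <= M * x ^+ N.

Section NormedZmodule.
Context {V W : normedZmodType K}.
Implicit Types (f g : K -> V) (N : nat).

Lemma bigOXn_near N f g :
  (\forall x \near 0^'+, f x = g x) -> bigOXn N f -> bigOXn N g.
Proof.
by move=> fg [M M0 fM]; exists M => //; apply: filterS2 fg fM => x ->.
Qed.

Lemma eq_bigOXn N f g : f =1 g -> bigOXn N f -> bigOXn N g.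
Proof. by move=> fg; apply: bigOXn_near; exact: nearW. Qed.

Lemma bigOXn_norm_le N f (g : K -> W) :
  (\forall x \near 0^'+, `|f x| <= `|g x|) -> bigOXn N g -> bigOXn N f.
Proof.
by move=> fg [M M0 gM]; exists M => //; apply: filterS2 fg gM => x; exact: le_trans.
Qed.

Lemma bigOXnD N f g : bigOXn N f -> bigOXn N g -> bigOXn N (fun x => f x + g x).
Proof.
move=> [M M0 fM] [M' M0' gM']; exists (M + M'); first exact: addr_ge0.
apply: filterS2 fM gM' => x fx gx; apply: le_trans (ler_normD _ _) _.
by rewrite mulrDl lerD.
Qed.

Lemma bigOXnW N N' f : (N' <= N)%N -> bigOXn N f -> bigOXn N' f.
Proof.
move=> NN [M M0 fM]; exists M => //.
apply: filterS3 (nbhs_right_ge (0 : K)) (nbhs_right_le ltr01) fM => x x0 x1 /le_trans; apply.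
by rewrite ler_wpM2l // -(subnK NN) exprD ler_piMl ?exprn_ge0 // exprn_ile1.
Qed.

Lemma bigOXn_sum (I : Type) (r : seq I) N (f : I -> K -> V) :
  (forall i, bigOXn N (f i)) -> bigOXn N (fun x => \sum_(i <- r) f i x).
Proof.
move=> fN; elim: r => [|i r IH].
  by exists 0 => //; apply: nearW => x; rewrite big_nil normr0 mul0r.
by apply: eq_bigOXn (bigOXnD (fN i) IH) => x; rewrite big_cons.
Qed.

Lemma bigOXn_near_lt N f d :
  bigOXn N.+1 f -> 0 < d -> \forall x \near 0^'+, `|f x| < d.
Proof.
move=> /(bigOXnW (ltn0Sn N)) [M M0 fM] d0.
have d2 : 0 < d / 2 by rewrite divr_gt0.
apply: filterS2 (near0_right_mul_le M0 d2) fM => x xM /le_lt_trans; apply.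
by rewrite expr1 mulrC (le_lt_trans xM) // gtr_pMr // invf_lt1 ?ltr1n.
Qed.

End NormedZmodule.

Lemma bigOXn_norm (V : normedZmodType K) N (f : K -> V) :
  bigOXn N f -> bigOXn N (fun x => `|f x|).
Proof. by apply: bigOXn_norm_le; apply: nearW => x; rewrite normr_id. Qed.

Lemma bigOXnN (V : normedZmodType K) N (f : K -> V) :
  bigOXn N f -> bigOXn N (fun x => - f x).
Proof. by apply: bigOXn_norm_le; apply: nearW => x; rewrite normrN. Qed.

Lemma bigOXnB (V : normedZmodType K) N (f g : K -> V) :
  bigOXn N f -> bigOXn N g -> bigOXn N (fun x => f x - g x).
Proof. by move=> fN gN; apply: bigOXnD => //; exact: bigOXnN. Qed.

Lemma bigOXn_rowP n N (f : K -> 'rV[K]_n) :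
  bigOXn N f <-> forall i, bigOXn N (fun x => f x 0 i).
Proof.
split=> [fN i|fN].
  by apply: bigOXn_norm_le fN; apply: nearW => x; exact: ler_coord_norm.
apply: (bigOXn_norm_le _ (bigOXn_sum (index_enum 'I_n) (fun i => bigOXn_norm (fN i)))).
apply: nearW => x; rewrite [leRHS]ger0_norm ?sumr_ge0 //.
apply: norm_row_le => [|i]; first exact: sumr_ge0.
exact: (ler_term_sum (F := fun i => `|f x 0 i|)).
Qed.

Lemma bigOXn_mulmx n p N (f : K -> 'rV[K]_n) (A : 'M[K]_(n, p)) :
  bigOXn N f -> bigOXn N (fun x => f x *m A).
Proof.
move=> [M M0 fM]; exists (entry_norm A * M); first by rewrite mulr_ge0 ?entry_norm_ge0.
apply: filterS fM => x fx; apply: le_trans (norm_mulmx_le _ _) _.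
by rewrite -mulrA ler_wpM2l ?entry_norm_ge0.
Qed.

Implicit Types (f g : K -> K) (N : nat).

Lemma bigOXnM N N' f g :
  bigOXn N f -> bigOXn N' g -> bigOXn (N + N') (fun x => f x * g x).
Proof.
move=> [M M0 fM] [M' M0' gM']; exists (M * M'); first exact: mulr_ge0.
by apply: filterS2 fM gM' => x fx gx; rewrite normrM exprD mulrACA ler_pM.
Qed.

Lemma bigOXn_cst (c : K) : bigOXn 0 (fun=> c).
Proof. by exists `|c| => //; apply: nearW => x; rewrite expr0 mulr1. Qed.

Lemma bigOXn_exprn N (c : K) : bigOXn N (fun x => x ^+ N * c).
Proof.
exists `|c| => //; apply: filterS (nbhs_right_ge (0 : K)) => x x0.
by rewrite normrM (ger0_norm (exprn_ge0 _ x0)) mulrC.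
Qed.

Lemma bigOXn_exprnZ n N (v : 'rV[K]_n) : bigOXn N (fun x => x ^+ N *: v).
Proof.
by apply/bigOXn_rowP => i; apply: eq_bigOXn (bigOXn_exprn N (v 0 i)) => x; rewrite rowZE.
Qed.

Lemma bigOXn_cst_eq0 N (c : K) : bigOXn N.+1 (fun=> c) -> c = 0.
Proof.
move=> c_O; apply/eqP/negPn/negP => c0.
have : 0 < `|c| by rewrite normr_gt0.
by move=> /(bigOXn_near_lt c_O)/filter_ex[x]; rewrite ltxx.
Qed.

Lemma bigOXn_poly_eq0 N (a : nat -> K) :
  bigOXn N (fun x => \sum_(k < N) x ^+ k * a k) -> forall k, (k < N)%N -> a k = 0.
Proof.
elim: N a => [//|N IH] a aO.
have a0 : a 0%N = 0.
  apply: (@bigOXn_cst_eq0 0); pose g (x : K) := \sum_(i < N) x ^+ (lift ord0 i) * a (lift ord0 i).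
  apply: (eq_bigOXn (f := fun x => (\sum_(k < N.+1) x ^+ k * a k) - g x)).
    by move=> x; rewrite big_ord_recl expr0 mul1r addrK.
  apply: bigOXnB; first exact: bigOXnW aO.
  by apply: bigOXn_sum => i; apply: (bigOXnW (N := lift ord0 i)) => //; exact: bigOXn_exprn.
case=> [//|k] kN; apply: (IH (fun k => a k.+1)) => //.
have [M M0 aM] := aO; exists M => //.
apply: filterS2 (nbhs_right_gt (0 : K)) aM => x x0.
rewrite big_ord_recl a0 mulr0 add0r.
under eq_bigr do rewrite /bump /= exprS -mulrA.
by rewrite -mulr_sumr normrM (gtr0_norm x0) exprS mulrCA ler_pM2l.
Qed.

End SmallArguments.

Section NonnegativePolynomials.
Context {K : numDomainType}.
Implicit Types (p q : {poly K}).

Definition coef_le p q : Prop := forall k, 0 <= p`_k <= q`_k.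

Lemma coef_le_refl p : (forall k, 0 <= p`_k) -> coef_le p p.
Proof. by move=> p0 k; rewrite p0 lexx. Qed.

Lemma coef_le_sum (I : Type) (r : seq I) (p q : I -> {poly K}) :
  (forall i, coef_le (p i) (q i)) -> coef_le (\sum_(i <- r) p i) (\sum_(i <- r) q i).
Proof.
move=> pq k; rewrite !coef_sum sumr_ge0 ?ler_sum // => i _;
by have /andP[] := pq i k.
Qed.

Lemma coef_leM p q p' q' : coef_le p q -> coef_le p' q' -> coef_le (p * p') (q * q').
Proof.
move=> pq pq' k; rewrite !coefM sumr_ge0 /= => [|i _].
  apply: ler_sum => i _; have /andP[p0 ple] := pq i; have /andP[p0' ple'] := pq' (k - i)%N.
  exact: ler_pM.
by rewrite mulr_ge0 //; [have /andP[] := pq i|have /andP[] := pq' (k - i)%N].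
Qed.

Lemma coef_le_exp p q n : coef_le p q -> coef_le (p ^+ n) (q ^+ n).
Proof.
move=> pq; elim: n => [|n IH]; last by rewrite !exprS; apply: coef_leM.
by rewrite !expr0; apply: coef_le_refl => k; rewrite coef1.
Qed.

Lemma coef_le_prod (I : Type) (r : seq I) (p q : I -> {poly K}) :
  (forall i, coef_le (p i) (q i)) -> coef_le (\prod_(i <- r) p i) (\prod_(i <- r) q i).
Proof.
move=> pq; apply: (big_ind2 coef_le) => //; last by move=> *; apply: coef_leM.
by apply: coef_le_refl => k; rewrite coef1.
Qed.

Lemma coef_leZ (c : K) p q : 0 <= c -> coef_le p q -> coef_le (c *: p) (c *: q).
Proof.
by move=> c0 pq k; have /andP[p0 ple] := pq k; rewrite !coefZ mulr_ge0 //= ler_wpM2l.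
Qed.

Lemma horner_ge0 p (x : K) : (forall k, 0 <= p`_k) -> 0 <= x -> 0 <= p.[x].
Proof.
move=> p0 x0; rewrite horner_coef; apply: sumr_ge0 => i _.
by rewrite mulr_ge0 // exprn_ge0.
Qed.

Lemma ler_horner p (x y : K) :
  (forall k, 0 <= p`_k) -> 0 <= x -> x <= y -> p.[x] <= p.[y].
Proof.
move=> p0 x0 xy; rewrite !horner_coef; apply: ler_sum => i _.
by rewrite ler_wpM2l // lerXn2r ?nnegrE // (le_trans x0).
Qed.

Lemma coef_le_horner p q (x : K) : coef_le p q -> 0 <= x -> p.[x] <= q.[x].
Proof.
move=> pq x0; rewrite -subr_ge0 -hornerN -hornerD horner_ge0 // => k.
by rewrite coefB subr_ge0; have /andP[] := pq k.
Qed.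

Lemma horner_partial_sum p N (x : K) :
  p.[x] = \sum_(k < N) x ^+ k * p`_k + (drop_poly N p).[x] * x ^+ N.
Proof.
rewrite -{1}(poly_take_drop N p) hornerD hornerM hornerXn; congr (_ + _).
rewrite (horner_coef_wide x (size_take_poly N p)); apply: eq_bigr => k _.
by rewrite coef_take_poly ltn_ord mulrC.
Qed.

End NonnegativePolynomials.

Section HornerTail.
Context {K : numFieldType}.
Variables (p : {poly K}) (N : nat) (x1 : K).
Hypotheses (p_ge0 : forall k, 0 <= p`_k) (x1_gt0 : 0 < x1).

Let drop_ge0 k : 0 <= (drop_poly N p)`_k.
Proof. by rewrite coef_drop_poly. Qed.

Lemma partial_sum_le_horner : \sum_(k < N) x1 ^+ k * p`_k <= p.[x1].
Proof.
by rewrite (horner_partial_sum p N) lerDl mulr_ge0 ?exprn_ge0 ?horner_ge0 ?(ltW x1_gt0).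
Qed.

Lemma horner_tail_le x : 0 <= x -> x <= x1 ->
  `|p.[x] - \sum_(k < N) x ^+ k * p`_k| <= p.[x1] * (x / x1) ^+ N.
Proof.
move=> x0 xx1; have x10 := ltW x1_gt0.
rewrite (horner_partial_sum p N x) addrAC subrr add0r.
rewrite ger0_norm ?mulr_ge0 ?exprn_ge0 ?horner_ge0 // expr_div_n mulrCA mulrC.
rewrite ler_wpM2l ?exprn_ge0 // ler_pdivlMr ?exprn_gt0 //.
rewrite (horner_partial_sum p N x1) ler_wpDl ?sumr_ge0 // => [k _|].
  by rewrite mulr_ge0 ?exprn_ge0.
by rewrite ler_wpM2r ?exprn_ge0 // ler_horner.
Qed.

End HornerTail.

Section IncreasingPolynomials.
Context {R : realType}.
Local Notation C := (Cplx R).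
Variables (P : nat -> {poly C}) (f : C -> C) (x1 : C).
Hypotheses (x1_gt0 : 0 < x1) (P_nd : forall B, coef_le (P B) (P B.+1)).
Hypothesis P_cvg : forall x, 0 <= x -> x <= x1 -> (fun B => (P B).[x]) @ \oo --> f x.

Definition coef_limit k : C := limn (fun B => (P B)`_k).

Let coef_ge0 B k : 0 <= (P B)`_k.
Proof. by have /andP[] := P_nd B k. Qed.

Let coef_nd k : nondecreasing_seq (fun B => (P B)`_k).
Proof. by apply/nondecreasing_seqP => B; have /andP[] := P_nd B k. Qed.

Let horner_le B : (P B).[x1] <= f x1.
Proof.
apply: (nondecreasing_cvg_ge (u := fun B => (P B).[x1])); last exact: P_cvg (ltW _) _.
by apply/nondecreasing_seqP => B'; rewrite coef_le_horner ?(ltW x1_gt0).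
Qed.

Let partial_sum_le B N : \sum_(k < N) x1 ^+ k * (P B)`_k <= f x1.
Proof. exact: le_trans (partial_sum_le_horner _ (coef_ge0 B) x1_gt0) (horner_le B). Qed.

Let coef_cvg k : (fun B => (P B)`_k) @ \oo --> coef_limit k.
Proof.
apply: (nondecreasing_bounded_cvgn (M := f x1 / x1 ^+ k) (coef_nd k)) => B.
rewrite ler_pdivlMr ?exprn_gt0 // mulrC; apply: le_trans (partial_sum_le B k.+1).
rewrite big_ord_recr /= lerDr sumr_ge0 // => i _.
by rewrite mulr_ge0 ?exprn_ge0 ?(ltW x1_gt0).
Qed.

Let partial_sum_cvg N x : (fun B => \sum_(k < N) x ^+ k * (P B)`_k) @ \oo -->
  \sum_(k < N) x ^+ k * coef_limit k.
Proof. by apply: (cvg_big (@add_continuous _)) => k _; apply: cvgMl_tmp. Qed.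

Lemma coef_le_limit B k : (P B)`_k <= coef_limit k.
Proof.
exact: (nondecreasing_cvg_ge (u := fun B => (P B)`_k) (coef_nd k) (coef_cvg (k := k)) B).
Qed.

Lemma coef_limit_ge0 k : 0 <= coef_limit k.
Proof. exact: le_trans (coef_ge0 0 k) (coef_le_limit 0 k). Qed.

Lemma coef_limit_partial_sum_le N : \sum_(k < N) x1 ^+ k * coef_limit k <= f x1.
Proof. by apply: cvg_seq_le_cst (@partial_sum_cvg N x1) _ => B; exact: partial_sum_le. Qed.

Lemma coef_limit_bigOXn N : bigOXn N (fun x => f x - \sum_(k < N) x ^+ k * coef_limit k).
Proof.
have x10 := ltW x1_gt0.
exists (f x1 / x1 ^+ N).
  by rewrite divr_ge0 ?exprn_ge0 // (le_trans _ (horner_le 0)) ?horner_ge0.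
apply: filterS2 (nbhs_right_ge (0 : C)) (nbhs_right_le x1_gt0) => x x0 xx1.
apply: (cvg_seq_le_cst (cvg_norm (cvgB (P_cvg x0 xx1) (@partial_sum_cvg N x)))) => B.
rewrite !fctE mulrAC -mulrA -expr_div_n.
apply: le_trans (horner_tail_le N (coef_ge0 B) x1_gt0 x0 xx1) _.
by rewrite ler_wpM2r ?exprn_ge0 ?divr_ge0.
Qed.

End IncreasingPolynomials.

(** * Generating functions *)

Section GeneratingFunctions.
Context {R : realType}.
Local Notation C := (Cplx R).

Section ScalarSeries.
Variables (c : nat -> C) (r M z : C).
Hypotheses (r_gt0 : 0 < r) (c_bound : forall k, `|c k| * r ^+ k <= M) (z_lt : `|z| < r).

Let S N := \sum_(k < N) z ^+ k * c k.
Let q := `|z| / r.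
Let tail N := M * q ^+ N / (1 - q).

Let q_ge0 : 0 <= q.
Proof. by rewrite divr_ge0 // ltW. Qed.

Let q_lt1 : 0 < 1 - q.
Proof. by rewrite subr_gt0 ltr_pdivrMr // mul1r. Qed.

Let tail_ge0 N : 0 <= tail N.
Proof.
rewrite divr_ge0 ?(ltW q_lt1) // mulr_ge0 ?exprn_ge0 // (le_trans _ (c_bound 0)) //.
by rewrite mulr_ge0 // exprn_ge0 // ltW.
Qed.

Let increments : dominated_increments S (fun N => - tail N).
Proof.
move=> N; rewrite /S big_ord_recr /= addrAC subrr add0r normrM normrX.
have q1 : 1 - q != 0 by rewrite gt_eqF.
have -> : - tail N.+1 - - tail N = q ^+ N * M by rewrite /tail exprS; field.
have -> : `|z| ^+ N = q ^+ N * r ^+ N by rewrite -exprMn divfK // gt_eqF.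
by rewrite -mulrA ler_wpM2l ?exprn_ge0 // mulrC.
Qed.

Let tail_le0 N : - tail N <= 0.
Proof. by rewrite oppr_le0. Qed.

Lemma scalar_series_cvg : S @ \oo --> limn S.
Proof. exact: dominated_increments_cvgn increments tail_le0. Qed.

Lemma scalar_series_tail N : `|limn S - S N| <= M * q ^+ N / (1 - q).
Proof. by have := dominated_increments_lim increments tail_le0 N; rewrite opprK add0r. Qed.

End ScalarSeries.

Lemma cvg_row n (T : Type) (F : set_system T) {FF : Filter F} (u : T -> 'rV[C]_n)
    (l : 'rV[C]_n) :
  (forall j, u t 0 j @[t --> F] --> l 0 j) -> u @ F --> l.
Proof.
move=> ul; apply/cvgrPdist_le => e e0.
have : \forall t \near F, forall j, `|l 0 j - u t 0 j| <= e.
  by apply: filter_forall => j; have /cvgrPdist_le := ul j; apply.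
apply: filterS => t ul_e; apply: norm_row_le; first exact: ltW.
by move=> j; rewrite rowBE.
Qed.

Lemma cvg_coord n (T : Type) (F : set_system T) {FF : Filter F} (u : T -> 'rV[C]_n)
    (l : 'rV[C]_n) j :
  u @ F --> l -> u t 0 j @[t --> F] --> l 0 j.
Proof. exact: (continuous_cvg _ (@coord_continuous C 1 n 0 j l)). Qed.

Context {m : nat}.
Implicit Types y : nat -> 'rV[C]_m.

Definition gf_trunc y N z : 'rV[C]_m := \sum_(k < N) z ^+ k *: y k.

Lemma gf_truncE y N z j : gf_trunc y N z 0 j = \sum_(k < N) z ^+ k * y k 0 j.
Proof. by rewrite summxE; apply: eq_bigr => k _; rewrite mxE. Qed.

Lemma gf_seriesE y z : series (fun k => z ^+ k *: y k) = fun N => gf_trunc y N z.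
Proof. by apply/funext => N; rewrite /series /= big_mkord. Qed.

Section CoefficientBound.
Variables (y : nat -> 'rV[C]_m) (r M : C).
Hypotheses (r_gt0 : 0 < r) (y_bound : forall k j, `|y k 0 j| * r ^+ k <= M).

Let gf_limit z : gf y z = limn (fun N => gf_trunc y N z).
Proof. by rewrite /gf gf_seriesE. Qed.

Lemma gf_trunc_cvg z : `|z| < r -> (fun N => gf_trunc y N z) @ \oo --> gf y z.
Proof.
move=> zr; set l : 'rV[C]_m := \row_j limn (fun N => \sum_(k < N) z ^+ k * y k 0 j).
have trunc_l : (fun N => gf_trunc y N z) @ \oo --> l.
  apply: cvg_row => j; rewrite mxE; under eq_cvg do rewrite gf_truncE.
  exact: (scalar_series_cvg r_gt0 (fun k => y_bound k j) zr).
by rewrite gf_limit (norm_cvg_lim trunc_l).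
Qed.

Lemma gf_trunc_coord_cvg z j :
  `|z| < r -> (fun N => gf_trunc y N z 0 j) @ \oo --> gf y z 0 j.
Proof. by move=> /gf_trunc_cvg; exact: cvg_coord. Qed.

Lemma gf_tail z j N : `|z| < r ->
  `|gf y z 0 j - gf_trunc y N z 0 j| <= M * (`|z| / r) ^+ N / (1 - `|z| / r).
Proof.
move=> zr; have := scalar_series_tail r_gt0 (fun k => y_bound k j) zr N.
rewrite -gf_truncE; congr (`|_ - _| <= _); apply: norm_cvg_lim.
by under eq_cvg do rewrite -gf_truncE; exact: gf_trunc_coord_cvg.
Qed.

Lemma gf_bigOXn N : bigOXn N (fun x => gf y x - gf_trunc y N x).
Proof.
apply/bigOXn_rowP => j; have M0 : 0 <= M.
  by apply: le_trans (y_bound 0 j); rewrite mulr_ge0 // exprn_ge0 // ltW.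
exists (2 * (M / r ^+ N)); first by rewrite mulr_ge0 // divr_ge0 // exprn_ge0 // ltW.
have r2 : 0 < r / 2 by rewrite divr_gt0.
apply: filterS2 (nbhs_right_gt (0 : C)) (nbhs_right_le r2) => x x0 xr.
have xr1 : `|x| < r by rewrite gtr0_norm // (le_lt_trans xr) // gtr_pMr // invf_lt1 ?ltr1n.
rewrite rowBE; apply: le_trans (gf_tail j N xr1) _; rewrite gtr0_norm //.
have half : 2^-1 <= 1 - x / r.
  have -> : 2^-1 = 1 - 2^-1 :> C by field.
  by rewrite lerD2l lerN2 ler_pdivrMr // mulrC.
have half_gt0 : 0 < 1 - x / r by apply: lt_le_trans half; rewrite invr_gt0.
rewrite ler_pdivrMr // expr_div_n.
have -> : 2 * (M / r ^+ N) * x ^+ N * (1 - x / r) =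
  (2 * (1 - x / r)) * (M * (x ^+ N / r ^+ N)) by ring.
rewrite ler_peMl //; first by rewrite mulr_ge0 // divr_ge0 // exprn_ge0 // ltW.
by rewrite mulrC -ler_pdivrMr // mul1r.
Qed.

End CoefficientBound.

Lemma gf0 y (r M : C) : 0 < r -> (forall k j, `|y k 0 j| * r ^+ k <= M) -> gf y 0 = y 0%N.
Proof.
move=> r0 yM; apply/rowP => j; apply/eqP; rewrite -subr_eq0 -normr_le0.
have z0 : `|0 : C| < r by rewrite normr0.
have := gf_tail r0 yM j 1 z0.
by rewrite gf_truncE big_ord1 expr0 mul1r normr0 mul0r expr1 mulr0 mul0r.
Qed.

Lemma cvg_series_coef_bounded y (z : C) : cvgn (series (fun k => z ^+ k *: y k)) ->
  exists2 M, 0 <= M & forall k j, `|y k 0 j| * `|z| ^+ k <= M.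
Proof.
move=> /cvgrPdist_lt/(_ 1 ltr01)[N0 _ tail_lt].
pose S := \sum_(k < N0) `|z ^+ k *: y k|.
have S0 : 0 <= S by apply: sumr_ge0.
exists (2 + S); first by rewrite addr_ge0.
move=> k j; apply: le_trans (_ : `|z ^+ k *: y k| <= _).
  by have := ler_coord_norm (z ^+ k *: y k) j; rewrite mxE normrM normrX mulrC.
have [kN|Nk] := ltnP k N0.
  rewrite ler_wpDl //.
  exact: (ler_term_sum (F := fun k : 'I_N0 => `|z ^+ k *: y k|) (Ordinal kN)).
rewrite ler_wpDr //.
have := lerD (ltW (tail_lt k Nk)) (ltW (tail_lt k.+1 (leqW Nk))).
set u := series _; set L := limn _.
have -> : z ^+ k *: y k = (L - u k) - (L - u k.+1).
  rewrite opprD addrACA subrr add0r opprK addrC /u gf_seriesE /gf_trunc big_ord_recr /=.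
  by rewrite addrAC subrr add0r.
by apply: le_trans; exact: ler_normB.
Qed.

Lemma lt_cvg_radius y (x : R) : (x%:E < cvg_radius y)%E ->
  exists2 r, x < r & exists M : C, forall k j, `|y k 0 j| * ofR r ^+ k <= M.
Proof.
move=> /ereal_sup_gt[_ [z z_cvg <-]]; rewrite lte_fin => xz; exists (modulus z) => //.
by have [M _ yM] := cvg_series_coef_bounded z_cvg; exists M; rewrite ofR_modulus.
Qed.

Lemma cvg_radius_ge y (r : R) (M : C) :
  0 < r -> (forall k j, `|y k 0 j| * ofR r ^+ k <= M) -> (r%:E <= cvg_radius y)%E.
Proof.
move=> r0 yM; apply/lee_subgt0Pr => e e0; pose x := Num.max 0 (r - e).
have xr : x < r by rewrite gt_max r0 ltrBlDr ltrDl.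
have norm_x : `|ofR x| = ofR x by rewrite ger0_norm // ofR_ge0 le_max lexx.
apply: le_trans (_ : (modulus (ofR x))%:E <= _)%E.
  by rewrite -EFinB lee_fin /modulus norm_x le_max lexx orbT.
apply: ereal_sup_ubound; exists (ofR x) => //=; rewrite gf_seriesE.
have r0' : 0 < ofR r by rewrite ofR_gt0.
have x_lt : `|ofR x| < ofR r by rewrite norm_x ltr_ofR.
by have := gf_trunc_cvg r0' yM x_lt; rewrite /gf gf_seriesE.
Qed.

End GeneratingFunctions.
(** * Systems with nonnegative coefficients *)

Section Points.
Context {R : realType} {m : nat}.
Local Notation C := (Cplx R).
Implicit Types (z : C) (Y Z : 'rV[C]_m).

Lemma zY_z z Y : zY z Y 0 (lshift m 0) = z.
Proof. by rewrite row_mxEl mxE. Qed.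

Lemma zY_Y z Y j : zY z Y 0 (rshift 1 j) = Y 0 j.
Proof. by rewrite row_mxEr. Qed.

Lemma zYB z z' Y Y' : zY z Y - zY z' Y' = zY (z - z') (Y - Y').
Proof. by rewrite /zY opp_row_mx add_row_mx -raddfB. Qed.

Lemma zvar_Yvar_ind (P : 'I_(1 + m) -> Prop) :
  P (lshift m 0) -> (forall j, P (rshift 1 j)) -> forall v, P v.
Proof. by move=> Pz PY v; case: (split_ordP v) => k -> //; rewrite (ord1 k). Qed.

Lemma zY_ge0 z Y : 0 <= z -> row_ge0 Y -> row_ge0 (zY z Y).
Proof. by move=> z0 Y0; apply: zvar_Yvar_ind => [|j]; rewrite ?zY_z ?zY_Y. Qed.

Lemma zY_le z z' Y Y' : z <= z' -> row_le Y Y' -> row_le (zY z Y) (zY z' Y').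
Proof. by move=> zz YY; apply: zvar_Yvar_ind => [|j]; rewrite ?zY_z ?zY_Y. Qed.

Lemma mul_zY z Y (n : nat) (A : 'M[C]_(1 + m, n)) :
  zY z Y *m A = z *: usubmx A + Y *m dsubmx A.
Proof. by rewrite -{1}[A]vsubmxK mul_row_col mul_scalar_mx. Qed.

End Points.

Section Domain.
Context {R : realType} {m : nat}.
Local Notation C := (Cplx R).
Variable h : psystem R m.
Implicit Types p q : 'rV[C]_(1 + m).

Definition system_cvg p : Prop := forall i, abs_convergent (h i) p.

Lemma abs_convergent_le n (c : {ffun 'I_n -> nat} -> C) (p q : 'rV[C]_n) :
  (forall v, `|p 0 v| <= `|q 0 v|) -> abs_convergent c q -> abs_convergent c p.
Proof.
move=> pq /abs_convergentP q_cvg; apply/abs_convergentP.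
apply: (box_bounded_le ler01 _ q_cvg) => a; rewrite mul1r !normrM ler_wpM2l //.
rewrite !dmonomial0 !normr_prod; apply: ler_prod => v _.
by rewrite !normrX exprn_ge0 // lerXn2r ?nnegrE.
Qed.

Lemma system_cvg_le p q :
  (forall v, `|p 0 v| <= `|q 0 v|) -> system_cvg q -> system_cvg p.
Proof. by move=> pq q_cvg i; exact: abs_convergent_le (q_cvg i). Qed.

Lemma cvg_domainP p :
  cvg_domain h p <-> exists2 e, 0 < e & system_cvg (map_mx Num.norm p + const_mx e).
Proof.
split=> [/nbhs_ballP[e /= e0 p_ball]|[e e0 pe_cvg]]; last first.
  apply/nbhs_ballP; exists e => //= x; rewrite -ball_normE /= => px.
  apply: system_cvg_le pe_cvg => v; rewrite !mxE [leRHS]ger0_norm ?addr_ge0 ?(ltW e0) //.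
  rewrite -lerBlDl; apply: le_trans (ltW px); apply: le_trans (ler_coord_norm _ v).
  by rewrite rowBE distrC; exact: lerB_dist.
pose phase (z : C) := if z == 0 then 1 else z / `|z|.
have norm_phase z : `|phase z| = 1.
  rewrite /phase; case: eqVneq => [_|z0]; first by rewrite normr1.
  by rewrite normrM normfV normr_id divff // normr_eq0.
have phaseE z : z = `|z| * phase z.
  rewrite /phase; case: eqVneq => [->|z0]; first by rewrite normr0 mul0r.
  by rewrite mulrCA divff ?mulr1 // normr_eq0.
have d0 : 0 < e / 2 by rewrite divr_gt0.
exists (e / 2) => //; set d := e / 2 in d0 *.
(* [q] has the arguments of [p], and its moduli increased by [d]. *)
pose q : 'rV[C]_(1 + m) := \row_v ((`|p 0 v| + d) * phase (p 0 v)).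
apply: (@system_cvg_le _ q) => [v|].
  by rewrite !mxE normrM norm_phase mulr1.
apply: p_ball; rewrite -ball_normE /=; apply: le_lt_trans (_ : d < e); last first.
  by rewrite gtr_pMr // invf_lt1 ?ltr1n.
apply: norm_row_le => [|v]; first exact: ltW.
rewrite rowBE mxE {1}[p 0 v]phaseE -mulrBl normrM norm_phase mulr1.
by rewrite opprD addrA subrr sub0r normrN gtr0_norm.
Qed.

Lemma cvg_domain_le p q :
  (forall v, `|p 0 v| <= `|q 0 v|) -> cvg_domain h q -> cvg_domain h p.
Proof.
move=> pq /cvg_domainP[e e0 qe_cvg]; apply/cvg_domainP; exists e => //.
apply: system_cvg_le qe_cvg => v; rewrite !mxE ![`|_ + _|]ger0_norm ?addr_ge0 ?(ltW e0) //.
by rewrite lerD2r.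
Qed.

Lemma cvg_domain_cvg p : cvg_domain h p -> system_cvg p.
Proof. by move=> /nbhs_singleton. Qed.

Definition taylor_domain (D : set 'rV[C]_(1 + m)) : Prop :=
  [/\ D `<=` cvg_domain h,
      forall v, exists M, forall x, D x -> `|x 0 v| <= M,
      forall i al, D `<=` dseries_cvg al (h i) &
      forall i al, taylor2_on D (dseries al (h i)) (fun k => dseries (mindexS k al) (h i))].

Lemma cvg_domain_taylor_domain p :
  cvg_domain h p -> exists2 D, nbhs p D & taylor_domain D.
Proof.
move=> /cvg_domainP[e e0 pe_cvg].
have d0 : 0 < e / 2 by rewrite divr_gt0.
set s := map_mx Num.norm p + const_mx (e / 2).
have s0 : row_ge0 s by move=> v; rewrite !mxE addr_ge0 // ltW.
have s_cvg : system_cvg (s + const_mx (e / 2)).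
  rewrite (_ : s + _ = map_mx Num.norm p + const_mx e) //.
  by apply/rowP => v; rewrite !mxE -addrA -splitr.
exists (polydisc s).
  apply/nbhs_ballP; exists (e / 2) => //= x; rewrite -ball_normE /= => px v.
  rewrite !mxE -lerBlDl; apply: le_trans (ltW px).
  by apply: le_trans (ler_coord_norm _ v); rewrite rowBE distrC; exact: lerB_dist.
split=> [x xs|v|i al x xs|i al].
- apply/cvg_domainP; exists (e / 2) => //; apply: system_cvg_le s_cvg => v.
  rewrite !mxE ![`|_ + _|]ger0_norm ?addr_ge0 ?(ltW d0) // lerD2r.
  by have := xs v; rewrite !mxE.
- by exists (s 0 v) => x; apply.
- by apply: (dseries_cvg_polydisc s0 d0 (s_cvg i)).
- exact: taylor2_on_dseries s0 d0 (s_cvg i) al.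
Qed.

Lemma cvg_domain_dseries_cvg p al i : cvg_domain h p -> dseries_cvg al (h i) p.
Proof. by move=> /cvg_domain_taylor_domain[D /nbhs_singleton Dp [_ _ + _]]; apply. Qed.

Lemma HfunE p i : Hfun h p 0 i = dseries mindex0 (h i) p.
Proof. by rewrite mxE psumE. Qed.

Lemma jacobian_HfunE p k i : cvg_domain h p ->
  jacobian (Hfun h) p k i = dseries (mindexS k mindex0) (h i) p.
Proof.
move=> /cvg_domain_taylor_domain[D Dp [_ _ _ taylor]].
pose J x : 'M[C]_(1 + m, m) := \matrix_(k, i) dseries (mindexS k mindex0) (h i) x.
rewrite (@taylor2_on_jacobian _ _ _ D _ J) ?mxE // => j.
apply: taylor2_on_ext (taylor j mindex0) => [x _|k' x _]; last by rewrite mxE.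
by rewrite HfunE.
Qed.

Lemma dHdYE p i j : cvg_domain h p ->
  dHdY h p i j = dseries (mindexS (rshift 1 j) mindex0) (h i) p.
Proof. by move=> p_dom; rewrite [LHS]mxE [LHS]mxE jacobian_HfunE. Qed.

Section TaylorDomain.
Variable D : set 'rV[C]_(1 + m).
Hypothesis D_taylor : taylor_domain D.

Lemma taylor2_on_Hfun : taylor2_on_rV D (Hfun h) (jacobian (Hfun h)).
Proof.
case: D_taylor => D_dom _ _ taylor i.
apply: taylor2_on_ext (taylor i mindex0) => [x _|k x Dx]; first by rewrite HfunE.
by rewrite jacobian_HfunE //; exact: D_dom.
Qed.

Lemma taylor2_on_jacobian_Hfun k i :
  exists g, taylor2_on D (fun x => jacobian (Hfun h) x k i) g.
Proof.
case: D_taylor => D_dom _ _ taylor; eexists.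
apply: (taylor2_on_ext _ (fun _ _ _ => erefl) (taylor i (mindexS k mindex0))) => x Dx.
by rewrite jacobian_HfunE //; exact: D_dom.
Qed.

End TaylorDomain.

Lemma dseries_continuous al i p : cvg_domain h p ->
  dseries al (h i) x @[x --> p] --> dseries al (h i) p.
Proof.
move=> /cvg_domain_taylor_domain[D Dp [_ _ _ taylor]].
exact: taylor2_on_continuous (taylor i al) Dp.
Qed.

(* Where two points tend to [p0], [H] is linearized by its differential at [p0]. *)
Lemma Hfun_linearize (N : nat) (p0 : 'rV[C]_(1 + m)) (P Q : C -> 'rV[C]_(1 + m)) :
  (0 < N)%N -> cvg_domain h p0 -> bigOXn 1 (fun x => P x - p0) ->
  bigOXn 1 (fun x => Q x - p0) -> bigOXn N (fun x => P x - Q x) ->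
  bigOXn N.+1 (fun x =>
    Hfun h (P x) - Hfun h (Q x) - (P x - Q x) *m jacobian (Hfun h) p0).
Proof.
move=> N0 /cvg_domain_taylor_domain[D Dp D_taylor] P_O Q_O PQ_O.
have near_D (F : C -> 'rV[C]_(1 + m)) : bigOXn 1 (fun x => F x - p0) ->
    \forall x \near 0^'+, D (F x).
  move=> F_O; move: Dp; rewrite nbhs_ballP => -[d /= d0 dD].
  apply: filterS (bigOXn_near_lt F_O d0) => x Fx; apply: dD.
  by rewrite -ball_normE /= distrC.
have [M M0 H_quad] := taylor2_on_rV_quadratic (taylor2_on_Hfun D_taylor).
have [L L0 J_lip] := taylor2_on_entry_norm (taylor2_on_jacobian_Hfun D_taylor).
have remainder_O : bigOXn N.+1 (fun x => Hfun h (P x) - Hfun h (Q x) -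
    (P x - Q x) *m jacobian (Hfun h) (Q x)).
  have sq_O : bigOXn (0 + (N + N)) (fun x => M * (`|P x - Q x| * `|P x - Q x|)).
    by apply/bigOXnM/bigOXnM; [exact: bigOXn_cst|exact: bigOXn_norm|exact: bigOXn_norm].
  apply: bigOXn_norm_le (bigOXnW _ sq_O); last by rewrite add0n -addn1 leq_add2l.
  apply: filterS2 (near_D P P_O) (near_D Q Q_O) => x DPx DQx.
  by rewrite [leRHS]ger0_norm ?mulr_ge0 // -expr2; exact: H_quad.
have variation_O : bigOXn N.+1 (fun x =>
    (P x - Q x) *m (jacobian (Hfun h) (Q x) - jacobian (Hfun h) p0)).
  have prod_O : bigOXn (0 + (1 + N)) (fun x => L * (`|Q x - p0| * `|P x - Q x|)).
    by apply/bigOXnM/bigOXnM; [exact: bigOXn_cst|exact: bigOXn_norm|exact: bigOXn_norm].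
  apply: bigOXn_norm_le prod_O; apply: filterS (near_D Q Q_O) => x DQx.
  rewrite [leRHS]ger0_norm ?mulr_ge0 // mulrA; apply: le_trans (norm_mulmx_le _ _) _.
  by rewrite ler_wpM2r // J_lip //; exact: nbhs_singleton Dp.
apply: eq_bigOXn (bigOXnD remainder_O variation_O) => x.
by rewrite mulmxBr addrA subrK.
Qed.

End Domain.

Section NonnegativeSystem.
Context {R : realType} {m : nat}.
Local Notation C := (Cplx R).
Variable h : psystem R m.
Hypothesis h_ge0 : forall i a, 0 <= h i a.
Implicit Types (p q : 'rV[C]_(1 + m)) (z : C) (Y Z : 'rV[C]_m).

Lemma system_cvg_row_le p q : row_ge0 p -> row_le p q -> system_cvg h q -> system_cvg h p.
Proof.
move=> p0 pq; apply: system_cvg_le => v.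
by rewrite !ger0_norm ?p0 ?pq // (le_trans (p0 v)) // pq.
Qed.

Lemma cvg_domain_row_le p q : row_ge0 p -> row_le p q -> cvg_domain h q -> cvg_domain h p.
Proof.
move=> p0 pq; apply: cvg_domain_le => v.
by rewrite !ger0_norm ?p0 ?pq // (le_trans (p0 v)) // pq.
Qed.

Lemma Hfun_ge0 p : row_ge0 p -> system_cvg h p -> row_ge0 (Hfun h p).
Proof.
move=> p0 p_cvg i; rewrite HfunE; apply: dseries_ge0 => //.
by apply/abs_convergentP; exact: p_cvg.
Qed.

Lemma Hfun_le p q : row_ge0 p -> row_le p q -> system_cvg h q ->
  row_le (Hfun h p) (Hfun h q).
Proof.
move=> p0 pq q_cvg i; rewrite !HfunE; apply: dseries_le => //.
by apply/abs_convergentP; exact: q_cvg.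
Qed.

Lemma jacobian_Hfun_ge0 p : row_ge0 p -> cvg_domain h p -> mx_ge0 (jacobian (Hfun h) p).
Proof.
move=> p0 p_dom k i; rewrite jacobian_HfunE //; apply: dseries_ge0 => //.
exact: cvg_domain_dseries_cvg.
Qed.

Lemma dHdY_ge0 p : row_ge0 p -> cvg_domain h p -> mx_ge0 (dHdY h p).
Proof.
move=> p0 p_dom i j; rewrite dHdYE //; apply: dseries_ge0 => //.
exact: cvg_domain_dseries_cvg.
Qed.

Lemma dHdY_gt0 p i j : (forall v, 0 < p 0 v) -> cvg_domain h p ->
  depends_on h i j -> 0 < dHdY h p i j.
Proof.
move=> p0 p_dom [q q_dom q_neq0]; rewrite dHdYE // in q_neq0.
by rewrite dHdYE //; apply: dseries_gt0 q_neq0 => //; exact: cvg_domain_dseries_cvg.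
Qed.

Lemma Hfun_convex p q : row_ge0 p -> row_le p q -> cvg_domain h q ->
  row_le (Hfun h p + (q - p) *m jacobian (Hfun h) p) (Hfun h q).
Proof.
move=> p0 pq q_dom i; have p_dom := cvg_domain_row_le p0 pq q_dom.
rewrite [leLHS]mxE [X in _ + X]mxE !HfunE; under eq_bigr do rewrite jacobian_HfunE //.
apply: dseries_convex => // [|j]; exact: cvg_domain_dseries_cvg.
Qed.

(* By convexity, the gap between two fixed points is subinvariant at the lower one. *)
Lemma fixpoint_gap_subinvariant z z' Y Y' : 0 <= z -> z <= z' -> row_ge0 Y -> row_le Y Y' ->
  cvg_domain h (zY z' Y') -> Hfun h (zY z Y) = Y -> Hfun h (zY z' Y') = Y' ->
  mx_le (dHdY h (zY z Y) *m (Y' - Y)^T) (Y' - Y)^T.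
Proof.
move=> z0 zz' Y0 YY' q_dom p_fix q_fix; set p := zY z Y; set q := zY z' Y'.
have p0 : row_ge0 p by exact: zY_ge0.
have pq : row_le p q by exact: zY_le.
have p_dom := cvg_domain_row_le p0 pq q_dom.
have J0 := jacobian_Hfun_ge0 p0 p_dom.
move=> i j; rewrite (ord1 j); have := Hfun_convex p0 pq q_dom i.
rewrite p_fix q_fix zYB mul_zY mxE -lerBrDl -rowBE [X in _ -> _ <= X]mxE; apply: le_trans.
rewrite -[dHdY h p *m _]trmxK trmx_mul !trmxK [leLHS]mxE [leRHS]mxE lerDr.
by rewrite rowZE mulr_ge0 ?subr_ge0 // mxE.
Qed.

Definition supersolution z Z : Prop :=
  [/\ row_ge0 Z, system_cvg h (zY z Z) & row_le (Hfun h (zY z Z)) Z].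

Lemma Hfun_le_along p (v : 'rV[C]_(1 + m)) (d : C) : row_ge0 p -> row_ge0 v ->
  cvg_domain h p -> 0 < d -> \forall e \near 0^'+,
  system_cvg h (p + e *: v) /\
  forall i, Hfun h (p + e *: v) 0 i <=
    Hfun h p 0 i + e * ((v *m jacobian (Hfun h) p) 0 i + d).
Proof.
move=> p0 v0 p_dom d0; have [D Dp D_taylor] := cvg_domain_taylor_domain p_dom.
have [M M0 H_quad] := taylor2_on_rV_quadratic (taylor2_on_Hfun D_taylor).
have line_D : \forall e \near 0^'+, D (p + e *: v).
  have line_cvg : p + e *: v @[e --> (0 : C)^'+] --> p + 0 *: v.
    apply: cvgD; first exact: cvg_cst.
    by apply: cvg_at_right_filter; exact: scalel_continuous.
  by apply: line_cvg; rewrite scale0r addr0.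
have Mv0 : 0 <= M * `|v| ^+ 2 by rewrite mulr_ge0 ?exprn_ge0.
apply: filterS3 line_D (nbhs_right_ge (0 : C)) (near0_right_mul_le Mv0 d0).
move=> e De e0 eMv; have [D_dom _ _ _] := D_taylor; have Dp' := nbhs_singleton Dp.
have pe0 : row_ge0 (p + e *: v) by move=> k; rewrite !mxE addr_ge0 // mulr_ge0.
split=> [|i]; first exact/cvg_domain_cvg/D_dom.
have := ler_coord_norm (Hfun h (p + e *: v) - Hfun h p -
  (p + e *: v - p) *m jacobian (Hfun h) p) i.
move=> /le_trans/(_ (H_quad _ _ Dp' De)).
have -> : p + e *: v - p = e *: v by rewrite addrAC subrr add0r.
rewrite normrZ (ger0_norm e0) exprMn -scalemxAl !rowBE rowZE => quad.
have real_terms : Hfun h (p + e *: v) 0 i - Hfun h p 0 i -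
    e * (v *m jacobian (Hfun h) p) 0 i \is Num.real.
  rewrite !rpredB ?ger0_real ?Hfun_ge0 ?mulr_ge0 //; do ?exact/cvg_domain_cvg/D_dom.
  by rewrite mxE sumr_ge0 // => k _; rewrite mulr_ge0 // jacobian_Hfun_ge0.
have := le_trans (real_ler_norm real_terms) quad.
rewrite lerBlDr lerBlDr => /le_trans; apply; rewrite addrC lerD2l mulrDr addrC lerD2l.
by rewrite mulrCA expr2 -mulrA ler_wpM2l.
Qed.

(* [w] is a direction in which [Y - H(z, Y)] increases, which leaves room for increasing [z]. *)
Lemma supersolution_beyond z Z (w : 'cV[C]_m) :
  0 <= z -> row_ge0 Z -> cvg_domain h (zY z Z) -> Hfun h (zY z Z) = Z ->
  mx_ge0 w -> w - dHdY h (zY z Z) *m w = const_mx 1 ->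
  exists z' Z', z < z' /\ supersolution z' Z'.
Proof.
move=> z0 Z0 p_dom p_fix w0 wA; set p := zY z Z in p_dom p_fix wA.
have p0 : row_ge0 p by exact: zY_ge0.
have wT0 : row_ge0 w^T by move=> j; rewrite mxE.
pose b := usubmx (jacobian (Hfun h) p).
have b0 i : 0 <= b 0 i by rewrite mxE; exact: jacobian_Hfun_ge0.
near (0 : C)^'+ => k.
have k0 : 0 < k by near: k; exact: nbhs_right_gt.
have kb : forall i, k * b 0 i <= 2^-1.
  near: k; apply: filter_forall => i; exact: near0_right_mul_le.
pose v := zY k w^T; have v0 : row_ge0 v by apply: zY_ge0 => //; exact: ltW.
have half0 : 0 < 2^-1 :> C by rewrite invr_gt0.
near (0 : C)^'+ => e.
have e0 : 0 < e by near: e; exact: nbhs_right_gt.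
have [q_cvg Hq] : system_cvg h (p + e *: v) /\ forall i, Hfun h (p + e *: v) 0 i <=
    Hfun h p 0 i + e * ((v *m jacobian (Hfun h) p) 0 i + 2^-1).
  by near: e; exact: Hfun_le_along.
have qE : p + e *: v = zY (z + e * k) (Z + e *: w^T).
  by rewrite /p /v /zY scale_row_mx add_row_mx scale_scalar_mx -raddfD.
rewrite qE in q_cvg Hq.
exists (z + e * k), (Z + e *: w^T); split; first by rewrite ltrDl mulr_gt0.
split=> // [j|i]; first by rewrite !mxE addr_ge0 // mulr_ge0 // ltW.
apply: le_trans (Hq i) _; rewrite p_fix [leRHS]mxE lerD2l [leRHS]mxE ler_wpM2l ?(ltW e0) //.
have vJ : (v *m jacobian (Hfun h) p) 0 i = k * b 0 i + (dHdY h p *m w) i 0.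
  rewrite mul_zY [LHS]mxE [X in X + _]mxE; congr (_ + _).
  by rewrite -[dHdY h p *m w]trmxK trmx_mul trmxK [RHS]mxE.
have -> : w^T 0 i = 1 + (dHdY h p *m w) i 0.
  by move/matrixP/(_ i 0): wA; rewrite !mxE => /eqP; rewrite subr_eq => /eqP.
by rewrite vJ addrAC lerD2r [leRHS]splitr mul1r lerD2r.
Unshelve. all: by end_near.
Qed.

End NonnegativeSystem.
Section Truncations.
Context {R : realType} {m : nat}.
Local Notation C := (Cplx R).
Implicit Types (q : nat -> 'rV[C]_m) (x z : C).

Lemma gf_truncS q N x : gf_trunc q N.+1 x = gf_trunc q N x + x ^+ N *: q N.
Proof. by rewrite /gf_trunc big_ord_recr. Qed.

Lemma gf_trunc_ge0 q N x :
  (forall k, (k < N)%N -> row_ge0 (q k)) -> 0 <= x -> row_ge0 (gf_trunc q N x).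
Proof.
move=> q0 x0 j; rewrite gf_truncE sumr_ge0 // => k _.
by rewrite mulr_ge0 ?exprn_ge0 // q0.
Qed.

Lemma gf_trunc_le q N x x' : (forall k, (k < N)%N -> row_ge0 (q k)) -> 0 <= x -> x <= x' ->
  row_le (gf_trunc q N x) (gf_trunc q N x').
Proof.
move=> q0 x0 xx j; rewrite !gf_truncE; apply: ler_sum => k _.
by rewrite ler_wpM2r ?q0 // lerXn2r ?nnegrE // (le_trans x0).
Qed.

Lemma gf_trunc_nondecreasing q x j : (forall k, row_ge0 (q k)) -> 0 <= x ->
  nondecreasing_seq (fun N => gf_trunc q N x 0 j).
Proof.
move=> q0 x0; apply/nondecreasing_seqP => N.
by rewrite !gf_truncE big_ord_recr /= lerDl mulr_ge0 ?exprn_ge0 // q0.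
Qed.

Lemma gf_trunc_bigOXn q N : bigOXn 1 (fun x => gf_trunc q N.+1 x - q 0%N).
Proof.
elim: N => [|N IH].
  by exists 0 => //; apply: nearW => x; rewrite /gf_trunc big_ord1 scale1r subrr normr0 mul0r.
apply: eq_bigOXn (bigOXnD IH (bigOXnW (ltn0Sn N) (bigOXn_exprnZ N.+1 (q N.+1)))) => x.
by rewrite [gf_trunc q N.+2 x]gf_truncS addrAC.
Qed.

Definition set_coef q N (p : 'rV[C]_m) k := if k == N then p else q k.

Lemma set_coef_eq q N p : set_coef q N p N = p.
Proof. by rewrite /set_coef eqxx. Qed.

Lemma set_coef_lt q N p k : (k < N)%N -> set_coef q N p k = q k.
Proof. by move=> kN; rewrite /set_coef ltn_eqF. Qed.

Lemma gf_trunc_set_coef q N p x :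
  gf_trunc (set_coef q N p) N.+1 x = gf_trunc q N x + x ^+ N *: p.
Proof.
rewrite gf_truncS set_coef_eq; congr (_ + _).
by apply: eq_bigr => k _; rewrite set_coef_lt.
Qed.

Lemma bigOXn_zY N (f : C -> C) (F : C -> 'rV[C]_m) :
  bigOXn N f -> bigOXn N F -> bigOXn N (fun x => zY (f x) (F x)).
Proof.
move=> fN FN; apply/bigOXn_rowP; apply: zvar_Yvar_ind => [|j].
  by apply: eq_bigOXn fN => x; rewrite zY_z.
by apply: eq_bigOXn ((bigOXn_rowP _ _).1 FN j) => x; rewrite zY_Y.
Qed.

(* Substituting the truncation of [q] at order [N] into the part of [H_i] supported
   on the box [B]. *)
Section SystemPolynomials.
Variable h : psystem R m.

Definition var_poly q N (v : 'I_(1 + m)) : {poly C} :=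
  match fintype.split v with
  | inl _ => 'X
  | inr j => \poly_(k < N) q k 0 j
  end.

Definition sys_poly q N i B : {poly C} :=
  box_sum B (fun a => h i a *: \prod_v var_poly q N v ^+ a v).

Lemma var_poly_z q N : var_poly q N (lshift m 0) = 'X.
Proof. by rewrite /var_poly (unsplitK (inl 0 : 'I_1 + 'I_m)). Qed.

Lemma var_poly_Y q N j : var_poly q N (rshift 1 j) = \poly_(k < N) q k 0 j.
Proof. by rewrite /var_poly (unsplitK (inr j : 'I_1 + 'I_m)). Qed.

Lemma horner_var_poly q N x v : (var_poly q N v).[x] = zY x (gf_trunc q N x) 0 v.
Proof.
move: v; apply: zvar_Yvar_ind => [|j]; first by rewrite var_poly_z hornerX zY_z.
rewrite var_poly_Y zY_Y horner_poly gf_truncE.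
by apply: eq_bigr => k _; rewrite mulrC.
Qed.

Lemma horner_sys_poly q N i B x : (sys_poly q N i B).[x] =
  box_sum B (fun a => h i a * dmonomial mindex0 a (zY x (gf_trunc q N x))).
Proof.
rewrite horner_sum; apply: eq_bigr => a _; rewrite hornerZ horner_prod dmonomial0.
by congr (_ * _); apply: eq_bigr => v _; rewrite horner_exp horner_var_poly.
Qed.

Hypothesis h_ge0 : forall i a, 0 <= h i a.

Lemma var_poly_le q N q' N' v : (N <= N')%N ->
  (forall k, (k < N)%N -> row_ge0 (q k) /\ row_le (q k) (q' k)) ->
  (forall k, (k < N')%N -> row_ge0 (q' k)) -> coef_le (var_poly q N v) (var_poly q' N' v).
Proof.
move=> NN qq q'0; move: v; apply: zvar_Yvar_ind => [|j].
  by rewrite !var_poly_z; apply: coef_le_refl => k; rewrite coefX ler0n.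
rewrite !var_poly_Y => k; rewrite !coef_poly; have [kN|Nk] := ltnP k N.
  by have [q0 qq'] := qq k kN; rewrite (leq_trans kN NN) q0 qq'.
by rewrite lexx /=; case: ifP => // /q'0.
Qed.

Lemma sys_term_le q N q' N' i (a : {ffun 'I_(1 + m) -> nat}) : (N <= N')%N ->
  (forall k, (k < N)%N -> row_ge0 (q k) /\ row_le (q k) (q' k)) ->
  (forall k, (k < N')%N -> row_ge0 (q' k)) ->
  coef_le (h i a *: \prod_v var_poly q N v ^+ a v) (h i a *: \prod_v var_poly q' N' v ^+ a v).
Proof.
move=> NN qq q'0; apply: coef_leZ => //.
by apply: coef_le_prod => v; apply/coef_le_exp/var_poly_le.
Qed.

Lemma sys_poly_le q N q' N' i B : (N <= N')%N ->
  (forall k, (k < N)%N -> row_ge0 (q k) /\ row_le (q k) (q' k)) ->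
  (forall k, (k < N')%N -> row_ge0 (q' k)) ->
  coef_le (sys_poly q N i B) (sys_poly q' N' i B).
Proof. by move=> NN qq q'0; apply: coef_le_sum => a; exact: sys_term_le. Qed.

Lemma sys_poly_nondecreasing q N i B : (forall k, (k < N)%N -> row_ge0 (q k)) ->
  coef_le (sys_poly q N i B) (sys_poly q N i B.+1).
Proof.
move=> q0 k; have qq k' : (k' < N)%N -> row_ge0 (q k') /\ row_le (q k') (q k').
  by move=> /q0 qk0; split=> // j.
have /andP[-> _] /= := sys_poly_le i B (leqnn N) qq q0 k.
rewrite /sys_poly box_sumS coefD lerDl coef_sum sumr_ge0 // => a _.
by have /andP[] := sys_term_le i a (leqnn N) qq q0 k.
Qed.

Section Composition.
Variables (q : nat -> 'rV[C]_m) (N : nat) (x1 : C).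
Hypotheses (q_ge0 : forall k, (k < N)%N -> row_ge0 (q k)) (x1_gt0 : 0 < x1).
Hypothesis x1_cvg : system_cvg h (zY x1 (gf_trunc q N x1)).

Let point_ge0 x : 0 <= x -> row_ge0 (zY x (gf_trunc q N x)).
Proof. by move=> x0; apply: zY_ge0 => //; exact: gf_trunc_ge0. Qed.

Lemma sys_poly_cvg i x : 0 <= x -> x <= x1 ->
  (fun B => (sys_poly q N i B).[x]) @ \oo --> Hfun h (zY x (gf_trunc q N x)) 0 i.
Proof.
move=> x0 xx1; rewrite HfunE; under eq_cvg do rewrite horner_sys_poly.
apply: cvg_dseries; apply/abs_convergentP.
apply: (system_cvg_row_le _ _ x1_cvg); first exact: point_ge0.
by apply: zY_le => //; exact: gf_trunc_le.
Qed.

Definition sys_coef i k : C := coef_limit (sys_poly q N i) k.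

Lemma sys_coef_ge0 i k : 0 <= sys_coef i k.
Proof.
exact: (coef_limit_ge0 x1_gt0 (fun B => sys_poly_nondecreasing i B q_ge0) (sys_poly_cvg (i := i))).
Qed.

Lemma sys_poly_le_coef i B k : (sys_poly q N i B)`_k <= sys_coef i k.
Proof.
exact: (coef_le_limit x1_gt0 (fun B => sys_poly_nondecreasing i B q_ge0) (sys_poly_cvg (i := i))).
Qed.

Lemma sys_coef_partial_sum_le i n :
  \sum_(k < n) x1 ^+ k * sys_coef i k <= Hfun h (zY x1 (gf_trunc q N x1)) 0 i.
Proof.
exact: (coef_limit_partial_sum_le x1_gt0 (fun B => sys_poly_nondecreasing i B q_ge0)
  (sys_poly_cvg (i := i))).
Qed.

Lemma sys_coef_bigOXn i n : bigOXn n (fun x =>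
  Hfun h (zY x (gf_trunc q N x)) 0 i - \sum_(k < n) x ^+ k * sys_coef i k).
Proof.
exact: (coef_limit_bigOXn x1_gt0 (fun B => sys_poly_nondecreasing i B q_ge0)
  (sys_poly_cvg (i := i))).
Qed.

Lemma sys_coef_unique (t : nat -> 'rV[C]_m) n :
  bigOXn n (fun x => Hfun h (zY x (gf_trunc q N x)) - gf_trunc t n x) ->
  forall i k, (k < n)%N -> sys_coef i k = t k 0 i.
Proof.
move=> /bigOXn_rowP t_O i k kn; apply/eqP; rewrite -subr_eq0; apply/eqP.
apply: (@bigOXn_poly_eq0 _ n (fun k => sys_coef i k - t k 0 i)) => //.
apply: eq_bigOXn (bigOXnB (t_O i) (sys_coef_bigOXn i n)) => x.
under [RHS]eq_bigr do rewrite mulrBr.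
by rewrite rowBE sumrB gf_truncE; ring.
Qed.

End Composition.
End SystemPolynomials.
End Truncations.

(** * The coefficients of the solution *)

Section SolutionCoefficients.
Context {R : realType} {m : nat}.
Local Notation C := (Cplx R).
Variables (h : psystem R m) (y : nat -> 'rV[C]_m).
Hypothesis h_ge0 : forall i a, 0 <= h i a.
Hypothesis y_bigOXn : forall N, bigOXn N (fun x => gf y x - gf_trunc y N x).
Hypothesis y_fix : \forall x \near 0^'+, Hfun h (zY x (gf y x)) = gf y x.
Hypothesis origin_dom : cvg_domain h (zY 0 (y 0%N)).

Let A := dHdY h (zY 0 (y 0%N)).

(* The coefficient of [x ^+ N] in [H(x, Y)] when [Y] is [y] with its [N]-th coefficient
   replaced by [p] and truncated there. *)
Definition next_coef N (p : 'rV[C]_m) : 'rV[C]_m := y N + (p - y N) *m A^T.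

Lemma Hfun_trunc_bigOXn N p : (0 < N)%N -> bigOXn N.+1 (fun x =>
  Hfun h (zY x (gf_trunc (set_coef y N p) N.+1 x)) -
  gf_trunc (set_coef y N (next_coef N p)) N.+1 x).
Proof.
move=> N0; pose T x := gf_trunc (set_coef y N p) N.+1 x.
have id_O : bigOXn 1 (fun x : C => x - 0).
  by apply: eq_bigOXn (bigOXn_exprn 1 1) => x; rewrite mulr1 subr0.
have near_origin F : bigOXn 1 (fun x => F x - y 0%N) ->
    bigOXn 1 (fun x => zY x (F x) - zY 0 (y 0%N)).
  by move=> F_O; apply: eq_bigOXn (bigOXn_zY id_O F_O) => x; rewrite zYB.
have gf_O : bigOXn 1 (fun x => gf y x - y 0%N).
  by apply: eq_bigOXn (y_bigOXn 1) => x; rewrite /gf_trunc big_ord1 scale1r.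
have T_O : bigOXn 1 (fun x => T x - y 0%N).
  apply: eq_bigOXn (gf_trunc_bigOXn (set_coef y N p) N) => x.
  by rewrite set_coef_lt.
have Tgf_O : bigOXn N (fun x => T x - gf y x).
  apply: eq_bigOXn (bigOXnB (bigOXn_exprnZ N p) (y_bigOXn N)) => x.
  by rewrite /T gf_trunc_set_coef opprB addrA [x ^+ N *: p + _]addrC.
have zTgf_O : bigOXn N (fun x => zY x (T x) - zY x (gf y x)).
  have zero_O : bigOXn N (fun x : C => x - x).
    by exists 0 => //; apply: nearW => x; rewrite subrr normr0 mul0r.
  by apply: eq_bigOXn (bigOXn_zY zero_O Tgf_O) => x; rewrite zYB.
have lin_O := Hfun_linearize N0 origin_dom (near_origin _ T_O) (near_origin _ gf_O) zTgf_O.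
have defect_O : bigOXn N.+1 (fun x => (T x - gf y x - x ^+ N *: (p - y N)) *m A^T).
  apply: bigOXn_mulmx; apply: eq_bigOXn (bigOXnN (y_bigOXn N.+1)) => x.
  rewrite /T gf_trunc_set_coef gf_truncS; move: (gf y x) (gf_trunc y N x) => g t.
  by apply/rowP => i; rewrite !mxE; ring.
apply: bigOXn_near (bigOXnD (bigOXnD lin_O (y_bigOXn N.+1)) defect_O).
apply: filterS y_fix => x; rewrite -/(T x) => ->.
rewrite zYB subrr mul_zY scale0r add0r -[dsubmx _]trmxK -/A.
rewrite gf_trunc_set_coef gf_truncS /next_coef.
rewrite [(_ - x ^+ N *: _) *m _]mulmxBl -scalemxAl.
move: (Hfun _ _) (gf y x) (gf_trunc y N x) ((T x - gf y x) *m A^T) ((p - y N) *m A^T).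
by move=> H g t a b; apply/rowP => i; rewrite !mxE; ring.
Qed.

Section TruncationStep.
Variables (N : nat) (p : 'rV[C]_m) (x : C).
Hypotheses (N_gt0 : (0 < N)%N) (y_ge0_lt : forall k, (k < N)%N -> row_ge0 (y k)).
Hypotheses (p_ge0 : row_ge0 p) (x_gt0 : 0 < x).

Let q := set_coef y N p.

Hypothesis x_cvg : system_cvg h (zY x (gf_trunc q N.+1 x)).

Let q_ge0 k : (k < N.+1)%N -> row_ge0 (q k).
Proof.
rewrite ltnS leq_eqVlt => /predU1P[->|kN]; rewrite /q ?set_coef_eq ?set_coef_lt //.
exact: y_ge0_lt.
Qed.

Let sys_coefE i k : (k < N.+1)%N ->
  sys_coef h q N.+1 i k = set_coef y N (next_coef N p) k 0 i.
Proof. exact: (sys_coef_unique h_ge0 q_ge0 x_gt0 x_cvg (Hfun_trunc_bigOXn p N_gt0)). Qed.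

Lemma next_coef_ge0 : row_ge0 (next_coef N p).
Proof.
move=> i; rewrite -(set_coef_eq y N (next_coef N p)) -sys_coefE //.
exact: (sys_coef_ge0 h_ge0 q_ge0 x_gt0 x_cvg).
Qed.

Lemma gf_trunc_next_coef_le :
  row_le (gf_trunc (set_coef y N (next_coef N p)) N.+1 x) (Hfun h (zY x (gf_trunc q N.+1 x))).
Proof.
move=> i; rewrite gf_truncE; under eq_bigr do rewrite -sys_coefE //.
exact: (sys_coef_partial_sum_le h_ge0 q_ge0 x_gt0 x_cvg).
Qed.

Lemma sys_poly_set_coef_le i B k : (k < N)%N -> (sys_poly h q N.+1 i B)`_k <= y k 0 i.
Proof.
move=> kN; rewrite -(set_coef_lt y (next_coef N p) kN) -sys_coefE ?(leqW kN) //.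
exact: (sys_poly_le_coef h_ge0 q_ge0 x_gt0 x_cvg).
Qed.

End TruncationStep.

Lemma next_coef_fixed N : next_coef N (y N) = y N.
Proof. by rewrite /next_coef subrr mul0mx addr0. Qed.

Lemma iter_next_coef N j : (iter j (next_coef N) 0 - y N)^T = A ^+ j *m (- y N)^T.
Proof.
elim: j => [|j IH]; first by rewrite sub0r expr0 mul1mx.
by rewrite iterS {1}/next_coef addrAC subrr add0r trmx_mul trmxK IH exprS -mulmxE mulmxA.
Qed.

Section Supersolution.
Variables (x : C) (Z : 'rV[C]_m).
Hypotheses (x_gt0 : 0 < x) (Z_super : supersolution h x Z).

Lemma next_coef_supersolution N p : (0 < N)%N -> (forall k, (k < N)%N -> row_ge0 (y k)) ->
  row_ge0 p -> row_le (gf_trunc (set_coef y N p) N.+1 x) Z ->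
  row_ge0 (next_coef N p) /\ row_le (gf_trunc (set_coef y N (next_coef N p)) N.+1 x) Z.
Proof.
move=> N0 y0 p0 pZ; have [_ Z_cvg HZ] := Z_super; have x0 := ltW x_gt0.
have q0 : row_ge0 (zY x (gf_trunc (set_coef y N p) N.+1 x)).
  apply: zY_ge0 => //; rewrite gf_trunc_set_coef => j; rewrite mxE rowZE.
  by rewrite addr_ge0 ?mulr_ge0 ?exprn_ge0 //; exact: gf_trunc_ge0.
have qZ : row_le (zY x (gf_trunc (set_coef y N p) N.+1 x)) (zY x Z) by exact: zY_le.
have q_cvg := system_cvg_row_le q0 qZ Z_cvg.
split; first exact: next_coef_ge0 q_cvg.
move=> i; apply: le_trans (gf_trunc_next_coef_le N0 y0 p0 x_gt0 q_cvg i) _.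
exact: le_trans (Hfun_le h_ge0 q0 qZ Z_cvg i) (HZ i).
Qed.

Hypothesis origin_ge0 : row_ge0 (y 0%N).
Hypothesis origin_le : row_le (y 0%N) Z.
Hypothesis origin_nilpotent : exists k, A ^+ k = 0.

(* Nilpotency of [A] makes [next_coef N], started at [0], reach [y N] in finitely
   many steps, and each step stays below [Z]. *)
Lemma gf_trunc_le_supersolution N :
  (forall k, (k < N)%N -> row_ge0 (y k)) /\ row_le (gf_trunc y N x) Z.
Proof.
elim: N => [|[_|N [y0 yZ]]].
- by split=> // j; rewrite /gf_trunc big_ord0 mxE; case: Z_super.
- split=> [k|]; first by rewrite ltnS leqn0 => /eqP ->.
  by rewrite /gf_trunc big_ord1 scale1r.
have [e Ae] := origin_nilpotent.
have iter_le j : row_ge0 (iter j (next_coef N.+1) 0) /\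
    row_le (gf_trunc (set_coef y N.+1 (iter j (next_coef N.+1) 0)) N.+2 x) Z.
  elim: j => [|j [p0 pZ]]; last exact: next_coef_supersolution.
  by split=> [j|]; rewrite ?mxE // gf_trunc_set_coef scaler0 addr0.
have iter_e : iter e (next_coef N.+1) 0 = y N.+1.
  by apply/eqP; rewrite -subr_eq0 -trmx_eq0 iter_next_coef Ae mul0mx.
have [yN0 yNZ] := iter_le e; rewrite iter_e gf_trunc_set_coef -gf_truncS in yN0 yNZ.
by split=> // k; rewrite ltnS leq_eqVlt => /predU1P[->//|]; exact: y0.
Qed.

End Supersolution.

Section LimitFixpoint.
Variables (x : C) (V : 'rV[C]_m).
Hypotheses (y_ge0 : forall k, row_ge0 (y k)) (x_gt0 : 0 < x).
Hypothesis V_lim : forall i, (fun N => gf_trunc y N x 0 i) @ \oo --> V 0 i.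
Hypothesis V_cvg : system_cvg h (zY x V).

Let trunc_le N : row_le (gf_trunc y N x) V.
Proof.
move=> i; apply: (nondecreasing_cvg_ge (u := fun N => gf_trunc y N x 0 i)) => //.
exact: gf_trunc_nondecreasing (ltW x_gt0).
Qed.

Let point_ge0 N : row_ge0 (zY x (gf_trunc y N x)).
Proof. by have x0 := ltW x_gt0; apply: zY_ge0 => //; exact: gf_trunc_ge0. Qed.

Let point_le N : row_le (zY x (gf_trunc y N x)) (zY x V).
Proof. exact: zY_le. Qed.

Let point_cvg N : system_cvg h (zY x (gf_trunc y N x)).
Proof. exact: system_cvg_row_le (point_ge0 N) (point_le N) V_cvg. Qed.

Lemma limit_le_Hfun : row_le V (Hfun h (zY x V)).
Proof.
move=> i; apply: (cvg_le (@V_lim i) (@cvg_cst _ (Hfun h (zY x V) 0 i) nat \oo _)).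
exists 2%N => // -[|[|N]] // _.
have truncE : gf_trunc (set_coef y N.+1 (y N.+1)) N.+2 x = gf_trunc y N.+2 x.
  by rewrite gf_trunc_set_coef -gf_truncS.
have := @gf_trunc_next_coef_le N.+1 (y N.+1) x isT (fun k _ => y_ge0 k) (y_ge0 _) x_gt0.
rewrite next_coef_fixed truncE => /(_ (point_cvg _) i) /le_trans; apply.
exact: Hfun_le.
Qed.

Lemma sys_poly_le_y N i B k : (sys_poly h y N i B)`_k <= y k 0 i.
Proof.
set n := (maxn N k).+1.
have truncE : gf_trunc (set_coef y n 0) n.+1 x = gf_trunc y n x.
  by rewrite gf_trunc_set_coef scaler0 addr0.
have zero_ge0 : row_ge0 (0 : 'rV[C]_m) by move=> j; rewrite mxE.
have := @sys_poly_set_coef_le n 0 x isT (fun k _ => y_ge0 k) zero_ge0 x_gt0.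
rewrite truncE => /(_ (point_cvg n) i B k) coef_le_y.
apply: le_trans (coef_le_y _); last by rewrite ltnS leq_maxr.
have Nn : (N < n)%N by rewrite ltnS leq_maxl.
have y_le l : (l < N)%N -> row_ge0 (y l) /\ row_le (y l) (set_coef y n 0 l).
  by move=> lN; rewrite set_coef_lt ?(ltn_trans lN) //; split=> // j.
have set_ge0 l : (l < n.+1)%N -> row_ge0 (set_coef y n 0 l).
  by move=> _ j; rewrite /set_coef; case: ifP; rewrite ?mxE // => _; exact: y_ge0.
by have /andP[] := sys_poly_le h_ge0 i B (leqW (ltnW Nn)) y_le set_ge0 k.
Qed.

Lemma Hfun_le_limit : row_le (Hfun h (zY x V)) V.
Proof.
move=> i; rewrite HfunE; have /abs_convergentP cvg_i := V_cvg i.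
apply: box_limit_le => // B.
have box_cvg : (fun N => (sys_poly h y N i B).[x]) @ \oo -->
    box_sum B (fun a => h i a * dmonomial mindex0 a (zY x V)).
  under eq_cvg do rewrite horner_sys_poly.
  apply: (cvg_big (@add_continuous _)) => a _; apply: cvgMl_tmp.
  rewrite dmonomial0; under eq_cvg do rewrite dmonomial0.
  apply: (cvg_big (@mul_continuous _)) => v _.
  apply: cvg_exprn; move: v.
  apply: zvar_Yvar_ind => [|j]; first by rewrite zY_z; under eq_cvg do rewrite zY_z; exact: cvg_cst.
  by rewrite zY_Y; under eq_cvg do rewrite zY_Y; exact: V_lim.
apply: (cvg_seq_le_cst box_cvg) => N; rewrite horner_coef.
apply: le_trans (trunc_le (size (sys_poly h y N i B)) i); rewrite gf_truncE.
apply: ler_sum => k _; rewrite mulrC ler_wpM2l ?exprn_ge0 ?(ltW x_gt0) //.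
exact: sys_poly_le_y.
Qed.

Lemma limit_fixpoint : Hfun h (zY x V) = V.
Proof. by apply/rowP => i; apply/eqP; rewrite eq_le Hfun_le_limit limit_le_Hfun. Qed.

End LimitFixpoint.
End SolutionCoefficients.

(** * The solution at its singularity *)

Section SolutionNearOrigin.
Context {R : realType} {m : nat}.
Local Notation C := (Cplx R).
Variables (h : psystem R m) (y : nat -> 'rV[C]_m).
Hypotheses (h_wf : well_founded_system h) (y_sol : gf_solution h y).

Let h_ge0 i a : 0 <= h i a.
Proof. by case: h_wf. Qed.

Let y_bounded : exists2 r : R, 0 < r & exists M : C, forall k j, `|y k 0 j| * ofR r ^+ k <= M.
Proof. by case: y_sol => rad_gt0 _ _; exact: lt_cvg_radius. Qed.

Lemma UiterS k : Uiter h k.+1 = Hfun h (zY 0 (Uiter h k)).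
Proof. by []. Qed.

Lemma Uiter_ge0 k : (k <= m)%N -> row_ge0 (Uiter h k).
Proof.
elim: k => [|k IH] km; first by move=> j; rewrite mxE.
rewrite UiterS; apply: Hfun_ge0 => //; first by apply: zY_ge0 => //; exact/IH/ltnW.
by apply: cvg_domain_cvg; case: h_wf => _ + _; apply; exact: ltnW.
Qed.

Lemma Uiter_le_supersolution x Z : 0 <= x -> supersolution h x Z ->
  forall k, (k <= m)%N -> row_le (Uiter h k) Z.
Proof.
move=> x0 [Z0 Z_cvg HZ]; elim=> [|k IH] km j; first by rewrite mxE.
rewrite UiterS; apply: le_trans (HZ j); apply: Hfun_le => //.
  by apply: zY_ge0 => //; exact/Uiter_ge0/ltnW.
by apply: zY_le => //; exact/IH/ltnW.
Qed.

Lemma gf_solution_origin : y 0%N = Uiter h m.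
Proof.
have [r r0 [M yM]] := y_bounded; case: y_sol => _ <- _.
by rewrite (gf0 _ yM) // ofR_gt0.
Qed.

Lemma gf_solution_bigOXn N : bigOXn N (fun x => gf y x - gf_trunc y N x).
Proof.
have [r r0 [M yM]] := y_bounded.
by apply: (gf_bigOXn _ yM); rewrite ofR_gt0.
Qed.

Lemma gf_solution_fix : \forall x \near 0^'+, Hfun h (zY x (gf y x)) = gf y x.
Proof.
by case: y_sol => _ _ sol; apply: cvg_within; apply: filterS sol => x [].
Qed.

Lemma gf_solution_origin_dom : cvg_domain h (zY 0 (y 0%N)).
Proof. by rewrite gf_solution_origin; case: h_wf => _ + _; exact. Qed.

Lemma gf_solution_origin_fix : Hfun h (zY 0 (y 0%N)) = y 0%N.
Proof.
have [_ gf_y0 /nbhs_singleton[_]] := y_sol.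
by rewrite gf_y0 -gf_solution_origin.
Qed.

Let origin_ge0 : row_ge0 (y 0%N).
Proof. by rewrite gf_solution_origin; exact: Uiter_ge0. Qed.

Let origin_nilpotent : exists k, dHdY h (zY 0 (y 0%N)) ^+ k = 0.
Proof. by rewrite gf_solution_origin; case: h_wf. Qed.

Lemma gf_solution_trunc_le x Z N : 0 < x -> supersolution h x Z ->
  (forall k, (k < N)%N -> row_ge0 (y k)) /\ row_le (gf_trunc y N x) Z.
Proof.
move=> x0 Z_super; have origin_le : row_le (y 0%N) Z.
  by rewrite gf_solution_origin; exact: Uiter_le_supersolution (ltW x0) Z_super _ _.
exact: (gf_trunc_le_supersolution h_ge0 gf_solution_bigOXn gf_solution_fix
  gf_solution_origin_dom x0 Z_super origin_ge0 origin_le origin_nilpotent).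
Qed.

Lemma supersolution_near_origin : exists x Z, 0 < x /\ supersolution h x Z.
Proof.
have [e Ae] := origin_nilpotent; have dom0 := gf_solution_origin_dom.
have A_ge0 : mx_ge0 (dHdY h (zY 0 (y 0%N))) by apply: dHdY_ge0 => //; exact: zY_ge0.
have [w w0 wA] := nilpotent_solve A_ge0 Ae.
exact: (supersolution_beyond h_ge0 (lexx _) origin_ge0 dom0 gf_solution_origin_fix w0 wA).
Qed.

Lemma gf_solution_ge0 k : row_ge0 (y k).
Proof.
have [x [Z [x0 Z_super]]] := supersolution_near_origin.
by have [y0 _] := gf_solution_trunc_le k.+1 x0 Z_super; exact: y0.
Qed.

End SolutionNearOrigin.

Section BelowSingularity.
Context {R : realType} {m : nat}.
Local Notation C := (Cplx R).
Variables (h : psystem R m) (y : nat -> 'rV[C]_m) (rho : R).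
Hypotheses (h_wf : well_founded_system h) (y_sol : gf_solution h y).
Hypothesis y_rad : cvg_radius y = rho%:E.

Let h_ge0 i a : 0 <= h i a.
Proof. by case: h_wf. Qed.

Let y_ge0 := gf_solution_ge0 h_wf y_sol.

Lemma gf_radius_gt0 : 0 < rho.
Proof. by case: y_sol => + _ _; rewrite y_rad lte_fin. Qed.

Lemma gf_coef_unbounded (r : R) (M : C) :
  rho < r -> ~ (forall k j, `|y k 0 j| * ofR r ^+ k <= M).
Proof.
move=> rho_r /(cvg_radius_ge (lt_trans gf_radius_gt0 rho_r)).
by rewrite y_rad lee_fin leNgt rho_r.
Qed.

Lemma gf_trunc_term_le x k j : 0 <= x -> x ^+ k * y k 0 j <= gf_trunc y k.+1 x 0 j.
Proof.
move=> x0; rewrite gf_truncS mxE rowZE lerDr.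
by apply: gf_trunc_ge0 => // l _; exact: y_ge0.
Qed.

Lemma no_supersolution_beyond_radius (r : R) Z : rho < r -> ~ supersolution h (ofR r) Z.
Proof.
move=> rho_r Z_super; have r0 : 0 < ofR r by rewrite ofR_gt0 (lt_trans gf_radius_gt0).
apply: (@gf_coef_unbounded r (\sum_j Z 0 j)) => // k j.
rewrite ger0_norm ?y_ge0 // mulrC; apply: le_trans (gf_trunc_term_le k j (ltW r0)) _.
have [_ /(_ j) /le_trans] := gf_solution_trunc_le h_wf y_sol k.+1 r0 Z_super; apply.
by have [Z0 _ _] := Z_super; exact: (ler_term_sum (F := fun j => Z 0 j)).
Qed.

Lemma gf_coef_nonconstant : exists k j, (0 < k)%N /\ y k 0 j != 0.
Proof.
apply: contrapT => y_const.
apply: (@gf_coef_unbounded (rho + 1) (\sum_j `|y 0%N 0 j|)) => [|k j]; first by rewrite ltrDl.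
have [->|k0] := posnP k.
  by rewrite expr0 mulr1; exact: (ler_term_sum (F := fun j => `|y 0%N 0 j|)).
have [->|yk] := eqVneq (y k 0 j) 0; first by rewrite normr0 mul0r sumr_ge0.
by case: y_const; exists k, j.
Qed.

Section Interior.
Variables (x : R).
Hypotheses (x_gt0 : 0 < x) (x_lt : x < rho).

Lemma gf_trunc_cvg_interior j : (fun N => gf_trunc y N (ofR x) 0 j) @ \oo --> gf y (ofR x) 0 j.
Proof.
have x_rad : (x%:E < cvg_radius y)%E by rewrite y_rad lte_fin.
have [r xr [M yM]] := lt_cvg_radius x_rad.
apply: (gf_trunc_coord_cvg _ yM); first by rewrite ofR_gt0 (lt_trans x_gt0).
by rewrite normr_ofR gtr0_norm // ltr_ofR.
Qed.

Lemma gf_trunc_le_gf N : row_le (gf_trunc y N (ofR x)) (gf y (ofR x)).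
Proof.
move=> j; apply: (nondecreasing_cvg_ge (u := fun N => gf_trunc y N (ofR x) 0 j)).
  by apply: gf_trunc_nondecreasing => //; rewrite ofR_ge0 ltW.
exact: gf_trunc_cvg_interior.
Qed.

Lemma gf_ge0 : row_ge0 (gf y (ofR x)).
Proof. by move=> j; have := gf_trunc_le_gf 0 j; rewrite /gf_trunc big_ord0 mxE. Qed.

End Interior.

Lemma gf_trunc_increment_ge x x' k N j : (k < N)%N -> 0 <= x -> x <= x' ->
  gf_trunc y N x 0 j + (x' ^+ k - x ^+ k) * y k 0 j <= gf_trunc y N x' 0 j.
Proof.
move=> kN x0 xx'; rewrite -lerBrDl !gf_truncE -sumrB (bigD1 (Ordinal kN)) //=.
rewrite -mulrBl lerDl sumr_ge0 // => l _.
by rewrite -mulrBl mulr_ge0 ?y_ge0 // subr_ge0 lerXn2r ?nnegrE // (le_trans x0).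
Qed.

Lemma gf_increment_ge x x' k : 0 < x -> x <= x' -> x' < rho ->
  row_le (gf y (ofR x) + (ofR x' ^+ k - ofR x ^+ k) *: y k) (gf y (ofR x')).
Proof.
move=> x0 xx' x'r j; rewrite mxE rowZE.
have lhs_cvg : (fun N => gf_trunc y N (ofR x) 0 j + (ofR x' ^+ k - ofR x ^+ k) * y k 0 j)
    @ \oo --> gf y (ofR x) 0 j + (ofR x' ^+ k - ofR x ^+ k) * y k 0 j.
  by apply: cvgD; [exact: gf_trunc_cvg_interior (le_lt_trans xx' x'r) _|exact: cvg_cst].
have rhs_cvg := gf_trunc_cvg_interior (lt_le_trans x0 xx') x'r (j := j).
apply: (cvg_le lhs_cvg rhs_cvg); apply: filterS (nbhs_infty_gt k) => N kN.
by apply: gf_trunc_increment_ge; rewrite ?ofR_ge0 ?ler_ofR // ltW.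
Qed.

End BelowSingularity.

Definition gf_point {R : realType} {m : nat} (y : nat -> 'rV[Cplx R]_m) (x : R) :
  'rV[Cplx R]_(1 + m) := zY (ofR x) (gf y (ofR x)).

Section AtSingularity.
Context {R : realType} {m : nat}.
Local Notation C := (Cplx R).
Variables (h : psystem R m) (y : nat -> 'rV[C]_m) (rho : R) (tau : 'rV[C]_m).
Hypotheses (h_wf : well_founded_system h) (y_sol : gf_solution h y).
Hypothesis y_rad : cvg_radius y = rho%:E.
Hypothesis y_lim : gf y (ofR x) @[x --> rho^'-] --> tau.

Let y_ge0 := gf_solution_ge0 h_wf y_sol.
Let rho_gt0 := gf_radius_gt0 y_sol y_rad.

Lemma gf_le_limit x : 0 < x -> x < rho -> row_le (gf y (ofR x)) tau.
Proof.
move=> x0 xr j.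
have y_lim_j : gf y (ofR x') 0 j @[x' --> rho^'-] --> tau 0 j by exact: cvg_coord.
have x_cst : (fun=> gf y (ofR x) 0 j) x' @[x' --> rho^'-] --> gf y (ofR x) 0 j.
  exact: cvg_cst.
apply: (cvg_le x_cst y_lim_j).
apply: filterS2 (nbhs_left_gt xr) (nbhs_left_lt rho) => x' xx' x'r.
have := gf_increment_ge h_wf y_sol y_rad 0 x0 (ltW xx') x'r j.
by rewrite !expr0 subrr scale0r addr0.
Qed.

Lemma gf_neq_limit x : 0 < x -> x < rho -> gf y (ofR x) != tau.
Proof.
move=> x0 xr; have [k [j [k0 yk]]] := gf_coef_nonconstant y_sol y_rad.
pose x' := (x + rho) / 2.
have xx' : x < x' by rewrite /x'; lra.
have x'r : x' < rho by rewrite /x'; lra.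
apply: contra_neq yk => /rowP/(_ j) x_tau.
have := le_trans (gf_increment_ge h_wf y_sol y_rad k x0 (ltW xx') x'r j)
  (gf_le_limit (lt_trans x0 xx') x'r j).
have pow_lt : 0 < ofR x' ^+ k - ofR x ^+ k.
  by rewrite subr_gt0 ltrXn2r ?ofR_ge0 ?ltr_ofR ?(ltW x0) ?(ltW (lt_trans x0 xx')) -?lt0n.
rewrite [leLHS]mxE rowZE x_tau gerDl pmulr_rle0 // => yk_le0.
by apply/eqP; rewrite eq_le yk_le0 y_ge0.
Qed.

Lemma gf_limit_gt0 : (forall j, exists k, y k 0 j != 0) -> forall j, 0 < tau 0 j.
Proof.
move=> y_neq0 j; have [k yk] := y_neq0 j.
have x0 : 0 < rho / 2 by rewrite divr_gt0.
have xr : rho / 2 < rho by have := rho_gt0; lra.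
have x0' : 0 < ofR (rho / 2) by rewrite ofR_gt0.
apply: lt_le_trans (gf_le_limit x0 xr j).
apply: lt_le_trans (gf_trunc_le_gf h_wf y_sol y_rad x0 xr k.+1 j).
apply: lt_le_trans (gf_trunc_term_le h_wf y_sol k j (ltW x0')).
by rewrite mulr_gt0 ?exprn_gt0 // lt_neqAle eq_sym yk y_ge0.
Qed.

Hypothesis limit_dom : cvg_domain h (zY (ofR rho) tau).

Section Interior.
Variable x : R.
Hypotheses (x_gt0 : 0 < x) (x_lt : x < rho).

Lemma gf_point_ge0 : row_ge0 (gf_point y x).
Proof.
apply: zY_ge0; first by rewrite ofR_ge0 ltW.
exact: (gf_ge0 h_wf y_sol y_rad).
Qed.

Lemma gf_point_le : row_le (gf_point y x) (zY (ofR rho) tau).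
Proof. by apply: zY_le; [rewrite ler_ofR ltW|exact: gf_le_limit]. Qed.

Lemma gf_point_dom : cvg_domain h (gf_point y x).
Proof. exact: cvg_domain_row_le gf_point_ge0 gf_point_le limit_dom. Qed.

Lemma Hfun_gf_point : Hfun h (gf_point y x) = gf y (ofR x).
Proof.
have h_ge0 i a : 0 <= h i a by case: h_wf.
have x0 : 0 < ofR x by rewrite ofR_gt0.
apply: (limit_fixpoint h_ge0 (gf_solution_bigOXn y_sol) (gf_solution_fix y_sol)
  (gf_solution_origin_dom h_wf y_sol) y_ge0 x0).
  by move=> i; exact: (gf_trunc_cvg_interior y_rad).
exact: cvg_domain_cvg gf_point_dom.
Qed.

End Interior.

Lemma gf_point_cvg : gf_point y x @[x --> rho^'-] --> zY (ofR rho) tau.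
Proof.
apply: cvg_row; apply: zvar_Yvar_ind => [|j].
  rewrite zY_z; under eq_cvg do rewrite zY_z.
  by apply: cvg_at_left_filter; exact: continuous_ofR.
by rewrite zY_Y; under eq_cvg do rewrite zY_Y; exact: cvg_coord.
Qed.

Lemma dseries_gf_point_cvg al i : dseries al (h i) (gf_point y x) @[x --> rho^'-] -->
  dseries al (h i) (zY (ofR rho) tau).
Proof.
have al_cont := dseries_continuous (al := al) (i := i) limit_dom.
exact: (@cvg_comp _ _ _ (gf_point y) (dseries al (h i)) _ _ _ gf_point_cvg al_cont).
Qed.

Lemma Hfun_limit : Hfun h (zY (ofR rho) tau) = tau.
Proof.
apply/rowP => i; rewrite HfunE; have H_cvg := dseries_gf_point_cvg (al := mindex0) (i := i).
apply: (@norm_cvg_unique C C _ _ _ _ H_cvg).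
have gf_cvg : gf y (ofR x) 0 i @[x --> rho^'-] --> tau 0 i by exact: cvg_coord.
apply: cvg_trans gf_cvg; apply: near_eq_cvg.
apply: filterS2 (nbhs_left_gt rho_gt0) (nbhs_left_lt rho) => x x0 xr.
by rewrite -HfunE Hfun_gf_point.
Qed.

End AtSingularity.

(** * Systems independent of [z] or affine in [Y] *)

Section DegenerateSystems.
Context {R : realType} {m : nat}.
Local Notation C := (Cplx R).
Local Notation expo := {ffun 'I_(1 + m) -> nat}.
Implicit Types (z : C) (Y : 'rV[C]_m) (a : expo).

Definition dHdY_deriv (h : psystem R m) (k : 'I_(1 + m)) (p : 'rV[C]_(1 + m)) : 'M[C]_m :=
  \matrix_(i, j) dseries (mindexS k (mindexS (rshift 1 j) mindex0)) (h i) p.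

Definition Ydegree a := (\sum_j a (rshift 1 j))%N.

Lemma dmonomial0_zY a z Y : dmonomial mindex0 a (zY z Y) =
  z ^+ a (lshift m 0) * \prod_j Y 0 j ^+ a (rshift 1 j).
Proof.
rewrite dmonomial0 big_split_ord big_ord1 zY_z; congr (_ * _).
by apply: eq_bigr => j _; rewrite zY_Y.
Qed.

Lemma dmonomial_affine a z Y : (Ydegree a <= 1)%N ->
  dmonomial mindex0 a (zY z 0) +
    \sum_j Y 0 j * dmonomial (mindexS (rshift 1 j) mindex0) a (zY z Y) =
  dmonomial mindex0 a (zY z Y).
Proof.
move=> deg1; under eq_bigr do rewrite -(zY_Y z Y) mul_dmonomial_mindexS.
rewrite -mulr_suml -natr_sum -/(Ydegree a).
have [deg0|[j aj]] : Ydegree a = 0%N \/ exists j, (0 < a (rshift 1 j))%N.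
  have [/existsP|/existsPn a0] := boolP [exists j, (0 < a (rshift 1 j))%N]; first by right.
  by left; rewrite /Ydegree big1 // => j _; apply/eqP; rewrite -leqn0 leqNgt.
  rewrite deg0 mul0r addr0 !dmonomial0_zY; congr (_ * _); apply: eq_bigr => j _.
  have /eqP := deg0; rewrite sum_nat_eq0 => /forallP/(_ j)/eqP ->.
  by rewrite !expr0.
have deg1' : Ydegree a = 1%N.
  by apply/eqP; rewrite eqn_leq deg1 /Ydegree (bigD1 j) //= addn_gt0 aj.
rewrite deg1' mul1r dmonomial0_zY (bigD1 j) //= mxE expr0n eqn0Ngt aj.
by rewrite mul0r mulr0 add0r.
Qed.

Lemma Ydegree_gt1 a : (1 < Ydegree a)%N -> exists j k : 'I_m,
  forall v, (mindexS (rshift 1 k) (mindexS (rshift 1 j) mindex0) v <= a v)%N.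
Proof.
move=> deg2; have [j aj] : exists j, (0 < a (rshift 1 j))%N.
  apply/existsP; apply: contraTT deg2 => /existsPn a0.
  by rewrite -leqNgt /Ydegree big1 // => j _; apply/eqP; rewrite -leqn0 leqNgt.
have [k ak] : exists k, ((k == j) < a (rshift 1 k))%N.
  apply/existsP; apply: contraTT deg2 => /existsPn a_le.
  rewrite -leqNgt; apply: leq_trans (_ : \sum_k (k == j) <= 1)%N.
    by apply: leq_sum => k _; rewrite leqNgt.
  by rewrite (bigD1 j) //= eqxx big1 // => k /negPf ->.
exists j, k; apply: zvar_Yvar_ind => [|l]; rewrite /mindexS /mindex0 ?eq_lrshift //.
rewrite !eq_rshift add0n; have [->|lk] := eqVneq l k; first by rewrite addn1.
by rewrite addn0; case: eqVneq => [->|].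
Qed.

Lemma dseries_affine (c : expo -> C) z Y : (forall a, (1 < Ydegree a)%N -> c a = 0) ->
  dseries_cvg mindex0 c (zY z Y) ->
  (forall j, dseries_cvg (mindexS (rshift 1 j) mindex0) c (zY z Y)) ->
  dseries mindex0 c (zY z 0) +
    \sum_j Y 0 j * dseries (mindexS (rshift 1 j) mindex0) c (zY z Y) =
  dseries mindex0 c (zY z Y).
Proof.
move=> c_eq0 p_cvg dp_cvg; have q_cvg : dseries_cvg mindex0 c (zY z 0).
  apply/abs_convergentP; apply: abs_convergent_le; last by apply/abs_convergentP; exact: p_cvg.
  by apply: zvar_Yvar_ind => [|j]; rewrite ?zY_z ?zY_Y // mxE normr0.
have sum_cvg : (fun N => box_sum N (fun a => c a * dmonomial mindex0 a (zY z 0)) +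
    \sum_j Y 0 j *
      box_sum N (fun a => c a * dmonomial (mindexS (rshift 1 j) mindex0) a (zY z Y))) @ \oo -->
  dseries mindex0 c (zY z 0) +
    \sum_j Y 0 j * dseries (mindexS (rshift 1 j) mindex0) c (zY z Y).
  apply: cvgD; first exact: cvg_dseries.
  apply: (cvg_big (@add_continuous _)) => j _; apply: cvgMl_tmp.
  by apply: cvg_dseries; exact: dp_cvg.
apply: (@norm_cvg_unique C C _ _ _ _ sum_cvg).
apply: cvg_trans (cvg_dseries p_cvg); apply: near_eq_cvg; apply: nearW => N.
under eq_bigr do rewrite -box_sumZ.
rewrite /box_sum exchange_big -big_split /=; apply: eq_bigr => a _.
have [deg1|deg2] := leqP (Ydegree a) 1; last first.
  by rewrite (c_eq0 a deg2) !mul0r add0r big1 // => j _; rewrite mul0r mulr0.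
under eq_bigr do rewrite mulrCA.
by rewrite -mulr_sumr -mulrDr dmonomial_affine.
Qed.

Section PositivePoint.
Variables (h : psystem R m) (z : C) (Y : 'rV[C]_m).
Hypotheses (h_ge0 : forall i a, 0 <= h i a) (p_gt0 : forall v, 0 < zY z Y 0 v).
Hypothesis p_dom : cvg_domain h (zY z Y).

Let p_ge0 : row_ge0 (zY z Y).
Proof. by move=> v; exact: ltW. Qed.

Lemma Hfun_z_independent : usubmx (jacobian (Hfun h) (zY z Y)) = 0 -> forall z',
  system_cvg h (zY z' Y) /\ Hfun h (zY z' Y) = Hfun h (zY z Y).
Proof.
move=> dz0 z'; have h_eq0 i a : (0 < a (lshift m 0%R))%N -> h i a = 0.
  move=> a0; have z_cvg := cvg_domain_dseries_cvg (mindexS (lshift m 0) mindex0) i p_dom.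
  apply: (dseries_eq0_coef (h_ge0 i) p_gt0 z_cvg).
    by rewrite -jacobian_HfunE //; have /matrixP/(_ 0 i) := dz0; rewrite !mxE.
  by apply: zvar_Yvar_ind => [|j]; rewrite /mindexS ?eqxx // eq_rlshift.
have term_eq i : (fun a => h i a * dmonomial mindex0 a (zY z' Y)) =
    (fun a => h i a * dmonomial mindex0 a (zY z Y)).
  apply/funext => a; have [a0|a0] := posnP (a (lshift m 0)); last first.
    by rewrite (h_eq0 i a a0) !mul0r.
  by rewrite !dmonomial0_zY a0 !expr0.
split=> [i|]; last first.
  by apply/rowP => i; rewrite [LHS]HfunE [RHS]HfunE /dseries term_eq.
apply/abs_convergentP; rewrite /dseries_cvg term_eq.
exact: cvg_domain_dseries_cvg.
Qed.

Lemma Hfun_affine : (forall k, dHdY_deriv h (rshift 1 k) (zY z Y) = 0) ->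
  Hfun h (zY z 0) + Y *m (dHdY h (zY z Y))^T = Hfun h (zY z Y).
Proof.
move=> d2_0; have h_eq0 i a : (1 < Ydegree a)%N -> h i a = 0.
  move=> /Ydegree_gt1[j [k a_ge]].
  have d2_cvg := cvg_domain_dseries_cvg (mindexS (rshift 1 k) (mindexS (rshift 1 j) mindex0))
    i p_dom.
  apply: (dseries_eq0_coef (h_ge0 i) p_gt0 d2_cvg _ a_ge).
  by have /matrixP/(_ i j) := d2_0 k; rewrite !mxE.
apply/rowP => i; rewrite [LHS]mxE [X in _ + X]mxE [in LHS]HfunE [RHS]HfunE.
under eq_bigr do rewrite mxE dHdYE //.
apply: dseries_affine (h_eq0 i) _ _ => [|j]; exact: cvg_domain_dseries_cvg.
Qed.

End PositivePoint.
End DegenerateSystems.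

(** * The characteristic system *)

Section CharacteristicJacobian.
Context {R : realType} {m : nat}.
Local Notation C := (Cplx R).
Variable h : psystem R m.

(* The derivative of [det (Id - dH/dY)] with respect to the variable [k]. *)
Definition char_det_deriv (k : 'I_(1 + m)) (p : 'rV[C]_(1 + m)) : C :=
  \sum_i \sum_j - dHdY_deriv h k p i j * cofactor (1%:M - dHdY h p) i j.

Section TaylorDomain.
Variable D : set 'rV[C]_(1 + m).
Hypothesis D_taylor : taylor_domain h D.

Lemma taylor2_on_1sub_dHdY i j : taylor2_on D (fun p => (1%:M - dHdY h p) i j)
  (fun k p => - dHdY_deriv h k p i j).
Proof.
case: D_taylor => D_dom _ _ taylor.
have := taylor2_onB (taylor2_on_cst D (1%:M i j : C)) (taylor i (mindexS (rshift 1 j) mindex0)).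
apply: taylor2_on_ext => [p Dp|k p Dp]; last by rewrite mxE sub0r.
by rewrite -dHdYE ?[RHS]mxE ?[X in _ = _ + X]mxE //; exact: D_dom.
Qed.

Lemma taylor2_on_char_det :
  taylor2_on D (fun p => \det (1%:M - dHdY h p)) (fun k p => char_det_deriv k p).
Proof. exact: taylor2_on_det taylor2_on_1sub_dHdY. Qed.

Lemma taylor2_on_char_cofactor i j :
  exists g, taylor2_on D (fun p => cofactor (1%:M - dHdY h p) i j) g.
Proof.
eexists; rewrite /cofactor; apply: taylor2_onM; first exact: taylor2_on_cst.
apply: taylor2_on_det => k l.
apply: taylor2_on_ext (taylor2_on_1sub_dHdY (lift i k) (lift j l)) => // p _.
by rewrite [RHS]mxE [RHS]mxE.
Qed.

Lemma taylor2_on_char_det_deriv k : exists g, taylor2_on D (char_det_deriv k) g.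
Proof.
case: D_taylor => _ _ _ taylor.
have /choice[g gP] : forall ij : 'I_m * 'I_m, exists g,
    taylor2_on D (fun p => - dHdY_deriv h k p ij.1 ij.2 * cofactor (1%:M - dHdY h p) ij.1 ij.2) g.
  move=> [i j] /=; have [g cof_g] := taylor2_on_char_cofactor i j; eexists.
  apply: taylor2_onM cof_g.
  have := taylor2_onB (taylor2_on_cst D (0 : C))
    (taylor i (mindexS k (mindexS (rshift 1 j) mindex0))).
  by apply: (taylor2_on_ext _ (fun _ _ _ => erefl)) => p _; rewrite mxE sub0r.
eexists; apply: taylor2_on_sum => i; apply: taylor2_on_sum => j.
exact: (gP (i, j)).
Qed.

End TaylorDomain.

Definition var_index (k : 'I_(m + 1)) : 'I_(1 + m) :=
  match fintype.split k with inl j => rshift 1 j | inr _ => lshift m 0 end.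

Lemma var_index_Y j : var_index (lshift 1 j) = rshift 1 j.
Proof. by rewrite /var_index (unsplitK (inl j : 'I_m + 'I_1)). Qed.

Lemma var_index_z : var_index (rshift m 0) = lshift m 0.
Proof. by rewrite /var_index (unsplitK (inr 0 : 'I_m + 'I_1)). Qed.

Lemma Yz_ind (P : 'I_(m + 1) -> Prop) :
  (forall j, P (lshift 1 j)) -> P (rshift m 0) -> forall k, P k.
Proof. by move=> PY Pz k; case: (split_ordP k) => l -> //; rewrite (ord1 l). Qed.

Lemma var_index_bij : bijective var_index.
Proof.
exists (fun v => match fintype.split v with inl _ => rshift m 0 | inr j => lshift 1 j end).
  apply: Yz_ind => [j|]; first by rewrite var_index_Y (unsplitK (inr j : 'I_1 + 'I_m)).
  by rewrite var_index_z (unsplitK (inl 0 : 'I_1 + 'I_m)).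
apply: zvar_Yvar_ind => [|j].
  by rewrite (unsplitK (inl 0 : 'I_1 + 'I_m)) var_index_z.
by rewrite (unsplitK (inr j : 'I_1 + 'I_m)) var_index_Y.
Qed.

Lemma zY_of_YzE (x : 'rV[C]_(m + 1)) k : zY_of_Yz x 0 (var_index k) = x 0 k.
Proof.
by move: k; apply: Yz_ind => [j|]; rewrite ?var_index_Y ?var_index_z ?zY_z ?zY_Y mxE.
Qed.

Lemma zY_of_Yz_row (z : C) (Y : 'rV[C]_m) : zY_of_Yz (row_mx Y z%:M) = zY z Y.
Proof. by rewrite /zY_of_Yz row_mxKl row_mxKr mxE. Qed.

Lemma zY_of_Yz_continuous : continuous (@zY_of_Yz R m).
Proof.
apply: (lipschitz_continuous ler01) => x x'; rewrite mul1r.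
exact: ler_norm_reindex var_index_bij zY_of_YzE _ _.
Qed.

Lemma char_system_Y x j : char_system h x 0 (lshift 1 j) =
  x 0 (lshift 1 j) - Hfun h (zY_of_Yz x) 0 j.
Proof. by rewrite row_mxEl rowBE mxE. Qed.

Lemma char_system_z x : char_system h x 0 (rshift m 0) = \det (1%:M - dHdY h (zY_of_Yz x)).
Proof. by rewrite row_mxEr [LHS]mxE mulr1n. Qed.

(* Transposed, as [jacobian] acts on row vectors. *)
Definition char_jac (x : 'rV[C]_(m + 1)) : 'M[C]_(m + 1) :=
  let p := zY_of_Yz x in
  block_mx (1%:M - dHdY h p)^T (\col_k char_det_deriv (rshift 1 k) p)
    (- usubmx (jacobian (Hfun h) p)) (char_det_deriv (lshift m 0) p)%:M.

Lemma char_jac_Y x k j : char_jac x k (lshift 1 j) =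
  (k == lshift 1 j)%:R - jacobian (Hfun h) (zY_of_Yz x) (var_index k) j.
Proof.
rewrite /char_jac; move: k; apply: Yz_ind => [k|].
  by rewrite block_mxEul var_index_Y (inj_eq (@lshift_inj _ _)) !mxE eq_sym.
by rewrite block_mxEdl var_index_z eq_rlshift sub0r 2!mxE.
Qed.

Lemma char_jac_z x k : char_jac x k (rshift m 0) = char_det_deriv (var_index k) (zY_of_Yz x).
Proof.
rewrite /char_jac; move: k; apply: Yz_ind => [k|].
  by rewrite block_mxEur var_index_Y mxE.
by rewrite block_mxEdr var_index_z mxE.
Qed.

Section CharacteristicTaylor.
Variable D : set 'rV[C]_(1 + m).
Hypothesis D_taylor : taylor_domain h D.

Lemma taylor2_on_Yz_coord k :
  taylor2_on (@zY_of_Yz R m @^-1` D) (fun x => x 0 k) (fun k' _ => (k' == k)%:R).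
Proof.
case: D_taylor => _ /(_ (var_index k))[M DM] _ _.
by apply: (taylor2_on_coord (M := M)) => x /DM; rewrite zY_of_YzE.
Qed.

Lemma taylor2_on_char_system :
  taylor2_on_rV (@zY_of_Yz R m @^-1` D) (char_system h) char_jac.
Proof.
apply: Yz_ind => [j|].
  have := taylor2_onB (taylor2_on_Yz_coord (lshift 1 j))
    (taylor2_on_reindex var_index_bij zY_of_YzE (taylor2_on_Hfun D_taylor j)).
  apply: taylor2_on_ext => [x _|k x _]; first by rewrite char_system_Y.
  by rewrite char_jac_Y.
have := taylor2_on_reindex var_index_bij zY_of_YzE (taylor2_on_char_det D_taylor).
apply: taylor2_on_ext => [x _|k x _]; first by rewrite char_system_z.
by rewrite char_jac_z.
Qed.

Lemma taylor2_on_char_jac k l :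
  exists g, taylor2_on (@zY_of_Yz R m @^-1` D) (fun x => char_jac x k l) g.
Proof.
have reindex_taylor f g := @taylor2_on_reindex _ _ _ _ _ var_index_bij zY_of_YzE D f g.
move: l; apply: Yz_ind => [j|].
  have [g /reindex_taylor J_g] := taylor2_on_jacobian_Hfun D_taylor (var_index k) j.
  eexists; have := taylor2_onB (taylor2_on_cst _ (k == lshift 1 j)%:R) J_g.
  by apply: (taylor2_on_ext _ (fun _ _ _ => erefl)) => x _; rewrite char_jac_Y.
have [g /reindex_taylor det_g] := taylor2_on_char_det_deriv D_taylor (var_index k).
eexists; apply: (taylor2_on_ext _ (fun _ _ _ => erefl) det_g) => x _.
by rewrite char_jac_z.
Qed.

End CharacteristicTaylor.
End CharacteristicJacobian.

(** * The characteristic point *)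

Section RealPart.
Context {R : realType}.

Definition Re_mx {p q} (A : 'M[Cplx R]_(p, q)) : 'M[R]_(p, q) := map_mx (@complex.Re R) A.

Lemma Re_mxK p q (A : 'M[Cplx R]_(p, q)) : mx_ge0 A -> map_mx (@ofR R) (Re_mx A) = A.
Proof. by move=> A0; apply/matrixP => i j; rewrite !mxE -ge0_ofR_Re. Qed.

Lemma Re_mx_ge0 p q (A : 'M[Cplx R]_(p, q)) : mx_ge0 A -> mx_ge0 (Re_mx A).
Proof. by move=> A0 i j; rewrite mxE; exact: Re_ge0. Qed.

Lemma Re_mx_neq0 p q (A : 'M[Cplx R]_(p, q)) : mx_ge0 A -> A != 0 -> Re_mx A != 0.
Proof. by move=> A0; apply: contra_neq => ReA0; rewrite -(Re_mxK A0) ReA0 map_mx0. Qed.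

Lemma Re_mxM p q r (A : 'M[Cplx R]_(p, q)) (B : 'M[Cplx R]_(q, r)) :
  mx_ge0 A -> mx_ge0 B -> Re_mx (A *m B) = Re_mx A *m Re_mx B.
Proof.
move=> A0 B0; apply: (@map_mx_inj _ _ (@ofR R)); rewrite map_mxM !Re_mxK //.
exact: mulmx_ge0.
Qed.

Lemma Re_mx_subinvariant n (A : 'M[Cplx R]_n) (d : 'rV[Cplx R]_n) :
  mx_ge0 A -> mx_ge0 d -> mx_le (A *m d^T) d^T ->
  mx_le (Re_mx A *m (Re_mx d)^T) (Re_mx d)^T.
Proof.
move=> A0 d0 Ad i j; rewrite map_trmx -Re_mxM // => [|k l]; last by rewrite mxE.
by have := Ad i j; rewrite lecE => /andP[_]; rewrite !(mxE, map_trmx).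
Qed.

Lemma Re_mx_close p q (A B : 'M[Cplx R]_(p, q)) (e : R) i j :
  mx_ge0 A -> mx_ge0 B -> `|A i j - B i j| < ofR e -> Re_mx A i j <= Re_mx B i j + e.
Proof.
move=> A0 B0; rewrite (ge0_ofR_Re (A0 i j)) (ge0_ofR_Re (B0 i j)) -rmorphB normr_ofR ltr_ofR.
by rewrite !mxE ltr_norml => /andP[_]; lra.
Qed.

End RealPart.

Section CharacteristicPoint.
Context {R : realType} {m : nat}.
Local Notation C := (Cplx R).
Variables (h : psystem R m) (y : nat -> 'rV[C]_m) (rho : R) (tau : 'rV[C]_m).
Hypotheses (h_irr : irreducible_system h) (y_sol : gf_solution h y).
Hypothesis y_rad : cvg_radius y = rho%:E.
Hypothesis y_lim : gf y (ofR x) @[x --> rho^'-] --> tau.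
Hypothesis limit_dom : cvg_domain h (zY (ofR rho) tau).

Let crit := zY (ofR rho) tau.
Let A := Re_mx (dHdY h crit).

Let h_wf : well_founded_system h.
Proof. by case: h_irr. Qed.

Let h_ge0 i a : 0 <= h i a.
Proof. by case: h_wf. Qed.

Let rho_gt0 : 0 < rho.
Proof. exact: gf_radius_gt0 y_sol y_rad. Qed.

Let tau_gt0 j : 0 < tau 0 j.
Proof.
by apply: (gf_limit_gt0 h_wf y_sol y_rad y_lim); case: h_irr => _ zero_free _ _; exact: zero_free.
Qed.

Let tau_ge0 : row_ge0 tau.
Proof. by move=> j; exact/ltW/tau_gt0. Qed.

Let crit_gt0 v : 0 < crit 0 v.
Proof.
by move: v; apply: zvar_Yvar_ind => [|j]; rewrite ?zY_z ?zY_Y // ofR_gt0.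
Qed.

Let crit_ge0 : row_ge0 crit.
Proof. by move=> v; exact/ltW/crit_gt0. Qed.

Let H_crit : Hfun h crit = tau.
Proof. exact: (Hfun_limit h_wf y_sol y_rad y_lim limit_dom). Qed.

Let dHdY_crit : dHdY h crit = map_mx (@ofR R) A.
Proof. by rewrite Re_mxK //; exact: dHdY_ge0. Qed.

Lemma dHdY_limit_ge0 : mx_ge0 A.
Proof. by apply: Re_mx_ge0; exact: dHdY_ge0. Qed.

Lemma dHdY_limit_irreducible : irreducible_mx A.
Proof.
case: h_irr => _ _ _ sc i j; apply: connect_sub (sc i j) => k l /= /asboolP kl.
apply: connect1 => /=; rewrite -ofR_gt0 mxE -ge0_ofR_Re; last exact: dHdY_ge0.
exact: (dHdY_gt0 h_ge0 crit_gt0 limit_dom kl).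
Qed.

Lemma dHdY_limit_close (e : R) : 0 < e -> \forall x \near rho^'-,
  forall i j, A i j <= Re_mx (dHdY h (gf_point y x)) i j + e.
Proof.
move=> e0; have e0' : 0 < ofR e by rewrite ofR_gt0.
have near_ij : \forall x \near rho^'-, forall ij : 'I_m * 'I_m,
    `|dseries (mindexS (rshift 1 ij.2) mindex0) (h ij.1) crit -
      dseries (mindexS (rshift 1 ij.2) mindex0) (h ij.1) (gf_point y x)| < ofR e.
  apply: filter_forall => -[i j] /=.
  have := dseries_gf_point_cvg y_lim limit_dom (al := mindexS (rshift 1 j) mindex0) (i := i).
  by move=> /cvgrPdist_lt; apply.
apply: filterS3 (nbhs_left_gt rho_gt0) (nbhs_left_lt rho) near_ij => x x0 xr close i j.
have x_dom := gf_point_dom h_wf y_sol y_rad y_lim limit_dom x0 xr.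
have x_ge0 := gf_point_ge0 h_wf y_sol y_rad x0 xr.
have := close (i, j); rewrite /= -(dHdYE _ _ limit_dom) -(dHdYE _ _ x_dom).
by apply: Re_mx_close; exact: dHdY_ge0.
Qed.

(* [tau - gf y x] is subinvariant for the matrix at [x], which tends to [A]. *)
Lemma dHdY_limit_near_subinvariant (e : R) : 0 < e ->
  exists v : 'rV[R]_m, [/\ mx_ge0 v, \sum_i v 0 i = 1 &
    forall i, (A *m v^T) i 0 <= v 0 i + e].
Proof.
move=> e0; near rho^'- => x.
have x0 : 0 < x by near: x; exact: nbhs_left_gt.
have xr : x < rho by near: x; exact: nbhs_left_lt.
have close : forall i j, A i j <= Re_mx (dHdY h (gf_point y x)) i j + e.
  by near: x; exact: dHdY_limit_close.
have d0 : mx_ge0 (tau - gf y (ofR x)).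
  by move=> i j; rewrite (ord1 i) rowBE subr_ge0 (gf_le_limit h_wf y_sol y_rad y_lim).
apply: (near_subinvariant_normalize close (d := Re_mx (tau - gf y (ofR x)))).
- exact: Re_mx_ge0.
- apply: Re_mx_neq0 => //; rewrite subr_eq0 eq_sym.
  exact: (gf_neq_limit h_wf y_sol y_rad y_lim).
have x_dom := gf_point_dom h_wf y_sol y_rad y_lim limit_dom x0 xr.
have x_ge0 := gf_point_ge0 h_wf y_sol y_rad x0 xr.
apply: Re_mx_subinvariant => //; first exact: dHdY_ge0.
have x0' : 0 <= ofR x by rewrite ofR_ge0 ltW.
have xr' : ofR x <= ofR rho by rewrite ler_ofR ltW.
apply: (fixpoint_gap_subinvariant h_ge0 x0' xr' _ _ limit_dom _ H_crit).
- exact: (gf_ge0 h_wf y_sol y_rad).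
- exact: (gf_le_limit h_wf y_sol y_rad y_lim).
- exact: (Hfun_gf_point h_wf y_sol y_rad y_lim limit_dom).
Unshelve. all: by end_near.
Qed.

Lemma dHdY_limit_subinvariant : exists2 w : 'cV[R]_m, mx_gt0 w & mx_le (A *m w) w.
Proof.
have [w [w0 w_neq0 Aw]] := subinvariant_limit dHdY_limit_near_subinvariant.
exists w => //; apply: subinvariant_gt0 Aw => //; first exact: dHdY_limit_ge0.
exact: dHdY_limit_irreducible.
Qed.

(* Otherwise [H] would have a supersolution beyond the radius of convergence. *)
Lemma dHdY_limit_singular : \det (1%:M - A) = 0.
Proof.
apply/eqP/negPn/negP => det_neq0; have [w w0 Aw] := dHdY_limit_subinvariant.
have [v v0 vA] := subinvariant_solve dHdY_limit_ge0 w0 Aw det_neq0.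
have v0' : mx_ge0 (map_mx (@ofR R) v) by move=> i j; rewrite mxE ofR_ge0.
have vA' : map_mx (@ofR R) v - dHdY h crit *m map_mx (@ofR R) v = const_mx 1.
  by rewrite dHdY_crit -map_mxM -map_mxB vA; apply/matrixP => i j; rewrite !mxE.
have rho0 : 0 <= ofR rho by rewrite ofR_ge0 ltW.
have [z [Z [rho_z Z_super]]] :=
  supersolution_beyond h_ge0 rho0 tau_ge0 limit_dom H_crit v0' vA'.
have zE := ge0_ofR_Re (le_trans rho0 (ltW rho_z)).
move: rho_z Z_super; rewrite zE ltr_ofR => rho_z.
exact: (no_supersolution_beyond_radius h_wf y_sol y_rad rho_z).
Qed.

Lemma dHdz_limit_neq0 : usubmx (jacobian (Hfun h) crit) != 0.
Proof.
apply/eqP => dz0.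
have [z_cvg Hz] := Hfun_z_independent h_ge0 crit_gt0 limit_dom dz0 (ofR (rho + 1)).
apply: (no_supersolution_beyond_radius h_wf y_sol y_rad (r := rho + 1) (Z := tau)).
  by rewrite ltrDl.
by split; [exact: tau_ge0|exact: z_cvg|rewrite Hz H_crit => j].
Qed.

Lemma dHdY_limit_invariant_vectors : exists (w : 'cV[R]_m) (u : 'rV[R]_m),
  [/\ mx_gt0 w, A *m w = w, mx_gt0 u & u *m A = u].
Proof.
have [w w0 Aw] := dHdY_limit_subinvariant; have A0 := dHdY_limit_ge0.
have A_irr := dHdY_limit_irreducible; have det0 := dHdY_limit_singular.
have [u u0 uA] := left_invariant_gt0 A0 A_irr w0 Aw det0.
by exists w, u; split=> //; exact: (subinvariant_invariant A0 A_irr w0 Aw det0).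
Qed.

(* The left invariant vector [u] annihilates [H(rho, 0) = tau - A tau]. *)
Lemma affine_Hfun_origin_eq0 : (forall k, dHdY_deriv h (rshift 1 k) crit = 0) ->
  system_cvg h (zY (ofR rho) 0) /\ Hfun h (zY (ofR rho) 0) = 0.
Proof.
move=> d2_0; have [w [u [_ _ u0 uA]]] := dHdY_limit_invariant_vectors.
have H_affine : Hfun h (zY (ofR rho) 0) = tau *m (1%:M - dHdY h crit)^T.
  have -> : tau *m (1%:M - dHdY h crit)^T = Hfun h crit - tau *m (dHdY h crit)^T.
    by rewrite H_crit linearB /= trmx1 mulmxBr mulmx1.
  by rewrite -(Hfun_affine h_ge0 crit_gt0 limit_dom d2_0) addrK.
have origin_ge0 : row_ge0 (zY (ofR rho) 0 : 'rV[C]_(1 + m)).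
  by apply: zY_ge0 => [|j]; [rewrite ofR_ge0 ltW|rewrite mxE].
have origin_cvg : system_cvg h (zY (ofR rho) 0).
  apply: (system_cvg_row_le origin_ge0 (q := crit)); last exact: cvg_domain_cvg.
  by apply: zY_le => // j; rewrite mxE tau_ge0.
split=> //; apply/eqP; rewrite -trmx_eq0; apply/negPn/negP => H0_neq0.
have u0' : mx_gt0 (map_mx (@ofR R) u) by move=> i j; rewrite mxE ofR_gt0.
have H0_ge0 : mx_ge0 (Hfun h (zY (ofR rho) 0))^T.
  by move=> i j; rewrite mxE (ord1 j); exact: Hfun_ge0.
have := mulmx_gt0 u0' H0_ge0 H0_neq0.
rewrite H_affine trmx_mul trmxK dHdY_crit -(map_mx1 (@ofR R)) -map_mxB mulmxA -map_mxM.
by rewrite mulmxBr mulmx1 uA subrr map_mx0 mul0mx mxE ltxx.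
Qed.

(* If [H] is affine in [Y] at [z = rho], then [0] is a supersolution and [y] vanishes. *)
Lemma dHdY_deriv_limit_neq0 : exists k, dHdY_deriv h (rshift 1 k) crit != 0.
Proof.
apply: contrapT => d2_0.
have [k|origin_cvg H0] := affine_Hfun_origin_eq0.
  by apply/eqP/negPn/negP => d2k; apply: d2_0; exists k.
have zero_super : supersolution h (ofR rho) 0.
  by split=> // j; rewrite ?H0 // mxE.
have [k [j [_ /eqP]]] := gf_coef_nonconstant y_sol y_rad; apply.
have rho0 : 0 < ofR rho by rewrite ofR_gt0.
have [_ /(_ j)] := gf_solution_trunc_le h_wf y_sol k.+1 rho0 zero_super.
rewrite mxE => /(le_trans (gf_trunc_term_le h_wf y_sol k j (ltW rho0))).
rewrite pmulr_rle0 ?exprn_gt0 // => yk_le0.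
by apply/eqP; rewrite eq_le yk_le0 (gf_solution_ge0 h_wf y_sol).
Qed.

Let zeta : 'rV[C]_(m + 1) := row_mx tau (ofR rho)%:M.

Let one_sub_dHdY : 1%:M - dHdY h crit = map_mx (@ofR R) (1%:M - A).
Proof. by rewrite map_mxB map_mx1 dHdY_crit. Qed.

Lemma char_system_zero : char_system h zeta = 0.
Proof.
apply/rowP; apply: Yz_ind => [j|]; rewrite [RHS]mxE.
  by rewrite char_system_Y zY_of_Yz_row H_crit row_mxEl subrr.
by rewrite char_system_z zY_of_Yz_row one_sub_dHdY det_map_mx dHdY_limit_singular rmorph0.
Qed.

Let dHdY_deriv_ge0 k : mx_ge0 (dHdY_deriv h k crit).
Proof.
by move=> i j; rewrite mxE; apply: dseries_ge0 => //; exact: cvg_domain_dseries_cvg.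
Qed.

Let dHdz_ge0 : mx_ge0 (usubmx (jacobian (Hfun h) crit)).
Proof. by move=> i j; rewrite mxE; exact: jacobian_Hfun_ge0. Qed.

Let b := Re_mx (usubmx (jacobian (Hfun h) crit)).
Let B i j : 'cV[R]_m := \col_k Re_mx (dHdY_deriv h (rshift 1 k) crit) i j.
Let c k := \sum_i \sum_j - Re_mx (dHdY_deriv h k crit) i j * cofactor (1%:M - A) i j.

Lemma char_det_deriv_real k : char_det_deriv h k crit = ofR (c k).
Proof.
rewrite rmorph_sum; apply: eq_bigr => i _; rewrite rmorph_sum; apply: eq_bigr => j _.
rewrite one_sub_dHdY cofactor_map_mx [RHS]rmorphM rmorphN -{1}(Re_mxK (dHdY_deriv_ge0 k)).
by rewrite [X in - X * _]mxE.
Qed.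

Lemma char_jac_real : char_jac h zeta = map_mx (@ofR R)
  (block_mx (1%:M - A)^T (\col_k c (rshift 1 k)) (- b) (c (lshift m 0))%:M).
Proof.
rewrite /char_jac zY_of_Yz_row map_block_mx -map_trmx -one_sub_dHdY map_mxN Re_mxK //.
rewrite map_scalar_mx char_det_deriv_real; congr (block_mx _ _ _ _).
by apply/colP => k; rewrite mxE char_det_deriv_real [RHS]mxE mxE.
Qed.

Lemma char_det_deriv_contraction :
  \col_k c (rshift 1 k) = - \sum_i \sum_j cofactor (1%:M - A) i j *: B i j.
Proof.
apply/colP => k; rewrite [LHS]mxE [RHS]mxE summxE -sumrN; apply: eq_bigr => i _.
rewrite summxE -sumrN; apply: eq_bigr => j _.
by rewrite [X in _ = - X]mxE [X in _ = - (_ * X)]mxE mulNr mulrC.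
Qed.

Lemma char_jac_unitmx : char_jac h zeta \in unitmx.
Proof.
have A0 : mx_ge0 A := dHdY_limit_ge0; have A_irr := dHdY_limit_irreducible.
have det0 := dHdY_limit_singular.
have [w [u [w0 Aw u0 uA]]] := dHdY_limit_invariant_vectors.
have b_neq0 : b != 0 by apply: Re_mx_neq0 dHdz_limit_neq0.
have B_ge0 i j : mx_ge0 (B i j) by move=> k l; rewrite mxE; exact: Re_mx_ge0.
have B_neq0 : exists i j, B i j != 0.
  have [k /(Re_mx_neq0 (dHdY_deriv_ge0 _))/matrix0Pn[i [j dk]]] := dHdY_deriv_limit_neq0.
  by exists i, j; apply/cV0Pn; exists k; rewrite mxE.
rewrite char_jac_real map_unitmx.
apply: (bordered_unitmx A0 A_irr w0 Aw u0 uA det0) => //; first exact: Re_mx_ge0.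
rewrite char_det_deriv_contraction mulmxN mxE oppr_eq0.
exact: (adj_contraction_neq0 A0 A_irr w0 Aw u0 uA det0).
Qed.

End CharacteristicPoint.

Unset Implicit Arguments.
Set Strict Implicit.

Theorem theorem4p6 (R : realType) (m : nat) (h : psystem R m)
    (y : nat -> 'rV[Cplx R]_m) (rho : R) (tau : 'rV[Cplx R]_m) :
  irreducible_system h ->
  gf_solution h y ->
  cvg_radius y = rho%:E ->
  gf y (ofR x) @[x --> rho^'-] --> tau ->
  cvg_domain h (zY (ofR rho) tau) ->
  let zeta : 'rV[Cplx R]_(m + 1) := row_mx tau (ofR rho)%:M in
  exists2 V : set 'rV[Cplx R]_(m + 1),
    nbhs zeta V &
    newton_cvg_quadratically [set x | cvg_domain h (zY_of_Yz x)] (char_system h) V zeta.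
Proof.
move=> h_irr y_sol y_rad y_lim limit_dom zeta.
have [D zeta_D D_taylor] := cvg_domain_taylor_domain limit_dom.
have zeta_E : nbhs zeta (zY_of_Yz @^-1` D).
  by apply: zY_of_Yz_continuous; rewrite zY_of_Yz_row.
have [V zeta_V newton_V] := newton_cvg_quadratically_near (taylor2_on_char_system D_taylor)
  (taylor2_on_char_jac D_taylor) zeta_E
  (char_system_zero h_irr y_sol y_rad y_lim limit_dom)
  (char_jac_unitmx h_irr y_sol y_rad y_lim limit_dom).
exists V => //; apply: newton_cvg_quadraticallyW newton_V => x Dx.
by case: D_taylor => D_dom _ _ _; exact: D_dom.
Qed.
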